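(* Let $A$ and $B$ be associative rings, let $L^\bullet$ be a pseudo-dualizing complex of $A$-$B$-bimodules situated in the cohomological degrees $-d_1\le m\le d_2$, and let $l_1\ge d_1$ be an integer. Then the lower pseudo-coderived category of left $A$-modules $\mathsf D'_{L^\bullet}(A\text{-mod})=\mathsf D(\mathsf E_{l_1})$ and the lower pseudo-contraderived category of left $B$-modules $\mathsf D''_{L^\bullet}(B\text{-mod})=\mathsf D(\mathsf F_{l_1})$ have Hom sets.
   Context: $A\text{-mod}$ denotes left $A$-modules, $\text{mod-}B$ right $B$-modules. Pseudo-dualizing complex of $A$-$B$-bimodules: a finite complex $L^\bullet$ of $A$-$B$-bimodules such that (ii) as a complex of left $A$-modules $L^\bullet$ is quasi-isomorphic to a bounded above complex of finitely generated projective left $A$-modules, and as a complex of right $B$-modules it is quasi-isomorphic to a bounded above complex of finitely generated projective right $B$-modules; (iii) the homothety maps $A\to\mathrm{Hom}_{\mathsf D^b(\text{mod-}B)}(L^\bullet,L^\bullet[*])$ and $B^{op}\to\mathrm{Hom}_{\mathsf D^b(A\text{-mod})}(L^\bullet,L^\bullet[*])$ are isomorphisms of graded rings. Notation: $\mathrm{Ext}^n_A(L^\bullet,M)=H^n\mathbb R\mathrm{Hom}_A(L^\bullet,M)$, $\mathrm{Tor}^B_n(L^\bullet,N)=H^{-n}(L^\bullet\otimes_B^{\mathbb L}N)$. $\mathsf E_{l_1}\subset A\text{-mod}$ consists of all $E$ with $\mathrm{Ext}_A^n(L^\bullet,E)=0$ for $n>l_1$ such that the adjunction morphism $L^\bullet\otimes_B^{\mathbb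 L}\mathbb R\mathrm{Hom}_A(L^\bullet,E)\to E$ is an isomorphism in $\mathsf D^-(A\text{-mod})$. $\mathsf F_{l_1}\subset B\text{-mod}$ consists of all $F$ with $\mathrm{Tor}^B_n(L^\bullet,F)=0$ for $n>l_1$ such that the adjunction morphism $F\to\mathbb R\mathrm{Hom}_A(L^\bullet,L^\bullet\otimes_B^{\mathbb L}F)$ is an isomorphism in $\mathsf D^+(B\text{-mod})$. Both are closed under extensions and carry the inherited exact structures. For an exact category $\mathsf G$, $\mathsf D(\mathsf G)$ is the Verdier quotient of $\mathsf{Hot}(\mathsf G)$ (unbounded complexes up to homotopy) by the complexes homotopy equivalent to complexes spliced from short exact sequences in $\mathsf G$. ''Has Hom sets'' means that morphisms between any fixed pair of objects of the Verdier quotient category form a set (in the fixed universe in which the rings and modules live), rather than a proper class. *)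

(* Defs.v *)
From HB Require Import structures.
From mathcomp Require Import all_boot all_order all_algebra.
From mathcomp Require Import boolp.
From mathcomp Require Import zify.
Set Implicit Arguments.
Unset Strict Implicit.
Unset Printing Implicit Defensive.
Import Order.TTheory GRing.Theory Num.Theory.
Local Open Scope ring_scope.
Local Open Scope quotient_scope.
#[local] Obligation Tactic := idtac.

(* Rings are associative and unital, possibly zero.  Left R-modules are
   [lmodType R]; right B-modules are left modules over the opposite ring
   [B^c].  Complexes are cohomologically graded by [int]. *)

Section Sign.
Variable V : zmodType.
Implicit Types (m n : int) (x y : V).

Definition sg n x : V := if odd `|n|%N then - x else x.

Lemma sgD n x y : sg n (x + y) = sg n x + sg n y.
Proof. by rewrite /sg; case: ifP => // _; rewrite opprD. Qed.

Lemma sgN n x : sg n (- x) = - sg n x.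
Proof. by rewrite /sg; case: ifP. Qed.

Lemma sg0 n : sg n 0 = 0.
Proof. by rewrite /sg oppr0 if_same. Qed.

Lemma sgK n x : sg n (sg n x) = x.
Proof. by rewrite /sg; case: (odd _) => //; rewrite opprK. Qed.

Lemma odd_abszD m n : odd `|(m + n)%R|%N = odd `|m|%N (+) odd `|n|%N.
Proof. by lia. Qed.

Lemma odd_abszM m n : odd `|(m * n)%R|%N = odd `|m|%N && odd `|n|%N.
Proof. by rewrite abszM oddM. Qed.

Lemma odd_abszN n : odd `|(- n)%R|%N = odd `|n|%N.
Proof. by rewrite abszN. Qed.

Lemma sg_add m n x : sg (m + n) x = sg m (sg n x).
Proof.
by rewrite /sg odd_abszD; case: (odd `|m|%N); case: (odd _) => //=; rewrite opprK.
Qed.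

Lemma addN_eq0 x y : x = y -> - x + y = 0.
Proof. by move=> ->; rewrite addNr. Qed.

Lemma addr_cancel x y z t : x = z -> y = t -> x + (y - z) = t.
Proof. by move=> -> ->; rewrite addrC subrK. Qed.

Lemma addr_cancel' x y z t : x = z -> t = y -> t = x + y - z.
Proof. by move=> -> ->; rewrite addrC addKr. Qed.

Lemma sg1 x : sg 1 x = - x. Proof. by []. Qed.

Lemma sg_odd m n x : odd `|m|%N = odd `|n|%N -> sg m x = sg n x.
Proof. by rewrite /sg => ->. Qed.

End Sign.

Lemma sg_morph (U V : zmodType) (f : U -> V) :
  {morph f : x / - x} -> forall n, {morph f : x / sg n x}.
Proof. by move=> fN n x; rewrite /sg; case: ifP. Qed.

Section SignLin.
Variables (R : pzRingType) (U V : lmodType R).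

Lemma sg_lin (f : {linear U -> V}) n x : f (sg n x) = sg n (f x).
Proof. by apply: (sg_morph (f := f)) => y; rewrite linearN. Qed.

Lemma sgZ n a (x : U) : sg n (a *: x) = a *: sg n x.
Proof. by rewrite /sg; case: ifP => // _; rewrite scalerN. Qed.
End SignLin.

Section Transport.
Variables (R : pzRingType) (C : int -> lmodType R).

Definition tr i j (e : i = j) : C i -> C j :=
  match e in _ = k return C i -> C k with erefl => id end.

Lemma tr_linear i j (e : i = j) : linear (tr e).
Proof. by case: j / e. Qed.
HB.instance Definition _ i j (e : i = j) :=
  GRing.isLinear.Build R (C i) (C j) *:%R (tr e) (tr_linear e).

Lemma tr_id i (e : i = i) x : tr e x = x.
Proof. by rewrite (eq_irrelevance e erefl). Qed.

Lemma tr_tr i j k (e : i = j) (e' : j = k) x :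
  tr e' (tr e x) = tr (etrans e e') x.
Proof. by case: k / e'. Qed.

Lemma tr_irr i j (e e' : i = j) x : tr e x = tr e' x.
Proof. by rewrite (eq_irrelevance e e'). Qed.
End Transport.

Section Complexes.
Variable R : pzRingType.

Record complex := Complex {
  cobj :> int -> lmodType R;
  cd : forall i, {linear cobj i -> cobj (i + 1)};
  cdd : forall i x, cd (i + 1) (cd i x) = 0 }.

Lemma cd_tr (C : complex) (i j : int) (e : i = j) (e' : i + 1 = j + 1) (x : C i) :
  cd C j (tr e x) = tr e' (cd C i x).
Proof. by move: e'; case: j / e => e'; rewrite !tr_id. Qed.

Record chain_map (C D : complex) := ChainMap {
  cmap :> forall i, {linear C i -> D i};
  cmap_d : forall i x, cmap (i + 1) (cd C i x) = cd D i (cmap i x) }.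

Lemma cmap_tr (C D : complex) (f : chain_map C D) (i j : int) (e : i = j) (x : C i) :
  f j (tr e x) = tr e (f i x).
Proof. by case: j / e. Qed.

Definition id_map (C : complex) : chain_map C C :=
  @ChainMap C C (fun i => idfun : {linear C i -> C i}) (fun i x => erefl).

Program Definition comp_map (C D E : complex)
    (g : chain_map D E) (f : chain_map C D) : chain_map C E :=
  @ChainMap C E (fun i => (g i \o f i : {linear C i -> E i})) _.
Next Obligation. by move=> C D E g f i x /=; rewrite !cmap_d. Qed.

Program Definition zero_map (C D : complex) : chain_map C D :=
  @ChainMap C D (fun i => (\0 : {linear C i -> D i})) _.
Next Obligation. by move=> C D i x /=; rewrite linear0. Qed.

Definition homotopic (C D : complex) (f g : chain_map C D) : Prop :=
  exists h : forall i, {linear C (i + 1) -> D i},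
  forall i x,
    f (i + 1) x - g (i + 1) x = cd D i (h i x) + h (i + 1) (cd C (i + 1) x).

Definition homotopy_equivalent (C D : complex) : Prop :=
  exists (f : chain_map C D) (g : chain_map D C),
    homotopic (comp_map g f) (id_map C) /\ homotopic (comp_map f g) (id_map D).

Section Cone.
Variables (C D : complex) (f : chain_map C D).

Definition cone_obj (i : int) : lmodType R := (C (i + 1)%R * D i)%type.

Definition cone_d i (u : cone_obj i) : cone_obj (i + 1) :=
  (- cd C (i + 1) u.1, f (i + 1) u.1 + cd D i u.2).

Lemma cone_d_linear i : linear (@cone_d i).
Proof.
move=> a u v; congr pair => /=; first by rewrite linearP opprD -scalerN.
by rewrite !linearP scalerDr addrACA.
Qed.
HB.instance Definition _ i :=
  GRing.isLinear.Build R (cone_obj i) (cone_obj (i + 1)) *:%R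
    (@cone_d i) (@cone_d_linear i).

Lemma cone_dd i u : cone_d (@cone_d i u) = 0.
Proof.
congr pair => /=; first by rewrite linearN cdd oppr0 oppr0.
by rewrite linearD cdd addr0 linearN cmap_d addNr.
Qed.

Definition cone : complex := @Complex cone_obj (fun i => @cone_d i) cone_dd.
End Cone.

Section Shift.
Variables (C : complex) (n : int).

Definition shift_obj (i : int) : lmodType R := C (i + n).

Definition shift_d i (x : shift_obj i) : shift_obj (i + 1) :=
  sg n (tr (addrAC i n 1) (cd C (i + n) x)).

Lemma shift_d_linear i : linear (@shift_d i).
Proof. by move=> a x y; rewrite /shift_d !linearP sgD sgZ. Qed.
HB.instance Definition _ i :=
  GRing.isLinear.Build R (shift_obj i) (shift_obj (i + 1)) *:%R
    (@shift_d i) (@shift_d_linear i).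

Lemma shift_dd i x : shift_d (@shift_d i x) = 0.
Proof.
rewrite /shift_d sg_lin (cd_tr _ (congr1 (+%R^~ 1) (addrAC i n 1))).
by rewrite cdd linear0 sg0 linear0 sg0.
Qed.

Definition shift : complex := @Complex shift_obj (fun i => @shift_d i) shift_dd.
End Shift.

Definition coboundary (C : complex) n (x : C n) : Prop :=
  exists m (e : m + 1 = n) (y : C m), x = tr e (cd C m y).

Definition cohomology_zero (C : complex) (n : int) : Prop :=
  forall x : C n, cd C n x = 0 -> coboundary x.

Definition acyclic (C : complex) : Prop := forall n, cohomology_zero C n.

(* the two conjuncts are injectivity and surjectivity of H^n(f) *)
Definition qiso (C D : complex) (f : chain_map C D) : Prop :=
  forall n,
    (forall x : C n, cd C n x = 0 -> coboundary (f n x) -> coboundary x) /\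
    (forall y : D n, cd D n y = 0 ->
       exists2 x : C n, cd C n x = 0 & coboundary (y - f n x)).

Definition quasi_isomorphic (C D : complex) : Prop :=
  exists (Z : complex) (f : chain_map Z C) (g : chain_map Z D),
    qiso f /\ qiso g.

Definition zero_module (M : lmodType R) : Prop := forall x : M, x = 0.

Definition concentrated (C : complex) (a b : int) : Prop :=
  forall i, ~~ (a <= i <= b) -> zero_module (C i).

Definition bounded (C : complex) : Prop := exists a b, concentrated C a b.

Definition bounded_above (C : complex) : Prop :=
  exists b, forall i, b < i -> zero_module (C i).

Definition bounded_below (C : complex) : Prop :=
  exists a, forall i, i < a -> zero_module (C i).

Definition surj (T U : Type) (f : T -> U) : Prop :=
  forall y, exists x, f x = y.

Definition projective (P : lmodType R) : Prop :=
  forall (M N : lmodType R) (g : {linear M -> N}) (f : {linear P -> N}),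
    surj g -> exists h : {linear P -> M}, forall x, g (h x) = f x.

Definition injective_module (J : lmodType R) : Prop :=
  forall (M N : lmodType R) (g : {linear M -> N}) (f : {linear M -> J}),
    injective g -> exists h : {linear N -> J}, forall x, h (g x) = f x.

Definition finitely_generated (M : lmodType R) : Prop :=
  exists (k : nat) (g : 'I_k -> M),
    forall x, exists c : 'I_k -> R, x = \sum_(i < k) c i *: g i.

Definition injective_resolution (M : lmodType R) (J : complex)
    (eta : {linear M -> J 0}) : Prop :=
  [/\ forall i, injective_module (J i),
      forall i, i < 0 -> zero_module (J i),
      injective eta,
      forall x : J 0, cd J 0 x = 0 <-> exists m, x = eta m &
      forall n, n != 0 -> cohomology_zero J n].

Definition projective_resolution (M : lmodType R) (P : complex)
    (eps : {linear P 0 -> M}) : Prop :=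
  [/\ forall i, projective (P i),
      forall i, 0 < i -> zero_module (P i),
      surj eps,
      forall x : P 0, eps x = 0 <-> coboundary x &
      forall n, n != 0 -> cohomology_zero P n].

(* The Verdier quotient K/Ac of a full triangulated subcategory K of the
   homotopy category by a full triangulated subcategory Ac, both given as
   predicates on complexes.  Its morphisms X -> Y are the equivalence classes
   of fractions X <-s- Z -f-> Y with Z in K and cone(s) in Ac. *)
Section Verdier.
Variables K Ac : complex -> Prop.

Record roof (X Y : complex) := Roof {
  roof_mid : complex;
  roof_midK : K roof_mid;
  roof_den : chain_map roof_mid X;
  roof_denP : Ac (cone roof_den);
  roof_num : chain_map roof_mid Y }.

Definition roof_equiv (X Y : complex) (r r' : roof X Y) : Prop :=
  exists (W : complex) (w : chain_map W X)
         (u : chain_map W (roof_mid r)) (v : chain_map W (roof_mid r')),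
    [/\ K W, Ac (cone w),
        homotopic (comp_map (roof_den r) u) w,
        homotopic (comp_map (roof_den r') v) w &
        homotopic (comp_map (roof_num r) u) (comp_map (roof_num r') v)].

(* The universe annotation is the point of the definition: fractions between X
   and Y form a type of the next universe, whereas [H] is required to lie in
   the universe of the carriers of modules. *)
Definition has_Hom_sets : Prop :=
  forall X Y : complex, K X -> K Y ->
  exists (H : Type@{GRing.Lmodule.axioms_.u0}) (cls : roof X Y -> H),
    surj cls /\ forall r r', cls r = cls r' <-> roof_equiv r r'.
End Verdier.

Lemma acyclic_cone_id (X : complex) : acyclic (cone (id_map X)).
Proof.
move=> n [x y] /= /(congr1 snd) /= exy.
exists (n - 1), (subrK 1 n).
have e : n = n - 1 + 1 by rewrite subrK.
exists (tr (C := X) e y, 0).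
have key m (e1 : m + 1 = n) (e2 : n = m + 1) :
  (x, y) = tr (C := cone (id_map X)) e1 (cone_d (id_map X)
    (tr (C := X) e2 y, 0 : X m)).
  case: n / e1 x y e2 exy {e} => x y e2 exy.
  rewrite /cone_d /= tr_id linear0 addr0; congr pair.
  by apply/eqP; rewrite -subr_eq0 opprK; apply/eqP.
exact: key.
Qed.

(* Hom in D^b(R-mod), the localization of bounded complexes by acyclic ones *)
Definition Db_roof := roof bounded acyclic.

Definition Db_of_map (X Y : complex) (bX : bounded X) (f : chain_map X Y) :
    Db_roof X Y :=
  @Roof bounded acyclic X Y X bX (id_map X) (@acyclic_cone_id X) f.

(* [G] is a class of modules closed under extensions, with the exact structure
   inherited from the category of modules. *)
Section ExactSubcategory.
Variable G : lmodType R -> Prop.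

Definition terms_in (C : complex) : Prop := forall i, G (C i).

Definition spliced (C : complex) : Prop :=
  exists (Z : int -> lmodType R) (j : forall i, {linear Z i -> C i})
         (p : forall i, {linear C i -> Z (i + 1)}),
  forall i,
    [/\ G (Z i) /\ G (C i), injective (j i), surj (p i),
        forall x, p i x = 0 <-> exists z, x = j i z &
        forall x, cd C i x = j (i + 1) (p i x)].

Definition Ac (C : complex) : Prop :=
  terms_in C /\ exists C', spliced C' /\ homotopy_equivalent C C'.

Definition derived_category_has_Hom_sets : Prop := has_Hom_sets terms_in Ac.
End ExactSubcategory.

End Complexes.

Record bimod (A B : pzRingType) := Bimod {
  bmod :> lmodType A;
  ract : bmod -> B -> bmod;
  ractDl : forall x y b, ract (x + y) b = ract x b + ract y b;
  ractDr : forall x b c, ract x (b + c) = ract x b + ract x c;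
  ractM : forall x b c, ract x (b * c) = ract (ract x b) c;
  ract1 : forall x, ract x 1 = x;
  ractZ : forall a x b, ract (a *: x) b = a *: ract x b }.

Section RightModule.
Variables (A B : pzRingType) (M : bimod A B).

Definition rmod : Type := bmod M.
HB.instance Definition _ := GRing.Zmodule.on rmod.

Definition rscale (b : B^c) (x : rmod) : rmod := ract (x : bmod M) b.

Lemma rscaleA b c x : rscale b (rscale c x) = rscale (b * c) x.
Proof. by rewrite /rscale -ractM. Qed.
Lemma rscale1 : left_id 1 rscale.
Proof. exact: ract1. Qed.
Lemma rscaleDr : right_distributive rscale +%R.
Proof. by move=> b x y; apply: ractDl. Qed.
Lemma rscaleDl x : {morph rscale^~ x : b c / b + c}.
Proof. by move=> b c; apply: ractDr. Qed.

HB.instance Definition _ :=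
  GRing.Zmodule_isLmodule.Build B^c rmod rscaleA rscale1 rscaleDr rscaleDl.

Lemma ract0 (b : B) : ract (0 : M) b = 0.
Proof. by apply: (addrI (ract (0 : M) b)); rewrite -ractDl !addr0. Qed.

Lemma ractN (x : M) b : ract (- x) b = - ract x b.
Proof. by apply: (addrI (ract x b)); rewrite -ractDl !subrr ract0. Qed.
End RightModule.

Record bicomplex (A B : pzRingType) := Bicomplex {
  bobj :> int -> bimod A B;
  bd : forall i, {linear bobj i -> bobj (i + 1)};
  bd_ract : forall i x b, bd i (ract x b) = ract (bd i x) b;
  bdd : forall i x, bd (i + 1) (bd i x) = 0 }.

Section Underlying.
Variables (A B : pzRingType) (L : bicomplex A B).

Definition lcomplex : complex A :=
  @Complex A (fun i => bmod (L i)) (fun i => bd L i) (@bdd A B L).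

Definition rbd i (x : rmod (L i)) : rmod (L (i + 1)) := bd L i x.

Lemma rbd_linear i : linear (@rbd i).
Proof. by move=> b x y; rewrite /rbd linearD; congr (_ + _); apply: bd_ract. Qed.
HB.instance Definition _ i :=
  GRing.isLinear.Build B^c (rmod (L i)) (rmod (L (i + 1))) *:%R
    (@rbd i) (@rbd_linear i).

Definition rcomplex : complex B^c :=
  @Complex B^c (fun i => rmod (L i)) (fun i => @rbd i) (@bdd A B L).

Definition lmult (a : A) i (x : rmod (L i)) : rmod (L i) :=
  a *: (x : bmod (L i)).

Lemma lmult_linear a i : linear (@lmult a i).
Proof.
move=> b x y; rewrite /lmult scalerDr; congr (_ + _).
by symmetry; apply: ractZ.
Qed.
HB.instance Definition _ a i :=
  GRing.isLinear.Build B^c (rmod (L i)) (rmod (L i)) *:%R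
    (@lmult a i) (@lmult_linear a i).

Program Definition left_homothety (a : A) : chain_map rcomplex rcomplex :=
  @ChainMap _ rcomplex rcomplex (fun i => (@lmult a i : {linear _ -> _})) _.
Next Obligation.
by move=> a i x; rewrite /= /lmult /rbd; symmetry; apply: linearZ.
Qed.

Definition rmult (b : B) i (x : L i) : L i := ract x b.

Lemma rmult_linear b i : linear (@rmult b i).
Proof. by move=> a x y; rewrite /rmult ractDl ractZ. Qed.
HB.instance Definition _ b i :=
  GRing.isLinear.Build A (L i) (L i) *:%R (@rmult b i) (@rmult_linear b i).

Program Definition right_homothety (b : B) : chain_map lcomplex lcomplex :=
  @ChainMap _ lcomplex lcomplex (fun i => (@rmult b i : {linear _ -> _})) _.
Next Obligation. by move=> b i x; rewrite /= /rmult bd_ract. Qed.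

End Underlying.

(* A homothety map S -> Hom_{D^b}(X, X[*]) takes values in degree 0 and is
   always a homomorphism of graded rings, so that it is an isomorphism exactly
   when it is bijective in degree 0 and the target vanishes in all the other
   degrees. *)
Definition homothety_iso (R : pzRingType) (S : Type) (X : complex R)
    (bX : bounded X) (h : S -> chain_map X X) : Prop :=
  (forall r : Db_roof X X, exists! s, roof_equiv r (Db_of_map bX (h s))) /\
  (forall n : int, n != 0 -> forall r : Db_roof X (shift X n),
     roof_equiv r (Db_of_map bX (zero_map X (shift X n)))).

Definition perfect_above (R : pzRingType) (X : complex R) : Prop :=
  exists P : complex R,
    [/\ bounded_above P,
        forall i, finitely_generated (P i) /\ projective (P i) &
        quasi_isomorphic X P].

Record pseudo_dualizing (A B : pzRingType) (L : bicomplex A B) : Prop := {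
  pd_lbounded : bounded (lcomplex L);
  pd_rbounded : bounded (rcomplex L);
  pd_lperfect : perfect_above (lcomplex L);
  pd_rperfect : perfect_above (rcomplex L);
  pd_left : homothety_iso pd_rbounded (left_homothety L);
  pd_right : homothety_iso pd_lbounded (right_homothety L) }.

Section HomComplex.
Variables (A B : pzRingType) (L : bicomplex A B) (J : complex A).

Section Degree.
Variable n : int.

Record cochain := Cochain {
  coch :> forall p, L p -> J (p + n);
  coch_linear : forall p, linear (@coch p) }.
Arguments coch : clear implicits.

HB.instance Definition _ := gen_eqMixin cochain.
HB.instance Definition _ := gen_choiceMixin cochain.

HB.instance Definition _ (f : cochain) p :=
  GRing.isLinear.Build A (L p) (J (p + n)) *:%R (coch f p)
    (@coch_linear f p).

Lemma cochainP (f g : cochain) : (forall p x, f p x = g p x) -> f = g.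
Proof.
case: f g => [f fl] [g gl] /= fg.
have E : f = g by apply: functional_extensionality_dep => p; apply: funext.
by case: g / E gl {fg} => gl; congr Cochain; apply: Prop_irrelevance.
Qed.

Program Definition cochain0 : cochain := @Cochain (fun p x => 0) _.
Next Obligation. by move=> p a x y; rewrite scaler0 addr0. Qed.

Program Definition cochainN (f : cochain) : cochain :=
  @Cochain (fun p x => - f p x) _.
Next Obligation. by move=> f p a x y; rewrite linearP opprD scalerN. Qed.

Program Definition cochainD (f g : cochain) : cochain :=
  @Cochain (fun p x => f p x + g p x) _.
Next Obligation.
by move=> f g p a x y; rewrite !linearP scalerDr addrACA.
Qed.

Program Definition cochainZ (b : B) (f : cochain) : cochain :=
  @Cochain (fun p x => f p (ract x b)) _.
Next Obligation. by move=> b f p a x y; rewrite ractDl ractZ linearP. Qed.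

Lemma cochainDA : associative cochainD.
Proof. by move=> f g h; apply: cochainP => p x; apply: addrA. Qed.
Lemma cochainDC : commutative cochainD.
Proof. by move=> f g; apply: cochainP => p x; apply: addrC. Qed.
Lemma cochain0D : left_id cochain0 cochainD.
Proof. by move=> f; apply: cochainP => p x; apply: add0r. Qed.
Lemma cochainND : left_inverse cochain0 cochainN cochainD.
Proof. by move=> f; apply: cochainP => p x; apply: addNr. Qed.
HB.instance Definition _ :=
  GRing.isZmodule.Build cochain cochainDA cochainDC cochain0D cochainND.

Lemma cochainZA b c f : cochainZ b (cochainZ c f) = cochainZ (b * c) f.
Proof. by apply: cochainP => p x /=; rewrite ractM. Qed.
Lemma cochain1Z : left_id 1 cochainZ.
Proof. by move=> f; apply: cochainP => p x /=; rewrite ract1. Qed.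
Lemma cochainZDr : right_distributive cochainZ +%R.
Proof. by move=> b f g; apply: cochainP. Qed.
Lemma cochainZDl f : {morph cochainZ^~ f : b c / b + c}.
Proof. by move=> b c; apply: cochainP => p x /=; rewrite ractDr linearD. Qed.
HB.instance Definition _ :=
  GRing.Zmodule_isLmodule.Build B cochain
    cochainZA cochain1Z cochainZDr cochainZDl.

End Degree.
Arguments coch {n} c p x.

(* d(f)(x) = d(f(x)) - (-1)^n f(d(x)) *)
Definition hom_d_fun n (f : cochain n) p (x : L p) : J (p + (n + 1)) :=
  tr (esym (addrA p n 1)) (cd J (p + n) (f p x))
  - sg n (tr (etrans (esym (addrA p 1 n)) (congr1 (+%R p) (addrC 1 n)))
             (f (p + 1) (bd L p x))).

Program Definition hom_d n (f : cochain n) : cochain (n + 1) :=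
  @Cochain (n + 1) (fun p x => hom_d_fun f x) _.
Next Obligation.
move=> n f p a x y; rewrite /hom_d_fun !linearP sgD sgZ opprD scalerBr.
by rewrite addrACA.
Qed.

Lemma hom_d_linear n : linear (@hom_d n).
Proof.
move=> b f g; apply: cochainP => p x /=; rewrite /hom_d_fun /=.
by rewrite bd_ract !linearD sgD opprD addrACA.
Qed.
HB.instance Definition _ n :=
  GRing.isLinear.Build B (cochain n) (cochain (n + 1)) *:%R
    (@hom_d n) (@hom_d_linear n).

Lemma hom_dd n f : hom_d (@hom_d n f) = 0.
Proof.
apply: cochainP => p x /=; rewrite /hom_d_fun /= /hom_d_fun.
rewrite bdd [f _ 0]linear0 [tr _ 0]linear0 sg0 subr0 linearB.
rewrite (cd_tr _ (congr1 (+%R^~ 1) (esym (addrA p n 1)))) cdd linear0 sub0r.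
rewrite sg_lin (cd_tr _ (congr1 (+%R^~ 1)
  (etrans (esym (addrA p 1 n)) (congr1 (+%R p) (addrC 1 n))))).
rewrite linearN sg_lin sg_add sg1 sgN opprK; apply: addN_eq0; congr (sg n _).
apply: etrans (tr_tr _ _ _) (etrans _ (esym (tr_tr _ _ _))); exact: tr_irr.
Qed.

Definition Hom_complex : complex B :=
  @Complex B (fun n => cochain n : lmodType B) (fun n => @hom_d n) hom_dd.

End HomComplex.

Lemma coch_tr (A B : pzRingType) (L : bicomplex A B) (J : complex A)
    (m n : int) (e : m = n) (f : cochain L J m) p (x : L p) :
  (tr (C := Hom_complex L J) e f : cochain L J n) p x
  = tr (congr1 (+%R p) e) (f p x).
Proof. by case: n / e. Qed.

(* \bigoplus_(i : int) M_i (x)_B N_i, as the abelian group with generators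
   x (x) y for x in some M_i and y in the corresponding N_i, subject to
   biadditivity and xb (x) y = x (x) by.  The elements are represented by words
   in signed generators, [true] standing for the sign -. *)
Section Tensor.
Variables (A B : pzRingType).
Variables (M : int -> bimod A B) (N : int -> lmodType B).

Definition gen : Type := {i : int & (M i * N i)%type}.
Definition word : Type := seq (bool * gen).

Definition gpair i (x : M i) (y : N i) : gen := existT _ i (x, y).

Inductive word_rel : word -> word -> Prop :=
| wr_refl s : word_rel s s
| wr_sym s t : word_rel s t -> word_rel t s
| wr_trans s t u : word_rel s t -> word_rel t u -> word_rel s u
| wr_cat s s' t t' :
    word_rel s s' -> word_rel t t' -> word_rel (s ++ t) (s' ++ t')
| wr_comm s t : word_rel (s ++ t) (t ++ s)
| wr_inv b g : word_rel [:: (b, g); (~~ b, g)] [::]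
| wr_addl i (x x' : M i) (y : N i) :
    word_rel [:: (false, gpair (x + x') y)]
             [:: (false, gpair x y); (false, gpair x' y)]
| wr_addr i (x : M i) (y y' : N i) :
    word_rel [:: (false, gpair x (y + y'))]
             [:: (false, gpair x y); (false, gpair x y')]
| wr_balanced i (x : M i) (b : B) (y : N i) :
    word_rel [:: (false, gpair (ract x b) y)] [:: (false, gpair x (b *: y))].

HB.instance Definition _ := gen_eqMixin word.
HB.instance Definition _ := gen_choiceMixin word.

Definition word_relb (s t : word) : bool := `[< word_rel s t >].

Lemma word_relb_equiv : equiv_class_of word_relb.
Proof.
split=> [s | s t | t s u].
- by apply/asboolP; apply: wr_refl.
- by apply/asboolP/asboolP => /wr_sym.
- by move=> /asboolP st /asboolP tu; apply/asboolP; apply: wr_trans st tu.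
Qed.
Canonical word_equiv : equiv_rel word := EquivRelPack word_relb_equiv.

Definition tensor : Type := {eq_quot word_equiv}.
HB.instance Definition _ := Choice.on tensor.

Definition tclass (s : word) : tensor := \pi_({eq_quot word_equiv}) s.
Definition trepr (t : tensor) : word := repr (t : {eq_quot word_equiv}).

Lemma tclassP s t : tclass s = tclass t <-> word_rel s t.
Proof.
split=> [/eqquotP/asboolP // | st].
by apply/eqquotP/asboolP.
Qed.

Lemma treprK t : tclass (trepr t) = t.
Proof. exact: reprK. Qed.

Lemma trepr_rel s : word_rel (trepr (tclass s)) s.
Proof. by apply/tclassP; rewrite treprK. Qed.

Definition negw (s : word) : word := [seq (~~ g.1, g.2) | g <- s].

Lemma wr_negw s : word_rel (s ++ negw s) [::].
Proof.
elim: s => [|[b g] s IHs] /=; first exact: wr_refl.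
apply: wr_trans (wr_inv b g).
apply: (@wr_cat [:: (b, g)] [:: (b, g)] _ [:: (~~ b, g)]).
  exact: wr_refl.
apply: (@wr_trans _ ([:: (~~ b, g)] ++ (negw s ++ s))).
  exact: (wr_comm s ((~~ b, g) :: negw s)).
rewrite -[X in word_rel _ X]cats0; apply: wr_cat; first exact: wr_refl.
by apply: wr_trans IHs; apply: wr_comm.
Qed.

Lemma wr_neg s t : word_rel s t -> word_rel (negw s) (negw t).
Proof.
move=> st.
have h1 : word_rel (negw s) (negw s ++ (t ++ negw t)).
  rewrite -[X in word_rel X _]cats0; apply: wr_cat; first exact: wr_refl.
  by apply: wr_sym; apply: wr_negw.
apply: wr_trans h1 _; rewrite catA.
rewrite -[X in word_rel _ X]cat0s; apply: wr_cat; last exact: wr_refl.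
apply: wr_trans (wr_comm _ _) _; apply: wr_trans (wr_negw s).
by apply: wr_cat; [apply: wr_sym | apply: wr_refl].
Qed.

Definition gscale (a : A) (g : gen) : gen :=
  gpair (a *: (projT2 g).1) (projT2 g).2.

Definition scalew (a : A) (s : word) : word :=
  [seq (g.1, gscale a g.2) | g <- s].

Lemma wr_scale a s t : word_rel s t -> word_rel (scalew a s) (scalew a t).
Proof.
elim=> {s t} /=.
- by move=> s; apply: wr_refl.
- by move=> s t _; apply: wr_sym.
- by move=> s t u _ h1 _; apply: wr_trans.
- by move=> s s' t t' _ h1 _ h2; rewrite /scalew !map_cat; apply: wr_cat.
- by move=> s t; rewrite /scalew !map_cat; apply: wr_comm.
- by move=> b g; apply: wr_inv.
- by move=> i x x' y; rewrite /gscale /= scalerDr; apply: wr_addl.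
- by move=> i x y y'; apply: wr_addr.
- by move=> i x b y; rewrite /gscale /= -ractZ; apply: wr_balanced.
Qed.

Definition tadd (s t : tensor) : tensor := tclass (trepr s ++ trepr t).
Definition topp (s : tensor) : tensor := tclass (negw (trepr s)).
Definition tscale (a : A) (s : tensor) : tensor := tclass (scalew a (trepr s)).

Lemma tadd_class s t : tadd (tclass s) (tclass t) = tclass (s ++ t).
Proof. by apply/tclassP; apply: wr_cat; apply: trepr_rel. Qed.
Lemma topp_class s : topp (tclass s) = tclass (negw s).
Proof. by apply/tclassP; apply: wr_neg; apply: trepr_rel. Qed.
Lemma tscale_class a s : tscale a (tclass s) = tclass (scalew a s).
Proof. by apply/tclassP; apply: wr_scale; apply: trepr_rel. Qed.

Lemma taddA : associative tadd.
Proof.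
move=> s t u; rewrite -[s]treprK -[t]treprK -[u]treprK.
by rewrite !tadd_class catA.
Qed.
Lemma taddC : commutative tadd.
Proof. by move=> s t; apply/tclassP; apply: wr_comm. Qed.
Lemma tadd0 : left_id (tclass [::]) tadd.
Proof. by move=> s; rewrite -[s]treprK tadd_class. Qed.
Lemma taddN : left_inverse (tclass [::]) topp tadd.
Proof.
move=> s; rewrite taddC -[s]treprK topp_class tadd_class.
by apply/tclassP; apply: wr_negw.
Qed.
HB.instance Definition _ := GRing.isZmodule.Build tensor taddA taddC tadd0 taddN.

Lemma tclassD s t : tclass (s ++ t) = tclass s + tclass t.
Proof. by symmetry; apply: tadd_class. Qed.

Definition tpure i (x : M i) (y : N i) : tensor :=
  tclass [:: (false, gpair x y)].

Lemma tclass_cons b g s :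
  tclass ((b, g) :: s) =
  (if b then - tpure (projT2 g).1 (projT2 g).2
   else tpure (projT2 g).1 (projT2 g).2) + tclass s.
Proof.
case: g => i [x y] /=; rewrite -cat1s tclassD; congr (_ + _).
by case: b => //; symmetry; apply: topp_class.
Qed.

Lemma tscaleA a b s : tscale a (tscale b s) = tscale (a * b) s.
Proof.
rewrite -[s]treprK !tscale_class /scalew -map_comp; congr tclass.
by apply: eq_map => -[c [i [x y]]] /=; rewrite /gscale /= scalerA.
Qed.
Lemma tscale1 : left_id 1 tscale.
Proof.
move=> s; rewrite -[s]treprK tscale_class; congr tclass.
rewrite -[RHS]map_id; apply: eq_map => -[c [i [x y]]].
by rewrite /gscale /= scale1r.
Qed.
Lemma tscaleDr : right_distributive tscale +%R.
Proof.
move=> a s t; rewrite -[s]treprK -[t]treprK -tclassD !tscale_class -tclassD.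
by rewrite /scalew map_cat.
Qed.
Lemma tscaleDl s : {morph tscale^~ s : a b / a + b}.
Proof.
move=> a b; rewrite -[s]treprK !tscale_class.
elim: (trepr s) => [|[c [i [x y]]] w IHw] /=; first by rewrite addr0.
rewrite !tclass_cons /= {}IHw addrACA; congr (_ + _).
have -> : tpure ((a + b) *: x) y = tpure (a *: x) y + tpure (b *: x) y.
  by rewrite scalerDl -tclassD; apply/tclassP; apply: wr_addl.
by case: c => //; rewrite opprD.
Qed.
HB.instance Definition _ :=
  GRing.Zmodule_isLmodule.Build A tensor tscaleA tscale1 tscaleDr tscaleDl.

Lemma tpureDl i (x x' : M i) (y : N i) :
  tpure (x + x') y = tpure x y + tpure x' y.
Proof. by rewrite -tclassD; apply/tclassP; apply: wr_addl. Qed.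
Lemma tpureDr i (x : M i) (y y' : N i) :
  tpure x (y + y') = tpure x y + tpure x y'.
Proof. by rewrite -tclassD; apply/tclassP; apply: wr_addr. Qed.
Lemma tpure_ract i (x : M i) b (y : N i) :
  tpure (ract x b) y = tpure x (b *: y).
Proof. by apply/tclassP; apply: wr_balanced. Qed.
Lemma tpureZ a i (x : M i) (y : N i) : tpure (a *: x) y = a *: tpure x y.
Proof. by symmetry; apply: tscale_class. Qed.

Lemma tpure0l i (y : N i) : tpure (0 : M i) y = 0.
Proof. by apply: (addrI (tpure (0 : M i) y)); rewrite -tpureDl !addr0. Qed.
Lemma tpure0r i (x : M i) : tpure x (0 : N i) = 0.
Proof. by apply: (addrI (tpure x (0 : N i))); rewrite -tpureDr !addr0. Qed.

Section Lift.
Variables (V : lmodType A) (f : forall i, M i -> N i -> V).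

Record balanced : Prop := Balanced {
  bal_Dl : forall i x x' y, @f i (x + x') y = f x y + f x' y;
  bal_Dr : forall i x y y', @f i x (y + y') = f x y + f x y';
  bal_ract : forall i x b y, @f i (ract x b) y = f x (b *: y);
  bal_Z : forall i a x y, @f i (a *: x) y = a *: f x y }.

Definition eval_gen (g : bool * gen) : V :=
  if g.1 then - f (projT2 g.2).1 (projT2 g.2).2
  else f (projT2 g.2).1 (projT2 g.2).2.

Definition eval_word (s : word) : V := \sum_(g <- s) eval_gen g.

Hypothesis fB : balanced.

Lemma eval_word_rel s t : word_rel s t -> eval_word s = eval_word t.
Proof.
rewrite /eval_word; elim=> {s t} //=.
- by move=> s t u _ -> _ ->.
- by move=> s s' t t' _ h1 _ h2; rewrite !big_cat /= h1 h2.
- by move=> s t; rewrite !big_cat /= addrC.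
- move=> b g; rewrite !big_cons big_nil addr0 /eval_gen /=.
  by case: b => /=; rewrite ?subrr ?addNr.
- by move=> i x x' y; rewrite !big_cons big_nil !addr0 /eval_gen /= bal_Dl.
- by move=> i x y y'; rewrite !big_cons big_nil !addr0 /eval_gen /= bal_Dr.
- by move=> i x b y; rewrite !big_cons big_nil !addr0 /eval_gen /= bal_ract.
Qed.

Definition tlift_fun of balanced := fun s : tensor => eval_word (trepr s).

Lemma tlift_class s : tlift_fun fB (tclass s) = eval_word s.
Proof. by apply: eval_word_rel; apply: trepr_rel. Qed.

Lemma tlift_linear : linear (tlift_fun fB).
Proof.
move=> a s t; rewrite -[s]treprK -[t]treprK.
have -> w w' : a *: tclass w + tclass w' = tclass (scalew a w ++ w').
  by rewrite tclassD; congr (_ + _); apply: tscale_class.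
rewrite !tlift_class /eval_word big_cat /=; congr (_ + _).
rewrite big_map scaler_sumr; apply: eq_bigr => -[b [i [x y]]] _.
by rewrite /eval_gen /= bal_Z // ; case: b => //; rewrite scalerN.
Qed.
HB.instance Definition _ :=
  GRing.isLinear.Build A tensor V *:%R (tlift_fun fB) tlift_linear.

Definition tlift : {linear tensor -> V} := tlift_fun fB.

Lemma tlift_pure i (x : M i) (y : N i) : tlift (tpure x y) = f x y.
Proof. by rewrite [LHS]tlift_class /eval_word big_seq1. Qed.
End Lift.

Lemma tensor_ext (V : lmodType A) (f g : {linear tensor -> V}) :
  (forall i (x : M i) (y : N i), f (tpure x y) = g (tpure x y)) -> f =1 g.
Proof.
move=> fg s; rewrite -[s]treprK.
elim: (trepr s) => [|[b [i [x y]]] w IHw].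
  by rewrite -[tclass [::]]/(0 : tensor) !linear0.
rewrite tclass_cons !linearD IHw; congr (_ + _).
by case: b; rewrite /= ?linearN fg.
Qed.

End Tensor.

Lemma subr_succ (n p : int) : n - p = n + 1 - (p + 1).
Proof. lia. Qed.

Lemma subr_succr (n p : int) : n - p + 1 = n + 1 - p.
Proof. lia. Qed.

Section TensorComplex.
Variables (A B : pzRingType) (L : bicomplex A B) (P : complex B).

Definition tens_obj (n : int) : lmodType A :=
  tensor L (fun p => P (n - p)).

Definition tens (n p : int) (x : L p) (y : P (n - p)) : tens_obj n :=
  @tpure A B L (fun p => P (n - p)) p x y.

(* d(x (x) y) = d(x) (x) y + (-1)^p x (x) d(y) for x of degree p *)
Definition tens_d_pure n p (x : L p) (y : P (n - p)) : tens_obj (n + 1) :=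
  @tens (n + 1) (p + 1) (bd L p x) (tr (subr_succ n p) y)
  + sg p (@tens (n + 1) p x (tr (subr_succr n p) (cd P (n - p) y))).

Lemma tens_d_balanced n : balanced (@tens_d_pure n).
Proof.
split=> [p x x' y|p x y y'|p x b y|p a x y]; rewrite /tens_d_pure /tens.
- by rewrite linearD !tpureDl sgD addrACA.
- by rewrite !linearD !tpureDr sgD addrACA.
- by rewrite bd_ract !linearZ /= !tpure_ract.
- by rewrite linearZ /= !tpureZ sgZ scalerDr.
Qed.

Definition tens_d n : {linear tens_obj n -> tens_obj (n + 1)} :=
  tlift (@tens_d_balanced n).

Lemma tens_dE n p (x : L p) (y : P (n - p)) :
  tens_d n (tens x y) = tens_d_pure x y.
Proof. exact: tlift_pure. Qed.

Lemma tens_dd n u : tens_d (n + 1) (tens_d n u) = 0.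
Proof.
move: u; apply: (tensor_ext (f := tens_d (n + 1) \o tens_d n) (g := \0)).
move=> p x y /=; rewrite -/(tens x y) tens_dE linearD sg_lin !tens_dE.
rewrite /tens_d_pure bdd.
rewrite (cd_tr _ (congr1 (+%R^~ 1) (subr_succr n p))) cdd !linear0.
rewrite (cd_tr _ (congr1 (+%R^~ 1) (subr_succ n p))).
rewrite /tens tpure0l tpure0r sg0 add0r addr0 sg_add sg1 sgN.
apply: addN_eq0; congr (sg p (tpure _ _)).
apply: etrans (tr_tr _ _ _) (etrans _ (esym (tr_tr _ _ _))); exact: tr_irr.
Qed.

Definition Tensor_complex : complex A := @Complex A tens_obj tens_d tens_dd.

End TensorComplex.

Lemma addr_subr (p n : int) : p + (n - p) = n.
Proof. lia. Qed.

Lemma subr_addl (p n : int) : n = p + n - p.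
Proof. lia. Qed.

Section Adjunction.
Variables (A B : pzRingType) (L : bicomplex A B).
Variables (P : complex B) (J : complex A).

(* The morphism L (x)_B P -> J adjoint to q : P -> Hom_A(L, J), that is the
   composition of L (x) q with the evaluation L (x)_B Hom_A(L, J) -> J,
   x (x) f |-> (-1)^{|x||f|} f(x). *)
Section Left.
Variable q : chain_map P (Hom_complex L J).

Definition adj_pure n p (x : L p) (y : P (n - p)) : J n :=
  sg (p * (n - p)) (tr (addr_subr p n) ((q (n - p) y : cochain L J (n - p)) p x)).

Lemma adj_balanced n : balanced (@adj_pure n).
Proof.
split=> [p x x' y|p x y y'|p x b y|p a x y]; rewrite /adj_pure.
- by rewrite !linearD sgD.
- by rewrite linearD /= linearD sgD.
- by rewrite linearZ.
- by rewrite !linearZ sgZ.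
Qed.

Definition adj n : {linear Tensor_complex L P n -> J n} :=
  tlift (@adj_balanced n).

Lemma adjE n p (x : L p) (y : P (n - p)) : adj n (tens x y) = adj_pure x y.
Proof. exact: tlift_pure. Qed.

Lemma adj_d n u : adj (n + 1) (cd (Tensor_complex L P) n u) = cd J n (adj n u).
Proof.
move: u; apply: (tensor_ext (f := adj (n + 1) \o tens_d L P n)
                            (g := cd J n \o adj n)).
move=> p x y /=; rewrite -/(tens x y) tens_dE adjE linearD sg_lin !adjE.
rewrite /adj_pure !cmap_tr !coch_tr cmap_d /= /hom_d_fun !linearB.
rewrite !sg_lin /= !(sgD, sgN) !tr_tr; apply: addr_cancel.
  rewrite -!sg_add; apply: etrans (sg_odd _ _) (congr1 _ (tr_irr _ _ _)).
  by rewrite !(odd_abszD, odd_abszM, odd_abszN) /=; do 2!case: (odd _).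
rewrite (cd_tr _ (congr1 (+%R^~ 1) (addr_subr p n))) -!sg_add.
apply: etrans (sg_odd _ _) (congr1 _ (tr_irr _ _ _)).
by rewrite !(odd_abszD, odd_abszM, odd_abszN) /=; do 2!case: (odd _).
Qed.

Definition left_adjoint : chain_map (Tensor_complex L P) J :=
  @ChainMap A (Tensor_complex L P) J adj adj_d.
End Left.

(* The morphism P -> Hom_A(L, J) adjoint to g : L (x)_B P -> J, that is the
   composition of P -> Hom_A(L, L (x)_B P), y |-> (x |-> (-1)^{|x||y|} x (x) y),
   with Hom_A(L, g). *)
Section Right.
Variable g : chain_map (Tensor_complex L P) J.

Program Definition coadj_fun n (y : P n) : cochain L J n :=
  @Cochain A B L J n
    (fun p x => sg (p * n)
       (g (p + n) (tens (n := p + n) x (tr (subr_addl p n) y)))) _.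
Next Obligation.
by move=> n y p a x x'; rewrite /tens tpureDl tpureZ linearP sgD sgZ.
Qed.

Lemma coadj_linear n : linear (@coadj_fun n).
Proof.
move=> b y y'; apply: cochainP => p x /=.
by rewrite linearP /tens tpureDr linearD sgD -tpure_ract.
Qed.
HB.instance Definition _ n :=
  GRing.isLinear.Build B (P n) (cochain L J n) *:%R
    (@coadj_fun n) (@coadj_linear n).

Definition coadj n : {linear P n -> Hom_complex L J n} := @coadj_fun n.

Lemma tens_tr (n n' p : int) (e : n = n') (e' : n - p = n' - p) (x : L p)
    (y : P (n - p)) :
  tr (C := Tensor_complex L P) e (tens x y) = tens (n := n') x (tr e' y).
Proof. by move: e'; case: n' / e => e'; rewrite !tr_id. Qed.

Lemma coadj_d n y : coadj (n + 1) (cd P n y) = cd (Hom_complex L J) n (coadj n y).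
Proof.
apply: cochainP => p x /=; rewrite /hom_d_fun /= !sg_lin /= -(cmap_d g) /=.
rewrite tens_dE /tens_d_pure !linearD !sg_lin /= -!(cmap_tr g) !(sgD, sgN).
have e1 : p + n + 1 - (p + 1) = p + (n + 1) - (p + 1) by lia.
have e2 : p + n + 1 - p = p + (n + 1) - p by lia.
have e3 : p + 1 + n - (p + 1) = p + (n + 1) - (p + 1) by lia.
rewrite (tens_tr _ e1) (tens_tr _ e2) (tens_tr _ e3).
rewrite (cd_tr _ (congr1 (+%R^~ 1) (subr_addl p n))) !tr_tr.
apply: addr_cancel'; rewrite -!sg_add.
  apply: etrans (sg_odd _ _) (congr1 _ (congr1 _ (congr1 _ (tr_irr _ _ _)))).
  by rewrite !(odd_abszD, odd_abszM) /=; do 2!case: (odd _).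
apply: etrans (sg_odd _ _) (congr1 _ (congr1 _ (congr1 _ (tr_irr _ _ _)))).
by rewrite !(odd_abszD, odd_abszM) /=; do 2!case: (odd _).
Qed.

Definition right_adjoint : chain_map P (Hom_complex L J) :=
  @ChainMap B P (Hom_complex L J) coadj coadj_d.
End Right.
End Adjunction.

Section Classes.
Variables (A B : pzRingType) (L : bicomplex A B) (l1 : int).

(* RHom_A(L, E) is computed as Hom_A(L, J) for an injective resolution J of E,
   and L (x)_B^L RHom_A(L, E) as L (x)_B P for a bounded above complex of
   projective B-modules P with a quasi-isomorphism q : P -> Hom_A(L, J).  The
   adjunction morphism L (x)_B^L RHom_A(L, E) -> E is then represented by
   L (x)_B P -> J.  Such J, P and q exist (under the condition on Ext, for the
   latter two) and the conditions do not depend on their choice. *)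
Definition Eclass (E : lmodType A) : Prop :=
  exists (J : complex A) (eta : {linear E -> J 0}),
    [/\ injective_resolution eta,
        forall n, l1 < n -> cohomology_zero (Hom_complex L J) n &
        exists (P : complex B) (q : chain_map P (Hom_complex L J)),
          [/\ bounded_above P, forall i, projective (P i), qiso q &
              qiso (left_adjoint q)]].

(* Dually, L (x)_B^L F is computed as L (x)_B P for a projective resolution P
   of F, so that Tor_n^B(L, F) = H^{-n}(L (x)_B P), and
   RHom_A(L, L (x)_B^L F) as Hom_A(L, J) for a bounded below complex of
   injective A-modules J with a quasi-isomorphism g : L (x)_B P -> J. *)
Definition Fclass (F : lmodType B) : Prop :=
  exists (P : complex B) (eps : {linear P 0 -> F}),
    [/\ projective_resolution eps,
        forall n, l1 < n -> cohomology_zero (Tensor_complex L P) (- n) &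
        exists (J : complex A) (g : chain_map (Tensor_complex L P) J),
          [/\ bounded_below J, forall i, injective_module (J i), qiso g &
              qiso (right_adjoint g)]].

End Classes.

(* Main.v *)
(* Both derived categories are controlled by a Loewenheim-Skolem argument.  A
   condition on subsets of a module (or of a complex) is "finitary" if it holds
   for all subsets closed under a family of rules, indexed by a small type, that
   send finite sequences of elements to finite sequences of elements; the hull
   of the empty set is then enumerated by terms, so that its size is bounded
   independently of the module.  If E lies in E_{l1} (or F in F_{l1}), then the
   resolutions which certify this can be cut down along a finitary condition:
   the perfectness of L over A allows one to test the adjunction morphism with
   a bounded above complex of finitely generated projective modules Q -> L, for
   which only finitely many elements matter in each lifting problem.  Applying
   this to the terms of the middle complex of a fraction X <- Z -> Y, and to
   objects witnessing that the cocycles of the cone of Z -> X are direct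
   summands of objects of the class, one replaces Z by a subcomplex enumerated
   by terms, without leaving the equivalence class of the fraction.  Such a
   small fraction is determined up to isomorphism by its atomic diagram, and
   the morphisms X -> Y correspond to sets of diagrams.
   Composition of equivalences of fractions is handled by explicit short exact
   sequences and retractions of cones. *)
Require Import Defs.
From mathcomp Require Import all_boot all_order all_algebra.
From HB Require Import structures.
From mathcomp Require Import boolp classical_sets.
From mathcomp Require Import zify.
Set Implicit Arguments.
Unset Strict Implicit.
Unset Printing Implicit Defensive.
Import Order.TTheory GRing.Theory Num.Theory.
Local Open Scope ring_scope.

(** * Finitary closure conditions *)

(** The obstacle is that membership in either class asserts the existence of projective and
    injective complexes and speaks of cochains, none of which is a matter of finitely many elements.
    Projective terms survive on subsets closed under a support function. Injective terms do not, so
    no injective complex is ever cut down: the adjunction is restated through [unit_map], from [P]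
    to Hom_A(Q, L (x)_B P), which involves no injectives, and an injective resolution of the small
    tensor complex is built afresh. A cochain on [Q] still has infinitely many components, as [Q] is
    only bounded above; but L (x)_B P is acyclic below some degree [a], so the new resolution
    vanishes there and only finitely many generators of [Q] count. A complex in [Ac] is merely
    homotopy equivalent to a spliced one, so its cocycles are only known to have complements with
    sum in the class; these complements are cut down together with the complex. The codes of the
    rules contain the scalars and the elements of [L] and [X], as [X] itself is not cut down; they
    do not depend on the fraction, and this makes the diagrams form a set. *)

Section Hull.
Variables (Om W : Type).

(** [Node o n ts] names the [n]-th entry of the output of the rule with code [o] on the values of
    [ts]; constants come from rules with empty input. Evaluation is partial, and arguments without a
    value are dropped. *)
Inductive term := Node of Om & nat & seq term.

Definition rule := Om -> seq W -> seq W -> Prop.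

(** Closure under some output, not under all of them: one choice per pair [(o, s)] suffices, and
    this keeps the hull small. *)
Definition hull_closed (Phi : rule) (S : pred W) : Prop :=
  forall o s ws, all S s -> Phi o s ws -> exists2 ws', Phi o s ws' & all S ws'.

Section Eval.
Variable F : Om -> seq W -> seq W.

Fixpoint eval (t : term) : option W :=
  let: Node o n ts := t in onth (F o (pmap eval ts)) n.

Lemma eval_lift s :
  (forall w, List.In w s -> exists t, eval t = Some w) ->
  exists ts, pmap eval ts = s.
Proof.
elim: s => [|w s IHs] Hs; first by exists [::].
have [t tw] := Hs w (or_introl erefl).
have [|ts tss] := IHs; first by move=> w' w's; apply: Hs; right.
by exists (t :: ts); rewrite /= tw /= tss.
Qed.
End Eval.

Lemma all_In (S : pred W) s : all S s <-> forall w, List.In w s -> S w.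
Proof.
elim: s => [|w s IHs] //=; split=> [/andP[Sw /IHs Ss] w' [<-|]//|H]; first exact: Ss.
by rewrite H ?IHs //; [move=> w' w's; apply: H; right | left].
Qed.

Lemma In_onth (s : seq W) w : List.In w s -> exists n, onth s n = Some w.
Proof.
elim: s => [//|x s IHs] /= [<-|/IHs[n sn]]; first by exists 0.
by exists n.+1.
Qed.


(** Once an output is chosen for every code and input, the values of terms form a closed set; its
    size is bounded by that of [term Om], however large [W] is. *)
Lemma small_hull (Phi : rule) :
  exists S : pred W, hull_closed Phi S /\
  exists v : term -> option W, forall w, S w -> exists t, v t = Some w.
Proof.
have /choice[F FP] : forall os : Om * seq W, exists ws : seq W,
    (exists ws', Phi os.1 os.2 ws') -> Phi os.1 os.2 ws.
  move=> [o s]; have [[ws' h]|h] := pselect (exists ws', Phi o s ws').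
    by exists ws'.
  by exists [::].
pose F' o s := F (o, s).
exists (fun w => `[< exists t, eval F' t = Some w >]); split; last first.
  by exists (eval F') => w /asboolP.
move=> o s ws /all_In Ss h; exists (F' o s); first by apply: (FP (o, s)); exists ws.
have [|ts tss] := @eval_lift F' s; first by move=> w /Ss /asboolP.
apply/all_In => w /In_onth[n wn]; apply/asboolP.
by exists (Node o n ts); rewrite /= tss.
Qed.
End Hull.

(** Pairs and natural numbers let the codes absorb integer indices and families of rules, so that
    all rules share one index type. *)
Inductive code (U : Type) := CLeaf of U | CPair of code U & code U | CNat of nat.
Arguments CNat {U}.

Section Finitary.
Variable U : Type.
Local Notation Om := (code U).

Definition finitary W (C : pred W -> Prop) : Prop :=
  exists Phi : rule Om W, forall S, hull_closed Phi S -> C S.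

Lemma finitary_imp W (C C' : pred W -> Prop) :
  (forall S, C S -> C' S) -> finitary C -> finitary C'.
Proof. by move=> CC' [Phi h]; exists Phi => S /h /CC'. Qed.

(** The rules are put side by side, tagged by [e i]; injectivity of [e] ensures that an output
    delivered for this tag comes from the [i]-th rule. *)
Lemma finitary_forall W (I : Type) (e : I -> Om) (C : I -> pred W -> Prop) :
  injective e -> (forall i, finitary (C i)) -> finitary (fun S => forall i, C i S).
Proof.
move=> e_inj /choice[Phi h].
exists (fun o s ws => exists i o', o = CPair (e i) o' /\ Phi i o' s ws) => S cl i.
apply: (h i) => o s ws Ss os.
have [|ws' [i' [o' [[/e_inj <- <-]]]] ? ?] := cl (CPair (e i) o) s ws Ss.
  by exists i, o.
by exists ws'.
Qed.

Lemma finitary_and W (C C' : pred W -> Prop) :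
  finitary C -> finitary C' -> finitary (fun S => C S /\ C' S).
Proof.
move=> fC fC'.
have := @finitary_forall W bool (fun b : bool => CNat (nat_of_bool b))
  (fun b => if b then C else C') _ _.
case=> [[] [] //|[] //|Phi h].
by exists Phi => S /h H; split; [apply: (H true) | apply: (H false)].
Qed.

Lemma finitary_preim W W' (f : W -> W') (C : pred W -> Prop) :
  injective f -> finitary C -> finitary (fun S : pred W' => C (fun w => S (f w))).
Proof.
move=> f_inj [Phi h].
exists (fun o s ws => exists s0 ws0,
  [/\ s = map f s0, ws = map f ws0 & Phi o s0 ws0]) => S cl; apply: h.
move=> o s ws Ss os.
have [||ws' [s1 [ws1 [/(inj_map f_inj) <- -> ?]]]] := cl o (map f s) (map f ws).
- by rewrite all_map.
- by exists s, ws.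
by rewrite all_map => ?; exists ws1.
Qed.


(** A rule sees only a code and an input sequence, so the output it delivers could belong to another
    instance [x'] with the same [k] and [hyp]; the hypothesis excludes this. Parameters that are not
    elements of the closed set must therefore be recorded by [k]. *)
Lemma finitary_horn W (X : Type) (Y : X -> Type) (k : X -> Om) (hyp : X -> seq W)
    (rel : forall x, Y x -> Prop) (con : forall x, Y x -> seq W) :
  (forall x x', k x = k x' -> hyp x = hyp x' -> x = x') ->
  finitary (fun S => forall x, all S (hyp x) -> (exists y, rel x y) ->
     exists2 y, rel x y & all S (con x y)).
Proof.
move=> inj; exists (fun o s ws => exists x (y : Y x),
  [/\ o = k x, s = hyp x, rel x y & ws = con x y]) => S cl x Sx [y xy].
have [|_ [x' [y' [kE hE xy' ->]]] Sws] := cl (k x) (hyp x) (con x y) Sx.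
  by exists x, y.
by move: (inj _ _ kE hE) => E; subst x'; exists y'.
Qed.

Lemma finitary_const W (w : W) : finitary (fun S => S w).
Proof.
have := @finitary_horn W unit (fun=> unit) (fun=> CNat 0) (fun=> [::])
  (fun _ _ => True) (fun _ _ => [:: w]).
case=> [[] []//|Phi h]; exists Phi => S /h/(_ tt isT).
by case=> [|_ _ /andP[]]; [exists tt | ].
Qed.
End Finitary.

Lemma code_int_inj U : injective (fun i : int => CNat (pickle i) : code U).
Proof. by move=> i j [] /(pcan_inj pickleK). Qed.

Lemma existT_inj (T : int -> Type) i (x y : T i) : existT T i x = existT T i y -> x = y.
Proof.
pose c (s : {i & T i}) : T i :=
  if projT1 s =P i is ReflectT e then eq_rect _ T (projT2 s) i e else x.
have cE z : c (existT T i z) = z.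
  by rewrite /c /=; case: eqP => // e; rewrite (eq_irrelevance e erefl).
by move=> /(congr1 c); rewrite !cE.
Qed.

Lemma dchoice (I : Type) (T : I -> Type) (P : forall i, T i -> Prop) :
  (forall i, exists x, P i x) -> exists f : forall i, T i, forall i, P i (f i).
Proof. by move=> H; exists (fun i => sval (cid (H i))) => i; apply: svalP. Qed.

(** * Modules *)

Section Linear.
Variables (R : pzRingType) (M N : lmodType R).

Definition linear_fun (f : M -> N) of linear f := f.
HB.instance Definition _ (f : M -> N) (fL : linear f) :=
  GRing.isLinear.Build R M N *:%R (linear_fun fL) fL.
Definition mklin (f : M -> N) (fL : linear f) : {linear M -> N} := linear_fun fL.

Lemma linear_of_rel (T : M -> N -> Prop) :
  (forall x, exists y, T x y) -> (forall x y y', T x y -> T x y' -> y = y') ->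
  (forall a x x' y y', T x y -> T x' y' -> T (a *: x + x') (a *: y + y')) ->
  exists f : {linear M -> N}, forall x, T x (f x).
Proof.
move=> /choice[f fT] uT linT.
have fL : linear f by move=> a x y; apply: uT (fT _) _; apply: linT.
by exists (mklin fL).
Qed.

End Linear.

Section Submodule.
Variables (R : pzRingType) (M : lmodType R).

Definition submodule (S : M -> Prop) : Prop :=
  S 0 /\ forall a x y, S x -> S y -> S (a *: x + y).

Definition subpred (S : M -> Prop) : pred M := fun x => `[< S x >].

Section Type_.
Variables (S : M -> Prop) (HS : submodule S).

Lemma subpred_closed : submod_closed (subpred S).
Proof.
split; first by apply/asboolP; case: HS.
by move=> a x y /asboolP Sx /asboolP Sy; apply/asboolP; apply: HS.2.
Qed.

Record subm_of (H : submodule S) := Subm { subm_val :> M; _ : subm_val \in subpred S }.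
Local Notation T := (subm_of HS).
HB.instance Definition _ := [isSub for @subm_val HS].
HB.instance Definition _ := [Choice of T by <:].
HB.instance Definition _ :=
  GRing.SubChoice_isSubLmodule.Build R M (subpred S) T subpred_closed.
Definition subm : lmodType R := T.

Definition sub_incl : {linear subm -> M} := \val.

Lemma sub_inclP (x : subm) : S (sub_incl x).
Proof. by case: x => x /= /asboolP. Qed.

Lemma sub_incl_inj : injective sub_incl.
Proof. exact: val_inj. Qed.

Lemma sub_inclE x : S x <-> exists y, sub_incl y = x.
Proof.
split=> [Sx|[y <-]]; last exact: sub_inclP.
have Sx' : x \in subpred S by apply/asboolP.
by exists (Subm HS Sx').
Qed.
End Type_.
End Submodule.

Section Factor.
Variable R : pzRingType.

Lemma lin_factor (M N K : lmodType R) (i : {linear N -> M}) (f : {linear K -> M}) :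
  injective i -> (forall x, exists y, i y = f x) ->
  exists g : {linear K -> N}, forall x, i (g x) = f x.
Proof.
move=> i_inj fi.
have := @linear_of_rel R K N (fun x y => i y = f x) fi _ _.
case=> [x y y' <- /i_inj //|a x x' y y' h h'|g gP]; first by rewrite !linearP h h'.
by exists g.
Qed.

(** Replacing the target of [T] by its image makes the lifting problem surjective, so that pointwise
    solvability is enough. *)
Lemma projective_lift (P X Y : lmodType R) (T : {linear X -> Y}) (v : {linear P -> Y}) :
  projective P -> (forall x, exists z, T z = v x) ->
  exists h : {linear P -> X}, forall x, T (h x) = v x.
Proof.
move=> Pp Tv.
have HS : submodule (fun y => exists z, T z = y).
  split; first by exists 0; rewrite linear0.
  by move=> a _ _ [z <-] [z' <-]; exists (a *: z + z'); rewrite linearP.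
have [T' T'E] := lin_factor (f := T) (@sub_incl_inj R Y _ HS)
  (fun z => proj1 (sub_inclE HS (T z)) (ex_intro _ z erefl)).
have [v' v'E] := lin_factor (f := v) (@sub_incl_inj R Y _ HS)
  (fun x => proj1 (sub_inclE HS (v x)) (Tv x)).
have [|h hE] := Pp _ _ T' v'.
  move=> y; have [z zy] := sub_inclP y; exists z.
  by apply: (@sub_incl_inj R Y _ HS); rewrite T'E zy.
by exists h => x; rewrite -T'E hE v'E.
Qed.

(** Dually, [v] descends to the image of [T] by the kernel condition and is then extended from this
    submodule. *)
Lemma injective_extend (J X Y : lmodType R) (T : {linear X -> Y}) (v : {linear X -> J}) :
  injective_module J -> (forall x, T x = 0 -> v x = 0) ->
  exists h : {linear Y -> J}, forall x, h (T x) = v x.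
Proof.
move=> Ji Tv.
have HS : submodule (fun y => exists z, T z = y).
  split; first by exists 0; rewrite linear0.
  by move=> a _ _ [z <-] [z' <-]; exists (a *: z + z'); rewrite linearP.
have [] := @linear_of_rel R (subm HS) J
  (fun y w => exists2 z, T z = sub_incl HS y & v z = w).
- by move=> y; have [z zy] := sub_inclP y; exists (v z), z.
- move=> y w w' [z zy <-] [z' zy' <-]; apply/eqP; rewrite -subr_eq0 -linearB.
  by apply/eqP; apply: Tv; rewrite linearB zy zy' subrr.
- move=> a y y' w w' [z zy <-] [z' zy' <-]; exists (a *: z + z') => //.
    by rewrite !linearP zy zy'.
  by rewrite linearP.
move=> v' v'E; have [h hE] := Ji _ _ _ v' (@sub_incl_inj R Y _ HS).
exists h => x; have [y yx] := proj1 (sub_inclE HS (T x)) (ex_intro _ x erefl).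
have [z zy vz] := v'E y; rewrite -yx hE -vz; apply/eqP; rewrite -subr_eq0 -linearB.
by apply/eqP/Tv; rewrite linearB zy yx subrr.
Qed.

Lemma lin_inverse (M N : lmodType R) (f : {linear M -> N}) :
  injective f -> surj f -> exists g : {linear N -> M}, cancel f g /\ cancel g f.
Proof.
move=> fI fS; have [g gP] := lin_factor (f := idfun : {linear N -> N}) fI fS.
by exists g; split=> x //; apply: fI; rewrite gP.
Qed.

Lemma eqB (V : zmodType) (x y : V) : x - y = 0 -> x = y.
Proof. by move/eqP; rewrite subr_eq0 => /eqP. Qed.

End Factor.

(** * Enough injectives *)

Definition int_pred : pred rat := fun x => x \is a Num.int.
Lemma int_pred_zmod : zmod_closed int_pred.
Proof. by split=> [|x y xZ yZ]; [exact: rpred0 | exact: rpredB]. Qed.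
HB.instance Definition _ := GRing.isZmodClosed.Build rat int_pred int_pred_zmod.

(** The group is Q/Z. Division is done on rational representatives, and the class of 1/n is a
    nonzero element killed by n. *)
Lemma divisible_torsion_group : exists D : zmodType,
  (forall (y : D) n, (0 < n)%N -> exists z, z *+ n = y) /\
  (forall n, (1 < n)%N -> exists2 z : D, z *+ n = 0 & z != 0).
Proof.
pose I : zmodClosed rat := GRing.ZmodClosed.clone rat int_pred _.
exists (Quotient.quot I); split=> [y n n0|n n1].
  exists (\pi_(Quotient.quot I)%qT (repr y / n%:R)).
  rewrite -raddfMn /= -[(_ / _) *+ n]mulr_natr divfK ?reprK //.
  by rewrite pnatr_eq0 -lt0n.
have n0 : n%:R != 0 :> rat by rewrite pnatr_eq0 -lt0n (ltn_trans _ n1).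
exists (\pi_(Quotient.quot I)%qT n%:R^-1).
  rewrite -raddfMn /= -[_^-1 *+ n]mulr_natr mulVf //.
  rewrite -[RHS](raddf0 (\pi_(Quotient.quot I)%qT : {additive _ -> _})) /=.
  by apply/eqP; rewrite -Quotient.idealrBE subr0 /in_mem /= /int_pred rpred1.
rewrite -[X in _ != X](raddf0 (\pi_(Quotient.quot I)%qT : {additive _ -> _})) /=.
rewrite -Quotient.idealrBE subr0; rewrite /in_mem /= /int_pred; apply/negP => /intrP[m].
case: m => [[|m]|m] /= E.
- by move: n0; rewrite -invr_eq0 E eqxx.
- have : (n%:R^-1 : rat) < 1 by rewrite invf_lt1 ?ltr1n // ltr0n; lia.
  by rewrite E -[1]/(1%:~R) ltr_int; lia.
have : (0 : rat) < n%:R^-1 by rewrite invr_gt0 ltr0n; lia.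
by rewrite E ltr0z.
Qed.

Section DivisibleExtension.
Variables (N D : zmodType).
Hypothesis Ddiv : forall (y : D) n, (0 < n)%N -> exists z, z *+ n = y.

(** Graphs of additive maps defined on subgroups; as subsets of [N * D] they are ordered by
    inclusion, as Zorn's lemma wants. *)
Definition partial_additive (G : N * D -> Prop) : Prop :=
  [/\ G (0, 0), forall x y x' y', G (x, y) -> G (x', y') -> G (x - x', y - y')
    & forall y, G (0, y) -> y = 0].

Section Properties.
Variables (G : N * D -> Prop) (HG : partial_additive G).

Lemma paddN x y : G (x, y) -> G (- x, - y).
Proof. by case: HG => G0 GB _ Gp; rewrite -[- x]sub0r -[- y]sub0r; apply: GB. Qed.

Lemma paddD x y x' y' : G (x, y) -> G (x', y') -> G (x + x', y + y').
Proof.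
case: HG => _ GB _ Gp /paddN Gq; rewrite -[x']opprK -[y']opprK; exact: GB.
Qed.

Lemma paddMz x y m : G (x, y) -> G (x *~ m, y *~ m).
Proof.
move=> Gp; have H n : G (x *+ n, y *+ n).
  by elim: n => [|n IHn]; [rewrite !mulr0n; case: HG | rewrite !mulrS; apply: paddD].
by case: m => n; [apply: H | apply/paddN/H].
Qed.

Lemma padd_uniq x y y' : G (x, y) -> G (x, y') -> y = y'.
Proof.
case: HG => _ GB G0 Gy Gy'; apply: eqB; apply: G0.
by have := GB _ _ _ _ Gy Gy'; rewrite subrr.
Qed.
End Properties.

(* [z] must be compatible with the multiples of [x] that are already in the
   domain; these are the multiples of the least positive one. *)
Lemma padd_extend1 (G : N * D -> Prop) (x : N) :
  partial_additive G -> exists z, forall m y, G (x *~ m, y) -> y = z *~ m.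
Proof.
move=> HG; pose Q n := (0 < n)%N && `[< exists y, G (x *+ n, y) >].
have [Qex|no] := pselect (exists n, Q n); last first.
  exists 0 => m y Gmy; rewrite mul0rz.
  have [m0|m0] := eqVneq m 0.
    by move: Gmy; rewrite m0 mulr0z; case: HG => _ _ /[apply].
  case: no; exists `|m|%N; apply/andP; split; first by rewrite absz_gt0.
  apply/asboolP; case: m Gmy {m0} => k Gmy; first by exists y.
  by exists (- y); have := paddN HG Gmy; rewrite opprK.
case: (ex_minnP Qex) => n /andP[n0 /asboolP[y Gy]] nmin.
have [z zy] := Ddiv y n0; exists z => m y' Gy'.
pose k := (m %/ n%:Z)%Z; pose r := `|(m %% n%:Z)%Z|%N.
have mE : m = k * n%:Z + r%:Z.
  by rewrite /r gez0_abs ?modz_ge0 -?divz_eq //; lia.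
have Gr : G (x *+ r, y' - y *~ k).
  have -> : x *+ r = x *~ m - (x *+ n) *~ k.
    by rewrite !pmulrn -mulrzA mE mulrzDr mulrC [X in X - _]addrC addrK.
  by case: (HG) => _ GB _; apply: GB => //; apply: (paddMz HG).
have r0 : r = 0%N.
  apply/eqP; rewrite -leqn0 leqNgt; apply/negP => r0.
  have /nmin : Q r by rewrite /Q r0; apply/asboolP; eexists; exact: Gr.
  have := ltz_pmod m (d := n%:Z); rewrite /r; lia.
move: Gr; rewrite r0 mulr0n; case: (HG) => _ _ /[apply]/eqB ->.
by rewrite mE r0 addr0 mulrC mulrzA -zy.
Qed.

Lemma padd_extend (G : N * D -> Prop) : partial_additive G ->
  exists F : N -> D, {morph F : x y / x - y} /\ forall x y, G (x, y) -> F x = y.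
Proof.
(* Adjoining [G] to every set makes the empty chain harmless. *)
move=> HG; pose P (A : set (N * D)) := partial_additive (fun p => A p \/ G p).
have [F FP Ftot|A [PA Amax]] := @Zorn_bigcup _ P.
  have [G0 GB GU] := HG.
  have common p q : (\bigcup_(X in F) X)%classic p \/ G p ->
      (\bigcup_(X in F) X)%classic q \/ G q ->
      (G p /\ G q) \/ exists X, [/\ F X, X p \/ G p & X q \/ G q].
    move=> [[X FX Xp]|Gp] [[Y FY Yq]|Gq]; last by left.
    - right; case: (Ftot _ _ FX FY) => XY.
        by exists Y; split=> //; left=> //; apply: XY.
      by exists X; split=> //; left=> //; apply: XY.
    - by right; exists X; split=> //; [left | right].
    - by right; exists Y; split=> //; [right | left].
  split; first by right.
    move=> x y x' y' Hp Hq; have [[Gp Gq]|[X [FX Xp Xq]]] := common _ _ Hp Hq.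
      by right; apply: GB.
    have [_ XB _] := FP _ FX; have [] := XB _ _ _ _ Xp Xq; last by right.
    by left; exists X.
  move=> y Hy; have [[Gy _]|[X [FX Xy _]]] := common _ _ Hy Hy; first exact: GU.
  by have [_ _] := FP _ FX; apply.
pose A' p := A p \/ G p; have PA' : partial_additive A' by [].
have total x : exists y, A' (x, y).
  apply: contrapT => no; have [z zP] := padd_extend1 x PA'.
  (* The graph is extended to the subgroup generated by the domain and [x], with [x] sent to [z];
     the choice of [z] keeps it single-valued. *)
  pose B : set (N * D) := fun p => exists m u, A' (p.1 - x *~ m, u) /\ p.2 = u + z *~ m.
  have A'B p : A' p -> B p.
    by case: p => a b A'p; exists 0, b; rewrite /= !mulr0z subr0 addr0.
  apply: (Amax B).
    split=> [p Ap|]; first by apply: A'B; left.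
    move=> /(_ (x, z)) BA; apply: no; exists z; left; apply: BA.
    exists 1, 0; rewrite /= !mulr1z subrr add0r; split=> //.
    by case: PA'.
  suff PB : partial_additive B.
    suff -> : P B = partial_additive B by [].
    congr partial_additive; apply/funext => p; apply/propext.
    by split=> [[//|Gp]|Bp]; [apply: A'B; right | left].
  split; first by apply: A'B; case: PA'.
    move=> a b a' b' [m [u [Au bE]]] [m' [u' [Au' bE']]]; exists (m - m'), (u - u').
    rewrite /= in Au bE Au' bE' *; split; last by rewrite bE bE' mulrzBr addrACA opprD.
    rewrite (_ : _ - _ = a - x *~ m - (a' - x *~ m')).
      by case: PA' => _ AB _; apply: AB.
    by rewrite mulrzBr !opprD !opprK addrACA.
  move=> y [m [u [/= Au ->]]]; rewrite sub0r in Au.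
  have := zP (- m) u; rewrite !mulrNz => /(_ Au) ->; exact: addNr.
have [F FP] := choice total; exists F; split=> [x y|x y Gxy].
  by apply: (padd_uniq PA' (FP _)); case: PA' => _ AB _; apply: AB.
by apply: (padd_uniq PA' (FP _)); right.
Qed.
End DivisibleExtension.

(** The map is prescribed on the subgroup generated by [S] and [x]: zero on [S], and at [x] a
    nonzero [z] killed by the least positive [n] with [x *+ n] in [S]. Divisibility of [D] extends
    it to [N]. *)
Lemma character (N D : zmodType) (S : N -> Prop) (x : N) :
  (forall (y : D) n, (0 < n)%N -> exists z, z *+ n = y) ->
  (forall n, (1 < n)%N -> exists2 z : D, z *+ n = 0 & z != 0) ->
  S 0 -> (forall a b, S a -> S b -> S (a - b)) -> ~ S x ->
  exists F : N -> D,
    [/\ {morph F : a b / a - b}, forall a, S a -> F a = 0 & F x != 0].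
Proof.
move=> Ddiv Dtors S0 SB Sx.
have SN a : S a -> S (- a) by move=> Sa; rewrite -sub0r; apply: SB.
have SM a m : S a -> S (a *~ m).
  move=> Sa; have H n : S (a *+ n).
    elim: n => [|n IHn]; first by rewrite mulr0n.
    by rewrite mulrS -[_ *+ n]opprK; apply: SB => //; apply: SN.
  by case: m => n; [apply: H | apply/SN/H].
have [z z0 zP] : exists2 z : D, z != 0 & forall m, S (x *~ m) -> z *~ m = 0.
  pose Q n := (0 < n)%N && `[< S (x *+ n) >].
  have [Qex|no] := pselect (exists n, Q n); last first.
    (* No positive multiple of [x] lies in [S], so any nonzero [z] is compatible. *)
    have [//|z _ z0] := Dtors 2; exists z => // m Sm.
    have [->|m0] := eqVneq m 0; first by rewrite mulr0z.
    case: no; exists `|m|%N; apply/andP; split; first by rewrite absz_gt0.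
    apply/asboolP; case: m Sm {m0} => k Sm; first exact: Sm.
    by have := SN _ Sm; rewrite opprK.
  case: (ex_minnP Qex) => n /andP[n0 /asboolP Sn] nmin.
  have [|z zn z0] := Dtors n.
    by case: n n0 Sn {nmin} => [|[|n]] // _ /Sx.
  exists z => // m Sm.
  pose k := (m %/ n%:Z)%Z; pose r := `|(m %% n%:Z)%Z|%N.
  have mE : m = k * n%:Z + r%:Z.
    by rewrite /r gez0_abs ?modz_ge0 -?divz_eq //; lia.
  have Sr : S (x *+ r).
    have -> : x *+ r = x *~ m - (x *+ n) *~ k.
      by rewrite !pmulrn -mulrzA mE mulrzDr mulrC [X in X - _]addrC addrK.
    by apply: SB => //; apply: SM.
  have r0 : r = 0%N.
    apply/eqP; rewrite -leqn0 leqNgt; apply/negP => r0.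
    have /nmin : Q r by rewrite /Q r0; apply/asboolP.
    have := ltz_pmod m (d := n%:Z); rewrite /r; lia.
  by rewrite mE r0 addr0 mulrC mulrzA -pmulrn zn mul0rz.
pose G (p : N * D) := exists2 m, S (p.1 - x *~ m) & p.2 = z *~ m.
have [|F [FB FG]] := @padd_extend N D Ddiv G.
  split; first by exists 0; rewrite /= ?mulr0z ?subr0.
    move=> a b a' b' [m /= Sa ->] [m' /= Sa' ->]; exists (m - m') => /=; last first.
      by rewrite mulrzBr.
    rewrite (_ : _ - _ = a - x *~ m - (a' - x *~ m')); first exact: SB.
    by rewrite mulrzBr !opprD !opprK addrACA.
  move=> y [m /= Sm ->]; apply: zP; rewrite -[x *~ m]opprK; apply: SN.
  by rewrite -sub0r.
exists F; split=> // [a Sa|].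
  by apply: FG; exists 0; rewrite /= ?mulr0z ?subr0.
by rewrite (FG x z) //; exists 1; rewrite /= ?mulr1z // subrr.
Qed.

Section Coinduced.
Variables (R : pzRingType) (D : zmodType) (K : Type).

(** The [K]-fold power of Hom_Z(R, D), with [R] acting by right multiplication on the argument.
    Building the power into the record gives products of coinduced modules at once. *)
Record coind := Coind {
  coind_fun :> K -> R -> D;
  coind_add : forall k a b, coind_fun k (a + b) = coind_fun k a + coind_fun k b }.

HB.instance Definition _ := gen_eqMixin coind.
HB.instance Definition _ := gen_choiceMixin coind.

Lemma coindP (f g : coind) : (forall k r, f k r = g k r) -> f = g.
Proof.
case: f g => [f fl] [g gl] /= fg.
have E : f = g by apply/funext => k; apply/funext.
by case: g / E gl {fg} => gl; congr Coind; apply: Prop_irrelevance.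
Qed.

Program Definition coind0 : coind := @Coind (fun k r => 0) _.
Next Obligation. by rewrite addr0. Qed.
Program Definition coindN (f : coind) : coind := @Coind (fun k r => - f k r) _.
Next Obligation. by rewrite coind_add opprD. Qed.
Program Definition coindD (f g : coind) : coind := @Coind (fun k r => f k r + g k r) _.
Next Obligation. by rewrite !coind_add addrACA. Qed.
Program Definition coindZ (s : R) (f : coind) : coind := @Coind (fun k r => f k (r * s)) _.
Next Obligation. by rewrite mulrDl coind_add. Qed.

Lemma coindDA : associative coindD.
Proof. by move=> f g h; apply: coindP => k r; apply: addrA. Qed.
Lemma coindDC : commutative coindD.
Proof. by move=> f g; apply: coindP => k r; apply: addrC. Qed.
Lemma coind0D : left_id coind0 coindD.
Proof. by move=> f; apply: coindP => k r; apply: add0r. Qed.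
Lemma coindND : left_inverse coind0 coindN coindD.
Proof. by move=> f; apply: coindP => k r; apply: addNr. Qed.
HB.instance Definition _ :=
  GRing.isZmodule.Build coind coindDA coindDC coind0D coindND.

Lemma coindZA b c f : coindZ b (coindZ c f) = coindZ (b * c) f.
Proof. by apply: coindP => k r /=; rewrite mulrA. Qed.
Lemma coind1Z : left_id 1 coindZ.
Proof. by move=> f; apply: coindP => k r /=; rewrite mulr1. Qed.
Lemma coindZDr : right_distributive coindZ +%R.
Proof. by move=> b f g; apply: coindP. Qed.
Lemma coindZDl f : {morph coindZ^~ f : b c / b + c}.
Proof. by move=> b c; apply: coindP => k r /=; rewrite mulrDr coind_add. Qed.
HB.instance Definition _ :=
  GRing.Zmodule_isLmodule.Build R coind coindZA coind1Z coindZDr coindZDl.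

Hypothesis Ddiv : forall (y : D) n, (0 < n)%N -> exists z, z *+ n = y.

(* Coextension of scalars is right adjoint to restriction to abelian groups. *)
Lemma coind_injective : injective_module (coind : lmodType R).
Proof.
move=> M N g f g_inj.
have extend k : exists F : N -> D, {morph F : x y / x - y} /\
    forall m, F (g m) = (f m : coind) k 1.
  pose G (p : N * D) := exists2 m, p.1 = g m & p.2 = (f m : coind) k 1.
  have [|F [FB FG]] := @padd_extend N D Ddiv G.
    split; first by exists 0; rewrite /= linear0.
      move=> a b a' b' [m /= -> ->] [m' /= -> ->]; exists (m - m') => /=.
        by rewrite linearB.
      by rewrite linearB.
    by move=> y [m /= E ->]; rewrite (g_inj m 0) linear0.
  by exists F; split=> // m; apply: FG; exists m.
have {extend}/choice[F FP] := extend.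
have F0 k : F k 0 = 0 by have := (FP k).1 0 0; rewrite !subrr.
have FD k x y : F k (x + y) = F k x + F k y.
  by rewrite -{1}[y]opprK (FP k).1 -[- y]sub0r (FP k).1 F0 sub0r opprK.
have hA : forall n k (a b : R), F k ((a + b) *: n) = F k (a *: n) + F k (b *: n).
  by move=> n k a b; rewrite scalerDl FD.
pose h n : coind := Coind (hA n).
have hL : linear h.
  by move=> a x y; apply: coindP => k r /=; rewrite scalerDr scalerA FD.
exists (mklin hL) => m; apply: coindP => k r /=.
by rewrite -linearZ (FP k).2 linearZ /= mul1r.
Qed.
End Coinduced.

(** The index set [K] consists of all characters that kill [S]. The quotient by [S] is embedded
    without being formed, which is the shape used when resolutions are built degree by degree. *)
Lemma enough_injectives (R : pzRingType) (N : lmodType R) (S : N -> Prop) :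
  submodule S ->
  exists (J : lmodType R) (f : {linear N -> J}),
    injective_module J /\ forall x, f x = 0 <-> S x.
Proof.
move=> HS; have [D [Ddiv Dtors]] := divisible_torsion_group.
have S0 : S 0 by case: HS.
have SB a b : S a -> S b -> S (a - b).
  by move=> Sa Sb; rewrite addrC -scaleN1r; apply: HS.2.
pose K := {F : N -> D | {morph F : a b / a - b} /\ forall a, S a -> F a = 0}.
have FD (k : K) x y : sval k (x + y) = sval k x + sval k y.
  case: k => F [/= FB _].
  have F0 : F 0 = 0 by have := FB 0 0; rewrite !subrr.
  by rewrite -{1}[y]opprK FB -[- y]sub0r FB F0 sub0r opprK.
have fA n (k : K) (a b : R) :
    sval k ((a + b) *: n) = sval k (a *: n) + sval k (b *: n).
  by rewrite scalerDl FD.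
pose f n : coind R D K := Coind (fA n).
have fL : linear f.
  by move=> a x y; apply: coindP => k r /=; rewrite scalerDr scalerA FD.
exists (coind R D K), (mklin fL); split; first exact: coind_injective.
move=> x; split=> [|Sx]; last first.
  apply: coindP => -[F [FB FS]] r /=; apply: FS.
  by rewrite -[_ *: _]addr0; apply: HS.2.
move=> fx; apply: contrapT => nSx.
have [F [FB FS]] := character Ddiv Dtors S0 SB nSx; move/eqP; apply.
have := congr1 (fun g : coind R D K => g (exist _ F (conj FB FS)) 1) fx.
by rewrite /= scale1r.
Qed.

(** * Recursion over the integers *)

Section IntIter.
Variables (U : int -> Type) (b : int) (x0 : U b) (next : forall i, U i -> U (i + 1)).

Let next' (s : {i & U i}) : {i & U i} := existT U (projT1 s + 1) (next (projT2 s)).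
Let v k := iter k next' (existT U b x0).

Let cast i j (e : i = j) (x : U i) : U j := eq_rect i U x j e.

Lemma tag_iter k : projT1 (v k) = b + k%:Z.
Proof. by elim: k => [|k IHk] /=; rewrite ?addr0 // IHk; lia. Qed.

Lemma int_iter_tag i : b <= i -> projT1 (v `|i - b|%N) = i.
Proof. by rewrite tag_iter; lia. Qed.

(** The iteration runs on pairs of a degree and a value, so that index arithmetic is confined to a
    single cast. *)
Lemma int_iter : exists u : forall i : int, b <= i -> U i,
  (forall H, u b H = x0) /\ forall (i : int) H H', u (i + 1) H = next (u i H').
Proof.
exists (fun i H => cast (int_iter_tag H) (projT2 (v `|i - b|%N))); split.
  move=> H; have E : `|b - b|%N = 0%N by lia.
  move: (int_iter_tag H); rewrite E /= => e.
  by rewrite (eq_irrelevance e erefl).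
move=> i H H'; have E : absz (i + 1 - b)%R = (absz (i - b)%R).+1 by lia.
move: (int_iter_tag H) (int_iter_tag H'); rewrite E /=.
case: (v _) => j x /= e e'; case: i / e' e {H H' E} => e.
by rewrite (eq_irrelevance e erefl).
Qed.
End IntIter.

(** The step needs the relation that was just established, so the recursion runs on related pairs of
    neighbouring terms. *)
Lemma rec_up (T : int -> Type) (R : forall i, T i -> T (i + 1) -> Prop) (a : int)
    (z : forall i, T i) :
  (forall i, i < a -> R i (z i) (z (i + 1))) ->
  (forall i t0 t1, R i t0 t1 -> exists t2, R (i + 1) t1 t2) ->
  exists s : forall i, T i,
    (forall i, R i (s i) (s (i + 1))) /\ forall i, i <= a -> s i = z i.
Proof.
(* Starting at [a - 1] makes the first pair [z (a - 1), z a] the last one covered by [base]. *)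
move=> base step; pose b := a - 1.
pose U i := {p : T i * T (i + 1) | R i p.1 p.2}.
have nextP i (u : U i) : exists u' : U (i + 1), (sval u').1 = (sval u).2.
  case: u => -[t0 t1] /= /step[t2 r2].
  by exists (exist _ (t1, t2) r2).
have /dchoice[next nextE] : forall i, exists f : U i -> U (i + 1),
    forall u, (sval (f u)).1 = (sval u).2 by move=> i; exact: (dchoice (nextP i)).
have b_lt_a : b < a by rewrite /b; lia.
have [u [u0 uS]] := int_iter (exist _ (z b, z (b + 1)) (base b b_lt_a) : U b) next.
pose s i : T i := if pselect (b <= i) is left H then (sval (u i H)).1 else z i.
have sL i : i <= a -> s i = z i.
  rewrite /s; case: pselect => // H ia.
  have [ib|ib] := eqVneq i b; first by move: H; rewrite ib => H; rewrite u0.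
  have ia' : i = b + 1 by move: H ib; rewrite /b; lia.
  move: H; rewrite ia' => H.
  by rewrite (uS b H (lexx b)) nextE u0.
exists s; split=> // i; have [H|ib] := pselect (b <= i).
  have H' : b <= i + 1 by lia.
  have -> : s (i + 1) = (sval (u i H)).2.
    by rewrite /s; case: pselect => // K; rewrite (uS i K H) nextE.
  have -> : s i = (sval (u i H)).1.
    by rewrite /s; case: pselect => // K; congr (sval (u i _)).1; apply: Prop_irrelevance.
  by case: (u i H).
rewrite !sL; [apply: (base)| |]; move: ib; rewrite /b; lia.
Qed.

Section IntIterDown.
Variables (U : int -> Type) (b : int) (x0 : U b) (next : forall i, U (i + 1) -> U i).

Let cast i j (e : i = j) (x : U i) : U j := eq_rect i U x j e.
Let next' (s : {i & U i}) : {i & U i} :=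
  existT U (projT1 s - 1) (next (cast (esym (subrK 1 (projT1 s))) (projT2 s))).
Let v k := iter k next' (existT U b x0).

Lemma tag_iter_down k : projT1 (v k) = b - k%:Z.
Proof. by elim: k => [|k IHk] /=; rewrite ?subr0 // IHk; lia. Qed.

Lemma int_iter_down_tag i : i <= b -> projT1 (v `|b - i|%N) = i.
Proof. by rewrite tag_iter_down; lia. Qed.

Lemma int_iter_down : exists u : forall i : int, i <= b -> U i,
  (forall H, u b H = x0) /\ forall (i : int) H H', u i H = next (u (i + 1) H').
Proof.
exists (fun i H => cast (int_iter_down_tag H) (projT2 (v `|b - i|%N))); split.
  move=> H; have E : `|b - b|%N = 0%N by lia.
  move: (int_iter_down_tag H); rewrite E /= => e.
  by rewrite (eq_irrelevance e erefl).
move=> i H H'; have E : absz (b - i)%R = (absz (b - (i + 1))%R).+1 by lia.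
move: (int_iter_down_tag H) (int_iter_down_tag H'); rewrite E /=.
case: (v _) => j x /= e e'; move: (esym (subrK 1 j)) e.
have ej : j - 1 = i by rewrite e'; lia.
case: i / ej {H H' E} e' => e' e e2; rewrite (eq_irrelevance e2 erefl) /=.
by congr (next _); rewrite /cast; congr eq_rect; apply: eq_irrelevance.
Qed.
End IntIterDown.

Lemma rec_down (T : int -> Type) (R : forall i, T i -> T (i + 1) -> Prop) (a : int)
    (z : forall i, T i) :
  (forall i, a <= i -> R i (z i) (z (i + 1))) ->
  (forall i t1 t2, R (i + 1) t1 t2 -> exists t0, R i t0 t1) ->
  exists s : forall i, T i,
    (forall i, R i (s i) (s (i + 1))) /\ forall i, a <= i -> s i = z i.
Proof.
move=> base step.
pose U i := {p : T i * T (i + 1) | R i p.1 p.2}.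
have nextP i (u : U (i + 1)) : exists u' : U i, (sval u').2 = (sval u).1.
  case: u => -[t1 t2] /= /step[t0 r0].
  by exists (exist _ (t0, t1) r0).
have /dchoice[next nextE] : forall i, exists f : U (i + 1) -> U i,
    forall u, (sval (f u)).2 = (sval u).1 by move=> i; exact: (dchoice (nextP i)).
have [u [u0 uS]] :=
  int_iter_down (exist _ (z a, z (a + 1)) (base a (lexx a)) : U a) next.
pose s i : T i := if pselect (i <= a) is left H then (sval (u i H)).1 else z i.
have sE i H : s i = (sval (u i H)).1.
  by rewrite /s; case: pselect => // K; congr (sval (u i _)).1; apply: Prop_irrelevance.
have sL i : a <= i -> s i = z i.
  rewrite /s; case: pselect => // H ia; have E : a = i by lia.
  by move: H; rewrite -E => H; rewrite u0.
exists s; split=> // i; have [H|ai] := pselect (i + 1 <= a).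
  have H' : i <= a by lia.
  rewrite !sE; move: (svalP (u i H')); rewrite (uS i H' H) nextE //.
have [E|ia] := eqVneq i a; last by rewrite !sL; [apply: (base)| |]; lia.
by rewrite E (sL (a + 1)) ?sL //; [apply: (base) | lia].
Qed.
#[local] Obligation Tactic := idtac.

(** * Cohomology and quasi-isomorphisms *)

Lemma sub_add_cancel (V : zmodType) (d a b : V) : d = a - b + (d + b - a).
Proof. by rewrite [RHS]addrC addrA subrK addrK. Qed.

Lemma addDK (V : zmodType) (x y : V) : x + y - x = y.
Proof. by rewrite addrC addKr. Qed.

Lemma subr_eqD (V : zmodType) (a b c : V) : a - b = c -> a = b + c.
Proof. by move=> <-; rewrite addrC subrK. Qed.

Lemma eq_subrD (V : zmodType) (a b c : V) : a = b + c -> a - b = c.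
Proof. by move=> ->; apply: addDK. Qed.

Lemma subr_addr_eq0 (V : zmodType) (a b c : V) : a + c = 0 -> b + c = 0 -> b - a = 0.
Proof. by move=> ac bc; rewrite -(addrK c b) bc sub0r -opprD addrC ac oppr0. Qed.

Section Cohomology.
Variable R : pzRingType.
Implicit Types C D E : complex R.

Lemma coboundary1 C n (x : C (n + 1)) : coboundary x <-> exists y, x = cd C n y.
Proof.
split=> [[m [e [y ->]]]|[y ->]]; last by exists n, erefl, y.
have E : m = n by apply: (addIr 1).
by case: n / E {x} e => e; exists y; rewrite tr_id.
Qed.

Lemma coboundary_cd C n (y : C n) : coboundary (cd C n y).
Proof. by apply/coboundary1; exists y. Qed.

Lemma coboundary0 C n : coboundary (0 : C n).
Proof. by exists (n - 1), (subrK 1 n), 0; rewrite !linear0. Qed.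

Lemma coboundaryD C n (x y : C n) : coboundary x -> coboundary y -> coboundary (x + y).
Proof.
move=> [m [e [x' ->]]] [m' [e' [y' ->]]].
have E : m = m' by apply: (addIr 1); rewrite e e'.
subst m'; exists m, e, (x' + y').
by rewrite !linearD (tr_irr e' e).
Qed.

Lemma coboundaryN C n (x : C n) : coboundary x -> coboundary (- x).
Proof. by move=> [m [e [x' ->]]]; exists m, e, (- x'); rewrite !linearN. Qed.


Lemma coboundary_map C D (f : chain_map C D) n (x : C n) :
  coboundary x -> coboundary (f n x).
Proof.
by move=> [m [e [x' ->]]]; exists m, e, (f m x'); rewrite cmap_tr cmap_d.
Qed.


Lemma int_succ (P : int -> Prop) : (forall n, P (n + 1)) -> forall n, P n.
Proof. by move=> H n; rewrite -(subrK 1 n). Qed.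

Lemma acyclic1 C :
  acyclic C <-> forall n (x : C (n + 1)), cd C (n + 1) x = 0 -> exists y, x = cd C n y.
Proof.
split=> [H n x x0|H]; first by apply/coboundary1/H.
by apply: int_succ => n x /H/coboundary1.
Qed.

Lemma qiso_cone C D (f : chain_map C D) : qiso f <-> acyclic (cone f).
Proof.
split=> [fq|ac].
  apply/acyclic1 => n [c d] /= E.
  have c0 : cd C (n + 1 + 1) c = 0.
    by apply: oppr_inj; rewrite oppr0; exact: (congr1 fst E).
  have fc : f (n + 1 + 1) c + cd D (n + 1) d = 0 := congr1 snd E.
  have [|c' c'E] := proj1 (coboundary1 _) ((fq _).1 c c0 _).
    apply/coboundary1; exists (- d); rewrite linearN.
    by apply/eqP; rewrite -addr_eq0 fc.
  have [|c'' c''0 /coboundary1[z zE]] := (fq (n + 1)).2 (d + f (n + 1) c').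
    by rewrite linearD -cmap_d -c'E -fc; apply: addrC.
  exists (c'' - c', z); congr pair => /=.
    by rewrite linearB c''0 sub0r opprK.
  by rewrite linearB -zE; apply: sub_add_cancel.
move=> n; split.
  move=> x x0 [m [e [y]]] fx.
  have [|k [e' [[u v]]]] := ac m (tr (esym e) x, - y).
    congr pair => /=; first by rewrite (cd_tr _ (congr1 (+%R^~ 1) (esym e))) x0 linear0 oppr0.
    by case: n / e x x0 fx => x x0; rewrite !tr_id => ->; rewrite linearN subrr.
  case: n / e x x0 fx => x x0 _ /=; rewrite ?tr_id; case: m / e' x x0 y => x x0 y.
  rewrite tr_id => /(congr1 fst) /= ->.
  by apply: coboundaryN; apply: coboundary_cd.
move: n; apply: int_succ => n y y0.
have [|[x z] /(congr1 (fun p => (p.1, p.2))) [/= E1 E2]] :=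
  proj1 (acyclic1 _) ac n (0, y).
  by congr pair => /=; rewrite ?linear0 ?oppr0 ?add0r.
exists x; first by apply: oppr_inj; rewrite oppr0 -E1.
by rewrite E2 addDK; apply: coboundary_cd.
Qed.

Lemma qiso_ext C D (f g : chain_map C D) :
  qiso g -> (forall n x, f n x = g n x) -> qiso f.
Proof.
move=> gq E n; split=> [x x0|y y0]; first by rewrite E; apply: (gq n).1.
by have [x x0 xy] := (gq n).2 y y0; exists x; rewrite ?E.
Qed.

Section TwoOfThree.
Variables (C D E : complex R) (f : chain_map C D) (g : chain_map D E) (h : chain_map C E).
Hypothesis hE : forall n x, h n x = g n (f n x).

Lemma qiso_comp : qiso f -> qiso g -> qiso h.
Proof.
move=> fq gq n; split=> [x x0|z z0].
  rewrite hE => /((gq n).1 (f n x)) H; apply: (fq n).1 => //; apply: H.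
  by rewrite -cmap_d x0 linear0.
have [y y0 yz] := (gq n).2 z z0; have [x x0 xy] := (fq n).2 y y0.
exists x => //; rewrite hE; have := coboundaryD yz (coboundary_map g xy).
by rewrite linearB addrA subrK.
Qed.

Lemma qiso_cancel_l : qiso g -> qiso h -> qiso f.
Proof.
move=> gq hq n; split=> [x x0 fx|y y0].
  by apply: (hq n).1 => //; rewrite hE; apply: coboundary_map.
have [|x x0 xz] := (hq n).2 (g n y); first by rewrite -cmap_d y0 linear0.
exists x => //; apply: (gq n).1; first by rewrite linearB y0 -cmap_d x0 linear0 subrr.
by rewrite linearB -hE.
Qed.

End TwoOfThree.

Definition exact_seq (M1 M2 M3 : lmodType R) (i : {linear M1 -> M2}) (p : {linear M2 -> M3}) :=
  [/\ injective i, surj p & forall x, p x = 0 <-> exists y, x = i y].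

Lemma cohomology_zero_ses C D E (i : chain_map C D) (p : chain_map D E) n :
  (forall k, exact_seq (i k) (p k)) ->
  cohomology_zero C n -> cohomology_zero E n -> cohomology_zero D n.
Proof.
move=> ex Cn En x x0; have [_ _ exn] := ex n.
have [|m [e [z zE]]] := En (p n x); first by rewrite -cmap_d x0 linear0.
have [_ /(_ z)[z' z'E] _] := ex m.
have [y yE] : exists y, x - tr e (cd D m z') = i n y.
  by apply/exn; rewrite linearB zE -z'E cmap_tr cmap_d subrr.
have [|m' [e' [y' y'E]]] := Cn y.
  have [iI _ _] := ex (n + 1); apply: iI.
  rewrite cmap_d -yE linearB x0 linear0; case: n / e {exn yE x x0 Cn En zE y} => /=.
  by rewrite ?tr_id cdd subrr.
rewrite -[x](subrK (tr e (cd D m z'))) yE y'E; apply: coboundaryD.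
  by apply: coboundary_map; exists m', e', y'.
by exists m, e, z'.
Qed.

Program Definition cone_map C D C' D' (f : chain_map C D) (f' : chain_map C' D')
   (a : chain_map C C') (b : chain_map D D')
   (ab : forall n x, f' n (a n x) = b n (f n x)) : chain_map (cone f) (cone f') :=
  @ChainMap R (cone f) (cone f')
    (fun n => @mklin R (cone f n) (cone f' n) (fun u => (a (n + 1) u.1, b n u.2)) _) _.
Next Obligation.
by move=> C D C' D' f f' a b ab n c x y /=; rewrite !linearP.
Qed.
Next Obligation.
move=> C D C' D' f f' a b ab n [x y]; congr pair => /=.
  by rewrite linearN cmap_d.
by rewrite linearD cmap_d ab.
Qed.

Section Five.
Variables (C1 C2 C3 D1 D2 D3 : complex R).
Variables (i : chain_map C1 C2) (p : chain_map C2 C3).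
Variables (j : chain_map D1 D2) (q : chain_map D2 D3).
Variables (f1 : chain_map C1 D1) (f2 : chain_map C2 D2) (f3 : chain_map C3 D3).
Hypothesis ex : forall n, exact_seq (i n) (p n).
Hypothesis ex' : forall n, exact_seq (j n) (q n).
Hypothesis f12 : forall n x, f2 n (i n x) = j n (f1 n x).
Hypothesis f23 : forall n x, f3 n (p n x) = q n (f2 n x).

(** The cones of the three maps again form a short exact sequence, so the five lemma reduces to
    acyclicity of its middle term. *)
Lemma qiso_ses : qiso f1 -> qiso f3 -> qiso f2.
Proof.
move=> /qiso_cone a1 /qiso_cone a3; apply/qiso_cone => n.
apply: (cohomology_zero_ses (i := cone_map f12) (p := cone_map f23)) => // k.
have [iI pS ipE] := ex (k + 1); have [jI qS jqE] := ex' k; split.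
- by move=> [x y] [x' y'] [] /iI -> /jI ->.
- by move=> [z w]; have [x <-] := pS z; have [y <-] := qS w; exists (x, y).
- move=> [x y]; split=> [[/ipE[x' ->] /jqE[y' ->]]|[[x' y']] /= [-> ->]].
    by exists (x', y').
  congr pair => /=; first by apply/ipE; exists x'.
  by apply/jqE; exists y'.
Qed.
End Five.

End Cohomology.

(** * Hom complexes and quasi-isomorphisms *)

Lemma sgS (V : zmodType) n (x : V) : sg (n + 1) x = - sg n x.
Proof. by rewrite sg_add sg1 /sg; case: ifP. Qed.

Lemma add_cancel_mid (V : zmodType) (x y z y' t : V) :
  y = y' -> t = - z -> x - (y + z) + y' = x + t.
Proof. by move=> <- ->; rewrite opprD addrA addrAC subrK. Qed.

Section Differential.
Variables (R : pzRingType) (C : complex R).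

Lemma trK i j (e : i = j) (e' : j = i) (x : C i) : tr e' (tr e x) = x.
Proof. by rewrite tr_tr tr_id. Qed.
Lemma tr0 i j (e : i = j) : tr e (0 : C i) = 0.
Proof. exact: linear0. Qed.
Lemma trD i j (e : i = j) (x y : C i) : tr e (x + y) = tr e x + tr e y.
Proof. exact: linearD. Qed.
Lemma trN i j (e : i = j) (x : C i) : tr e (- x) = - tr e x.
Proof. exact: linearN. Qed.
Lemma trB i j (e : i = j) (x y : C i) : tr e (x - y) = tr e x - tr e y.
Proof. exact: linearB. Qed.
Lemma tr_sg i j (e : i = j) n (x : C i) : tr e (sg n x) = sg n (tr e x).
Proof. exact: (sg_lin (tr e)). Qed.

(** The differential followed by transport to any index equal to [i + 1]; sums bracketed differently
    can then be matched by arbitrary proofs of equality. *)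
Definition cde i j (e : i + 1 = j) : {linear C i -> C j} :=
  (tr (C := C) e \o cd C i : {linear _ -> _}).

Lemma cdeE i j (e : i + 1 = j) x : cde e x = tr e (cd C i x). Proof. by []. Qed.

Lemma cde_cd i (e : i + 1 = i + 1) x : cde e x = cd C i x.
Proof. by rewrite cdeE tr_id. Qed.

Lemma cde_tr i j k (e : i = j) (e' : j + 1 = k) x :
  cde e' (tr e x) = cde (etrans (congr1 (+%R^~ 1) e) e') x.
Proof. by case: j / e e' => e'; rewrite tr_id; congr (cde _ x); apply: eq_irrelevance. Qed.

Lemma tr_cde i j k (e : i + 1 = j) (e' : j = k) x :
  tr e' (cde e x) = cde (etrans e e') x.
Proof. by case: k / e'; rewrite tr_id. Qed.

Lemma cde_irr i j (e e' : i + 1 = j) x : cde e x = cde e' x.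
Proof. by rewrite (eq_irrelevance e e'). Qed.

Lemma cde_cde i j k (e : i + 1 = j) (e' : j + 1 = k) x : cde e' (cde e x) = 0.
Proof. by case: j / e e' => e'; case: k / e'; rewrite !cde_cd cdd. Qed.

Lemma cde0_cd i j (e : i + 1 = j) x : cde e x = 0 <-> cd C i x = 0.
Proof. by case: j / e; rewrite cde_cd. Qed.

End Differential.

Lemma cmap_cde (R : pzRingType) (C D : complex R) (f : chain_map C D) i j
  (e : i + 1 = j) x : f j (cde C e x) = cde D e (f i x).
Proof. by case: j / e; rewrite !cde_cd cmap_d. Qed.

(** Acyclicity of the cone of [u] read off on elements; this is one step of the lifting in
    [hom_lift]. *)
Lemma qiso_solve (R : pzRingType) (M N : complex R) (u : chain_map M N)
    i j k (e : i + 1 = j) (e' : j + 1 = k) (x : M k) (y : N j) :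
  qiso u -> cd M k x = 0 -> u k x = cde N e' y ->
  exists m n, cde M e' m = x /\ u j m + cde N e n = y.
Proof.
case: k / e' x; case: j / e y => y x uq x0; rewrite cde_cd => ux.
have [|m0 m0E] := proj1 (coboundary1 _) ((uq _).1 x x0 _).
  by apply/coboundary1; exists y.
have [|m1 m10 /coboundary1[n nE]] := (uq (i + 1)).2 (y - u (i + 1) m0).
  by rewrite linearB -cmap_d -m0E ux subrr.
exists (m0 + m1), n; rewrite !cde_cd; split; first by rewrite linearD m10 addr0.
by rewrite -nE linearD addrACA subrr addr0 addrC subrK.
Qed.

Section Components.
Variables (A B : pzRingType) (L : bicomplex A B).

Definition mkcoch (J : complex A) n (g : forall i, {linear L i -> J (i + n)}) :
  cochain L J n := @Cochain A B L J n (fun i => g i) (fun i => linearP (g i)).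

Lemma hom_dE (J : complex A) n (f : cochain L J n) i (x : L i)
    (e : i + n + 1 = i + (n + 1)) (e' : i + 1 + n = i + (n + 1)) :
  hom_d f i x = cde J e (f i x) - sg n (tr e' (f (i + 1) (bd L i x))).
Proof.
rewrite [LHS]/= /hom_d_fun; congr (_ - sg n _); exact: tr_irr.
Qed.

End Components.

Section Lift.
Variables (A B : pzRingType) (L : bicomplex A B) (M N : complex A).
Variables (u : chain_map M N) (n : int).
Variables (f : cochain L N (n + 1)) (e : cochain L M (n + 1 + 1)).
Hypotheses (Lb : bounded_above (lcomplex L)) (Lp : forall i, projective (L i)).
Hypotheses (uq : qiso u) (e0 : hom_d e = 0).
Hypothesis fe : forall i (x : L i), hom_d f i x = u (i + (n + 1 + 1)) (e i x).

Let E1 (i : int) : i + (n + 1) + 1 = i + (n + 1 + 1). Proof. lia. Qed.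
Let E2 (i : int) : i + 1 + (n + 1) = i + (n + 1 + 1). Proof. lia. Qed.
Let E3 (i : int) : i + n + 1 = i + (n + 1). Proof. lia. Qed.
Let E4 (i : int) : i + 1 + n = i + (n + 1). Proof. lia. Qed.

Let F1 (i : int) : i + (n + 1 + 1) + 1 = i + (n + 1 + 1 + 1). Proof. lia. Qed.
Let F2 (i : int) : i + 1 + (n + 1 + 1) = i + (n + 1 + 1 + 1). Proof. lia. Qed.

(** The case [e = 0] is surjectivity on the cohomology of Hom complexes, and general [e] gives
    injectivity. The components are found by descending induction, starting with zero above the top
    degree of [L]. *)
Lemma hom_lift : exists (a : cochain L M (n + 1)) (b : cochain L N n),
  hom_d a = e /\ forall i (x : L i), f i x = u _ (a i x) + hom_d b i x.
Proof.
pose T (i : int) : Type :=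
  prod {linear L i -> M (i + (n + 1))} {linear L i -> N (i + n)}.
pose Rel i (t : T i) (t' : T (i + 1)) := forall x : L i,
  cde M (E1 i) (t.1 x) - sg (n + 1) (tr (E2 i) (t'.1 (bd L i x))) = e i x /\
  f i x = u _ (t.1 x)
          + (cde N (E3 i) (t.2 x) - sg n (tr (E4 i) (t'.2 (bd L i x)))).
have [c Lc] := Lb.
have L0 (i : int) (x : L i) : c + 1 <= i -> x = 0 by move=> ci; apply: Lc; lia.
pose z i : T i := ((\0 : {linear L i -> M (i + (n + 1))}), (\0 : {linear L i -> N (i + n)})).
have [|i t1 t2 r|s [sR _]] := @rec_down T Rel (c + 1) z.
- move=> i ci x; rewrite (L0 _ x) // [e i 0]linear0 [f i 0]linear0.
  by rewrite [(z i).1 0]linear0 [(z i).2 0]linear0 !linear0 !sg0 !subr0 addr0.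
(* [al] and [be] are the values that the unknown components in degree [i] must attain once those in
   degree [i + 1] are known. Solutions exist elementwise by [qiso_solve], and projectivity of [L i]
   makes them linear. *)
- pose al x := e i x + sg (n + 1) (tr (E2 i) (t1.1 (bd L i x))).
  pose be x := f i x + sg n (tr (E4 i) (t1.2 (bd L i x))).
  have alL : linear al by move=> a x y; rewrite /al !linearP sgD sgZ scalerDr addrACA.
  have beL : linear be by move=> a x y; rewrite /be !linearP sgD sgZ scalerDr addrACA.
  pose Y : lmodType A := (M (i + (n + 1 + 1))%R * N (i + (n + 1))%R)%type.
  pose X : lmodType A := (M (i + (n + 1))%R * N (i + n)%R)%type.
  pose v x : Y := (al x, be x).
  have vL : linear v by move=> a x y; congr pair; [apply: alL | apply: beL].
  pose Tf (p : X) : Y := (cde M (E1 i) p.1, u _ p.1 + cde N (E3 i) p.2).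
  have TfL : linear Tf.
    by move=> a x y; congr pair => /=; rewrite !linearP // scalerDr addrACA.
  have solv x : exists z, mklin TfL z = mklin vL x.
    have [m [k [mE kE]]] : exists m k,
        cde M (E1 i) m = al x /\ u _ m + cde N (E3 i) k = be x.
      have r1 := (r (bd L i x)).1; have r2 := (r (bd L i x)).2.
      rewrite bdd linear0 !linear0 sg0 subr0 in r1.
      rewrite bdd !linear0 sg0 subr0 in r2.
      apply: qiso_solve => //.
        apply/(cde0_cd (F1 i)); move/(congr1 (fun g : cochain L M _ => g i x)): e0.
        rewrite (hom_dE _ _ (F1 i) (F2 i)) -r1 sgS opprK tr_cde => e0'.
        by rewrite /al linearD sg_lin cde_tr -[RHS]e0'; congr (_ + sg _ _); apply: cde_irr.
      have fex := fe x; rewrite (hom_dE _ _ (E1 i) (E2 i)) r2 in fex.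
      rewrite /al linearD -fex [u _ (sg _ _)]sg_lin. rewrite [u _ (tr _ _)]cmap_tr.
 rewrite /be [tr _ (_ + _)]linearD sgD [RHS]linearD [cde _ _ (sg _ _)]sg_lin.
      apply: add_cancel_mid => //.
      rewrite sgS opprK cde_tr; congr (sg _ _).
      by apply: etrans (esym (tr_cde (E3 (i + 1)) (E2 i) _)); apply: cde_irr.
    by exists (m, k); exact: (f_equal2 pair mE kE).
  have [h hE] := projective_lift (@Lp i) solv.
  have h1L : linear (fun x => (h x).1) by move=> a x y; rewrite linearP.
  have h2L : linear (fun x => (h x).2) by move=> a x y; rewrite linearP.
  exists (mklin h1L, mklin h2L) => x.
  have h1 : cde M (E1 i) (h x).1 = al x := congr1 fst (hE x).
  have h2 : u _ (h x).1 + cde N (E3 i) (h x).2 = be x := congr1 snd (hE x).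
  change (cde M (E1 i) (h x).1 - sg (n + 1) (tr (E2 i) (t1.1 (bd L i x))) = e i x /\
    f i x = u _ (h x).1 + (cde N (E3 i) (h x).2 - sg n (tr (E4 i) (t1.2 (bd L i x))))).
  by rewrite h1 /al addrK; split=> //; rewrite [RHS]addrA h2 /be addrK.
exists (mkcoch (fun i => (s i).1)), (mkcoch (fun i => (s i).2)); split.
  apply: cochainP => i x; rewrite (hom_dE _ _ (E1 i) (E2 i)); exact: (sR i x).1.
move=> i x; rewrite (hom_dE _ _ (E3 i) (E4 i)); exact: (sR i x).2.
Qed.
End Lift.

Lemma shift_family (T : int -> Type) (s : forall i, T (i + 1)) :
  exists b : forall i, T i, forall i, b (i + 1) = s i.
Proof.
exists (fun i => eq_rect (i - 1 + 1) T (s (i - 1)) i (subrK 1 i)) => i.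
have H j (e : j + 1 = i + 1) : eq_rect (j + 1) T (s j) (i + 1) e = s i.
  have E : j = i by apply: (addIr 1).
  by subst j; rewrite (eq_irrelevance e erefl).
exact: H.
Qed.

(** The sign bookkeeping behind the kernel condition in [hom_extend]. *)
Lemma sg_kernel (V : zmodType) n (A B P E X Y : V) :
  sg (n + 1) A = P - sg n B - E -> X = Y ->
  A - B + sg (n + 1) (- P + X - (- E + Y)) = 0.
Proof.
rewrite -{2}[A](sgK (n + 1)) => -> ->.
rewrite opprD opprK addrACA subrr addr0 !sgS !(sgD, sgN) sgK.
by rewrite !opprD !opprK [X in X + _]addrAC addrK addrACA addNr add0r addrN.
Qed.

Section PointwiseLinear.
Variables (R : pzRingType) (M N : lmodType R).
Implicit Types f g : M -> N.

Lemma fun_linD f g : linear f -> linear g -> linear (fun x => f x + g x).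
Proof. by move=> fL gL a x y; rewrite fL gL scalerDr addrACA. Qed.

Lemma fun_linN f : linear f -> linear (fun x => - f x).
Proof. by move=> fL a x y; rewrite fL opprD scalerN. Qed.

Lemma fun_linsg n f : linear f -> linear (fun x => sg n (f x)).
Proof. by move=> fL a x y; rewrite fL sgD sgZ. Qed.

Lemma fun_linC (K : lmodType R) (h : {linear N -> K}) f :
  linear f -> linear (fun x => h (f x)).
Proof. by move=> fL a x y; rewrite fL linearP. Qed.

Lemma fst_linear : linear (fun x : (M * N)%type => x.1). Proof. by []. Qed.
Lemma snd_linear : linear (fun x : (M * N)%type => x.2). Proof. by []. Qed.
Lemma inl_linear : linear (fun x : M => (x, 0) : (M * N)%type).
Proof. by move=> a x y; congr pair; rewrite /= scaler0 addr0. Qed.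
Lemma inr_linear : linear (fun x : N => (0, x) : (M * N)%type).
Proof. by move=> a x y; congr pair; rewrite /= scaler0 addr0. Qed.
End PointwiseLinear.

Lemma subrK_mid (V : zmodType) (x y z : V) : y - x + (x + z - y) = z.
Proof. by rewrite [LHS]addrC addrA subrK addDK. Qed.

Lemma subr_to (V : zmodType) (a b c : V) : a - b = c -> b = a - c.
Proof. by move=> <-; rewrite subKr. Qed.

Section Extend.
Variables (A B1 B2 : pzRingType) (K : bicomplex A B1) (L : bicomplex A B2).
Variables (J : complex A) (p : chain_map (lcomplex K) (lcomplex L)) (n : int).
Variables (f : cochain K J (n + 1)) (e : cochain L J (n + 1 + 1)).
Hypotheses (Jb : bounded_below J) (Ji : forall i, injective_module (J i)).
Hypotheses (pq : qiso p) (e0 : hom_d e = 0).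
Hypothesis fe : forall i (x : K i), hom_d f i x = e i (p i x).

Let E1 (i : int) : i + (n + 1) + 1 = i + (n + 1 + 1). Proof. lia. Qed.
Let E2 (i : int) : i + 1 + (n + 1) = i + (n + 1 + 1). Proof. lia. Qed.
Let E2' (i : int) : i + (n + 1 + 1) = i + 1 + (n + 1). Proof. lia. Qed.
Let E3 (i : int) : i + n + 1 = i + (n + 1). Proof. lia. Qed.
Let E4 (i : int) : i + 1 + n = i + (n + 1). Proof. lia. Qed.
Let F1 (i : int) : i + (n + 1 + 1) + 1 = i + (n + 1 + 1 + 1). Proof. lia. Qed.
Let F2 (i : int) : i + 1 + (n + 1 + 1) = i + (n + 1 + 1 + 1). Proof. lia. Qed.

(** The dual of [hom_lift], by ascending induction from the bottom degree of [J]; again [e = 0] and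
    general [e] give the two halves of a quasi-isomorphism. *)
Lemma hom_extend : exists (a : cochain L J (n + 1)) (b : cochain K J n),
  hom_d a = e /\ forall i (x : K i), f i x = a i (p i x) + hom_d b i x.
Proof.
(* The component of [b] in degree [i + 1] is paired with that of [a] in degree [i], because one
   extension problem yields both; [shift_family] undoes the offset at the end. *)
pose T (i : int) : Type :=
  prod {linear K (i + 1) -> J (i + 1 + n)} {linear L i -> J (i + (n + 1))}.
pose eqb i (b : {linear K i -> J (i + n)}) (b' : {linear K (i + 1) -> J (i + 1 + n)})
    (a : {linear L i -> J (i + (n + 1))}) (x : K i) :=
  f i x = a (p i x) + (cde J (E3 i) (b x) - sg n (tr (E4 i) (b' (bd K i x)))).
pose eqa i (a : {linear L i -> J (i + (n + 1))})
    (a' : {linear L (i + 1) -> J (i + 1 + (n + 1))}) (z : L i) :=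
  cde J (E1 i) (a z) - sg (n + 1) (tr (E2 i) (a' (bd L i z))) = e i z.
pose Rel i (t : T i) (t' : T (i + 1)) :=
  (forall x, eqb (i + 1) t.1 t'.1 t'.2 x) /\ (forall z, eqa i t.2 t'.2 z).
have [c Jc] := Jb.
pose z i : T i :=
  ((\0 : {linear K (i + 1) -> J (i + 1 + n)}), (\0 : {linear L i -> J (i + (n + 1))})).
have [|i t0 t1 [rb ra]|s [sR _]] := @rec_up T Rel (c - n - 1 - 1) z.
- move=> i ci; have J0 : zero_module (J (i + 1 + (n + 1))) by apply: Jc; lia.
  have J0' : zero_module (J (i + (n + 1 + 1))) by apply: Jc; lia.
  by split=> x; [rewrite /eqb [LHS]J0 [RHS]J0 | rewrite /eqa [LHS]J0' [RHS]J0'].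
- set k := i + 1 in t1 rb ra *; pose b1 := t1.1; pose a1 := t1.2.
  rewrite /= in rb ra.
  pose X : lmodType A := (K (k + 1)%R * L k)%type.
  pose Y : lmodType A := (K (k + 1 + 1)%R * L (k + 1)%R)%type.
  pose Tf (u : X) : Y := (bd K _ u.1, p _ u.1 + bd L k u.2).
  have TfL : linear Tf.
    by move=> a x y; congr pair => /=; rewrite !linearP // scalerDr addrACA.
  pose v (u : X) := f (k + 1) u.1 - cde J (E3 (k + 1)) (b1 u.1)
    + sg (n + 1) (tr (E2' k) (cde J (E1 k) (a1 u.2) - e k u.2)).
  have vL : linear v.
    apply: fun_linD; first apply: fun_linD.
    - exact: (fun_linC (f (k + 1) : {linear _ -> _}) (@fst_linear _ _ _)).
    - apply: fun_linN; exact: (fun_linC _ (fun_linC b1 (@fst_linear _ _ _))).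
    apply/fun_linsg/fun_linC/fun_linD.
      exact: (fun_linC _ (fun_linC a1 (@snd_linear _ _ _))).
    apply: fun_linN; exact: (fun_linC (e k : {linear _ -> _}) (@snd_linear _ _ _)).
  (* An element of the kernel of [Tf] is, up to sign, a cocycle of the cone of [p], hence a
     coboundary; there [v] vanishes by the relations already obtained and by [e0]. *)
  have ker u : mklin TfL u = 0 -> mklin vL u = 0.
    case: u => x w; rewrite /= /linear_fun /Tf /v /= => E.
    have dx : bd K (k + 1) x = 0 := congr1 fst E.
    have pxw : p (k + 1) x + bd L k w = 0 := congr1 snd E.
    have [|x0 x0E] := proj1 (coboundary1 _) ((pq (k + 1)).1 x dx _).
      apply/coboundary1; exists (- w); rewrite linearN.
      by apply/eqP; rewrite -addr_eq0 pxw.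
    have [|y y0 /coboundary1[w0 w0E]] := (pq k).2 (p k x0 + w).
      by rewrite linearD -cmap_d -x0E.
    pose x1 := x0 - y; have x1E : bd K k x1 = x by rewrite x0E linearB y0 subr0.
    have wE : w = - p k x1 + bd L i w0.
      by rewrite -[bd L i w0]w0E linearB opprB subrK_mid.
    rewrite -x1E wE.
    pose AA := f (k + 1) (bd K k x1); pose BB := cde J (E3 (k + 1)) (b1 (bd K k x1)).
    pose PP := tr (C := J) (E2' k) (cde J (E1 k) (a1 (p k x1))).
    pose EE := tr (C := J) (E2' k) (e k (p k x1)).
    pose XX := tr (C := J) (E2' k) (cde J (E1 k) (a1 (bd L i w0))).
    pose YY := tr (C := J) (E2' k) (e k (bd L i w0)).
    have H1 : sg (n + 1) AA = PP - sg n BB - EE.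
      have := fe x1; rewrite (hom_dE _ _ (E1 k) (E2 k)) => /subr_to.
      move=> /(congr1 (tr (C := J) (E2' k))).
      rewrite trB tr_sg trK -/AA => ->; congr (_ - _).
      rewrite rb linearD [cde _ _ (_ - _)]linearB [cde _ _ (sg _ _)]sg_lin.
      rewrite cde_cde sub0r trD trN tr_sg; congr (_ - sg _ _) => //.
      by rewrite cde_tr tr_cde; apply: cde_irr.
    have H2 : XX = YY.
      have G : i + (n + 1 + 1 + 1) = k + 1 + (n + 1) by rewrite /k; lia.
      have := congr1 (fun g : cochain L J _ => g i w0) e0.
      rewrite (hom_dE _ _ (F1 i) (F2 i)) -ra linearB cde_cde sub0r.
      rewrite [cde _ _ (sg _ _)]sg_lin !sgS !opprK => /eqB.
      rewrite cde_tr => /(congr1 (sg n)); rewrite !sgK => /(congr1 (tr (C := J) G)).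
      rewrite tr_cde tr_tr /XX /YY tr_cde => EQ.
      by apply: etrans (etrans EQ _); [apply: cde_irr | apply: tr_irr].
    rewrite -[RHS](sg_kernel H1 H2); congr (_ - _ + sg _ _).
    have ekE : e k (- p k x1 + bd L i w0) = - e k (p k x1) + e k (bd L i w0).
      by rewrite linearD linearN.
    have a1E : cde J (E1 k) (a1 (- p k x1 + bd L i w0)) =
      - cde J (E1 k) (a1 (p k x1)) + cde J (E1 k) (a1 (bd L i w0)).
      by rewrite !linearD !linearN.
    by apply: etrans (congr1 _ (f_equal2 (fun a b => a - b) a1E ekE)) _; rewrite trB !trD !trN.
  have [h hE] := injective_extend (@Ji (k + 1 + (n + 1))) ker.
  have b2L := fun_linN (fun_linsg n (fun_linC (tr (C := J) (esym (E4 (k + 1))))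
    (fun_linC h (@inl_linear _ (K (k + 1 + 1)) (L (k + 1)))))).
  have a2L := fun_linC h (@inr_linear _ (K (k + 1 + 1)) (L (k + 1))).
  exists (mklin b2L, mklin a2L); split=> [x|x].
    change (f (k + 1) x = h (0, p (k + 1) x) + (cde J (E3 (k + 1)) (b1 x)
      - sg n (tr (E4 (k + 1)) (- sg n (tr (esym (E4 (k + 1))) (h (bd K (k + 1) x, 0))))))).
    rewrite trN tr_sg sgN sgK trK opprK [RHS]addrCA -linearD.
    have -> : (0, p (k + 1) x) + (bd K (k + 1) x, 0) = Tf (x, 0).
      by rewrite /Tf; congr pair; rewrite /= ?linear0 ?add0r ?addr0.
    apply: etrans (congr1 (fun y => _ + y) (esym (hE (x, 0)))) => //.
    change (f (k + 1) x = cde J (E3 (k + 1)) (b1 x) + v (x, 0)); rewrite /v.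
    by rewrite [e k 0]linear0 [a1 0]linear0 linear0 subr0 tr0 sg0 addr0 [RHS]addrC subrK.
  change (cde J (E1 k) (a1 x) - sg (n + 1) (tr (E2 k) (h (0, bd L k x))) = e k x).
  have -> : (0, bd L k x) = Tf (0, x).
    by rewrite /Tf; congr pair; rewrite /= linear0 ?add0r.
  apply: etrans (congr1 (fun y => _ - sg _ (tr _ y)) (hE (0, x))) _.
  have -> : mklin vL (0, x) = sg (n + 1) (tr (E2' k) (cde J (E1 k) (a1 x) - e k x)).
    change (v (0, x) = sg (n + 1) (tr (E2' k) (cde J (E1 k) (a1 x) - e k x))).
    by rewrite /v [f (k + 1) _]linear0 [b1 _]linear0 linear0 subr0 add0r.
  by rewrite tr_sg sgK trK subKr.
have [b bE] := @shift_family (fun i => {linear K i -> J (i + n)}) (fun i => (s i).1).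
exists (mkcoch (fun i => (s i).2)), (mkcoch b); split.
  apply: cochainP => i x; rewrite (hom_dE _ _ (E1 i) (E2 i)); exact: (sR i).2.
apply: int_succ => i x; rewrite (hom_dE _ _ (E3 _) (E4 _)) /= !bE.
exact: (sR i).1.
Qed.
End Extend.

Lemma zlinear (U V : zmodType) (f : U -> V) :
  {morph f : x y / x + y} -> linear (f : zmodule U -> zmodule V).
Proof.
move=> fD; have f0 : f 0 = 0 by apply: (addrI (f 0)); rewrite -fD !addr0.
have fN x : f (- x) = - f x by apply: (addrI (f x)); rewrite -fD !subrr.
have fM x m : f (x *~ m) = f x *~ m.
  have H k : f (x *+ k) = f x *+ k.
    by elim: k => [|k IHk]; rewrite ?mulr0n // !mulrS fD IHk.
  by case: m => k; [apply: H | rewrite fN H].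
by move=> m x y; rewrite fD; congr (_ + _); apply: fM.
Qed.

Section Restriction.
Variable R : pzRingType.

(* Hom_A(Q, M) carries no B-action for a complex Q of left A-modules, so that
   it is compared with complexes of B-modules over the integers. *)
Program Definition zc (C : complex R) : complex int :=
  @Complex int (fun i => (zmodule (C i)) : lmodType int)
    (fun i => @mklin int (zmodule (C i)) (zmodule (C (i + 1))) (fun x => cd C i x) _) _.
Next Obligation. by move=> C i; apply: zlinear => x y; apply: linearD. Qed.
Next Obligation. by move=> C i x; exact: (cdd (x : C i)). Qed.

Program Definition zmap (C D : complex R) (f : chain_map C D) : chain_map (zc C) (zc D) :=
  @ChainMap int (zc C) (zc D)
    (fun i => @mklin int (zmodule (C i)) (zmodule (D i)) (fun x => f i x) _) _.
Next Obligation. by move=> C D f i; apply: zlinear => x y; apply: linearD. Qed.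
Next Obligation. by move=> C D f i x; exact: (cmap_d f (x : C i)). Qed.

Lemma coboundary_zc (C : complex R) n (x : C n) :
  coboundary (C := zc C) x <-> coboundary x.
Proof.
by split=> -[m [e [y ->]]]; exists m, e, y; case: n / e {x}.
Qed.

Lemma qiso_zmap (C D : complex R) (f : chain_map C D) : qiso (zmap f) <-> qiso f.
Proof.
split=> fq n; have [I S] := fq n; split=> x x0.
- by move=> fx; apply/coboundary_zc/I => //; apply/coboundary_zc.
- by have [z z0 zx] := S x x0; exists z => //; apply/coboundary_zc.
- by move=> fx; apply/coboundary_zc/I => //; apply/coboundary_zc.
- by have [z z0 zx] := S x x0; exists z => //; apply/coboundary_zc.
Qed.

(** Every abelian group is a right module over the integers, so [Hom_complex (triv Q)] is Hom_A(Q,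
    -) and the lemmas on bicomplexes apply to it. *)
Program Definition triv (Q : complex R) : bicomplex R int :=
  @Bicomplex R int (fun i => @Bimod R int (Q i) (fun x m => x *~ m) _ _ _ _ _)
    (fun i => cd Q i) _ (@cdd R Q).
Next Obligation. by move=> Q i x y b; apply: mulrzDl. Qed.
Next Obligation. by move=> Q i x b c; apply: mulrzDr. Qed.
Next Obligation. by move=> Q i x b c; apply: mulrzA. Qed.
Next Obligation. by move=> Q i x; apply: mulr1z. Qed.
Next Obligation. by move=> Q i a x b; rewrite /= scalerMzr. Qed.
Next Obligation. by move=> Q i x b; rewrite /= raddfMz. Qed.

Definition triv_map (Q C : complex R) (p : chain_map Q C) :
  chain_map (lcomplex (triv Q)) C :=
  @ChainMap R (lcomplex (triv Q)) C (fun i => p i) (fun i x => cmap_d p x).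

End Restriction.

Section HomFunctoriality.
Variables (A B : pzRingType).

Section Post.
Variables (L : bicomplex A B) (M N : complex A) (u : chain_map M N).

Definition post_fun n (f : cochain L M n) : cochain L N n :=
  @Cochain A B L N n (fun p x => u _ (f p x))
    (fun p => linearP (u _ \o (f p : {linear _ -> _}))).

Lemma post_linear n : linear (@post_fun n).
Proof. by move=> b f g; apply: cochainP => p x /=; rewrite linearD. Qed.

Lemma post_d n f : post_fun (@hom_d _ _ L M n f) = hom_d (post_fun f).
Proof.
apply: cochainP => p x /=.
by rewrite /hom_d_fun /= linearB sg_lin !cmap_tr cmap_d.
Qed.

Definition post : chain_map (Hom_complex L M) (Hom_complex L N) :=
  @ChainMap B (Hom_complex L M) (Hom_complex L N)
    (fun n => mklin (@post_linear n)) post_d.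

Lemma qiso_post : bounded_above (lcomplex L) -> (forall i, projective (L i)) ->
  qiso u -> qiso post.
Proof.
move=> Lb Lp uq; apply: int_succ; apply: int_succ => n; split.
  move=> x x0 /coboundary1[y yE]; apply/coboundary1.
  have [|a [b [aE _]]] := hom_lift (f := y) Lb Lp uq x0.
    by move=> i z; have := congr1 (fun g : cochain L N _ => g i z) yE => /= <-.
  by exists a.
move=> y y0; have [|i z|a [b [a0 yE]]] := hom_lift (f := y) (e := 0) Lb Lp uq.
- exact: (linear0 (@hom_d _ _ L M _ : {linear _ -> _})).
- by rewrite y0 linear0.
exists a => //; apply/coboundary1; exists b; apply: cochainP => i z /=.
by rewrite yE addDK.
Qed.
End Post.
End HomFunctoriality.

Section Pre.
Variables (A B1 B2 : pzRingType) (K : bicomplex A B1) (L : bicomplex A B2).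
Variables (J : complex A) (p : chain_map (lcomplex K) (lcomplex L)).

Definition pre_fun n (f : cochain L J n) : cochain K J n :=
  @Cochain A B1 K J n (fun i x => f i (p i x))
    (fun i => linearP ((f i : {linear _ -> _}) \o p i)).

Lemma pre_linear n :
  linear (@pre_fun n : zmodule (cochain L J n) -> zmodule (cochain K J n)).
Proof. by apply: zlinear => f g; apply: cochainP. Qed.

Lemma pre_d n f : pre_fun (@hom_d _ _ L J n f) = hom_d (pre_fun f).
Proof.
by apply: cochainP => i x /=; rewrite /hom_d_fun /=; have /= -> := cmap_d p x.
Qed.

Definition pre : chain_map (zc (Hom_complex L J)) (zc (Hom_complex K J)) :=
  @ChainMap int (zc (Hom_complex L J)) (zc (Hom_complex K J))
    (fun n => mklin (@pre_linear n)) pre_d.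

Lemma qiso_pre : bounded_below J -> (forall i, injective_module (J i)) ->
  qiso p -> qiso pre.
Proof.
move=> Jb Ji pq; apply: int_succ; apply: int_succ => n; split.
  move=> x x0 /coboundary_zc/coboundary1[y yE]; apply/coboundary_zc/coboundary1.
  have [|a [b [aE _]]] := hom_extend (f := y) Jb Ji pq x0.
    by move=> i z; have := congr1 (fun g : cochain K J _ => g i z) yE => /= <-.
  by exists a.
move=> y y0; have [|i z|a [b [a0 yE]]] := hom_extend (f := y) (e := 0) Jb Ji pq.
- exact: (linear0 (@hom_d _ _ L J _ : {linear _ -> _})).
- by have := congr1 (fun g : cochain K J _ => g i z) y0.
exists a => //; apply/coboundary_zc/coboundary1; exists b; apply: cochainP => i z /=.
by rewrite yE addDK.
Qed.
End Pre.

(** * Resolutions of perfect complexes and the unit of the adjunction *)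

Section PerfectResolution.
Variable R : pzRingType.

Lemma qiso_section (Q M : complex R) (u : chain_map M Q) :
  bounded_above Q -> (forall i, projective (Q i)) -> qiso u ->
  exists s : chain_map Q M, qiso s.
Proof.
move=> Qb Qp uq.
have e i : i = i + (-1 + 1) :> int by lia.
have e' i : i + (-1 + 1) = i :> int by lia.
(* The identity of [Q] as a cochain of degree 0, written [-1 + 1] to fit [hom_lift]; its lift is the
   section, and the homotopy has degree -1. *)
pose f : cochain (triv Q) Q (-1 + 1) :=
  mkcoch (L := triv Q) (fun i => tr (C := Q) (e i) : {linear _ -> _}).
have s0 (V : zmodType) (x : V) : sg (-1 + 1) x = x by [].
have e'' i : i + (-1 + 1 + 1) = i + 1 :> int by lia.
have F3 i : i + -1 + 1 = i + (-1 + 1) :> int by lia.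
have F4 i : i + 1 + -1 = i + (-1 + 1) :> int by lia.
have F1 i : i + (-1 + 1) + 1 = i + (-1 + 1 + 1) :> int by lia.
have F2 i : i + 1 + (-1 + 1) = i + (-1 + 1 + 1) :> int by lia.
have [|i x|a [b [a0 fE]]] := hom_lift (L := triv Q) (n := -1) (f := f) (e := 0) Qb Qp uq.
- exact: (linear0 (@hom_d _ _ (triv Q) M _ : {linear _ -> _})).
- rewrite (hom_dE _ _ (F1 i) (F2 i)) s0.
  change (cde Q (F1 i) (tr (e i) x) - tr (F2 i) (tr (e (i + 1)) (cd Q i x)) = u _ 0).
  rewrite linear0 cde_tr tr_tr cdeE; apply/eqP; rewrite subr_eq0; apply/eqP; exact: tr_irr.
pose s i : {linear Q i -> M i} := (tr (C := M) (e' i) : {linear _ -> _}) \o (a i : {linear _ -> _}).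
have sd i x : s (i + 1) (cd Q i x) = cd M i (s i x).
  have := congr1 (fun c : cochain (triv Q) M _ => tr (C := M) (e'' i) (c i x)) a0.
  rewrite (hom_dE _ _ (F1 i) (F2 i)) s0 trB tr0 => /eqB.
  rewrite tr_cde tr_tr => E; rewrite /s /= -[RHS](cde_cd erefl) [RHS]cde_tr.
  by apply: etrans (etrans _ (esym E)) _; [apply: tr_irr | apply: cde_irr].
have us i (x : Q i) : cd Q i x = 0 -> coboundary (x - u i (s i x)).
  move=> x0; have := congr1 (tr (C := Q) (e' i)) (fE i x).
  have -> : u i (s i x) = tr (e' i) (u _ (a i x)) by apply: cmap_tr.
  rewrite trD [tr _ (f i x)]trK => E; rewrite {1}E addDK (hom_dE _ _ (F3 i) (F4 i)).
  have -> : bd (triv Q) i x = 0 := x0.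
  by rewrite linear0 tr0 sg0 [X in tr _ X]subr0 tr_cde; eexists _, _, _.
exists (@ChainMap _ Q M s sd) => n; split=> [x x0 sx|y y0].
  rewrite -[x](subrK (u n (s n x))); apply: coboundaryD; first exact: us.
  exact: coboundary_map.
exists (u n y); first by rewrite -cmap_d y0 linear0.
apply: (uq n).1; first by rewrite linearB y0 sub0r -sd -cmap_d y0 !linear0.
by rewrite linearB; apply: us; rewrite -cmap_d y0 linear0.
Qed.

(** The definition of [perfect_above] provides only a zigzag through [Z]; a homotopy section of its
    leg onto [Q] straightens it. *)
Lemma perfect_resolution (X : complex R) : perfect_above X ->
  exists (Q : complex R) (p : chain_map Q X),
    [/\ bounded_above Q, forall i, finitely_generated (Q i) /\ projective (Q i) & qiso p].
Proof.
move=> [Q [Qb Qp [Z [f [g [fq gq]]]]]].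
have [s sq] := qiso_section Qb (fun i => (Qp i).2) gq.
exists Q, (comp_map f s); split=> //.
apply: (qiso_comp (f := s) (g := f)) => //.
Qed.
End PerfectResolution.

Section Unit.
Variables (A B : pzRingType) (L : bicomplex A B).
Variables (Q : complex A) (p : chain_map Q (lcomplex L)).

(* The composition P -> Hom_A(L, L (x)_B P) -> Hom_A(Q, L (x)_B P). *)
Definition unit_map (P : complex B) :
    chain_map (zc P) (zc (Hom_complex (triv Q) (Tensor_complex L P))) :=
  comp_map (pre (Tensor_complex L P) (triv_map p))
           (zmap (right_adjoint (id_map (Tensor_complex L P)))).

Variables (P : complex B) (J : complex A) (g : chain_map (Tensor_complex L P) J).
Hypotheses (Qb : bounded_above Q) (Qp : forall i, projective (Q i)) (pq : qiso p).
Hypotheses (Jb : bounded_below J) (Ji : forall i, injective_module (J i)).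
Hypothesis gq : qiso g.

(** Restricting [right_adjoint g] along [p] gives the unit map followed by composition with [g], and
    both restriction along [p] and composition with [g] are quasi-isomorphisms. The resulting
    criterion does not mention [J]. *)
Lemma qiso_unit : qiso (right_adjoint g) <-> qiso (unit_map P).
Proof.
have q1 : qiso (zmap (post (triv Q) g)) by apply/qiso_zmap; apply: qiso_post.
have q2 : qiso (pre J (triv_map p)) by apply: qiso_pre.
have E n x : comp_map (pre J (triv_map p)) (zmap (right_adjoint g)) n x =
    zmap (post (triv Q) g) n (unit_map P n x).
  apply: cochainP => i y; symmetry.
  exact: (sg_lin (g (i + n))).
split=> [/qiso_zmap rq|uq]; last apply/qiso_zmap.
  apply: (qiso_cancel_l E) => //.
  by apply: (qiso_comp (f := zmap (right_adjoint g)) (g := pre J (triv_map p))).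
apply: (qiso_cancel_l (g := pre J (triv_map p)) (h := comp_map (pre J (triv_map p)) (zmap (right_adjoint g)))) => //.
exact: (qiso_comp E uq q1).
Qed.
End Unit.

(** * Injective resolutions of complexes that are acyclic below some degree *)

Section InjectiveResolution.
Variables (R : pzRingType) (C : complex R) (a : int).
Hypothesis Ca : forall n, n < a -> cohomology_zero C n.

Record stage (i : int) := Stage {
  st_obj :> lmodType R;
  st_im : st_obj -> Prop;
  st_map : {linear C i -> st_obj} }.
Arguments st_im {i}.
Arguments st_map {i}.

(** [st_im] records the coboundaries, which is all that later stages have to know about earlier
    ones. The last two clauses are surjectivity in degree [i] and injectivity in degree [i + 1] of
    the comparison map on cohomology. *)
Definition next_stage i (s : stage i) (t : stage (i + 1)) : Prop :=
  (injective_module s /\ submodule (st_im s)) /\ (injective_module t /\ submodule (st_im t)) /\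
  exists d : {linear s -> t},
  [/\ forall x, st_im s x -> d x = 0,
      forall y, st_im t y <-> exists x, y = d x,
      forall c, d (st_map s c) = st_map t (cd C i c),
      forall x, d x = 0 -> exists2 c, cd C i c = 0 & st_im s (x - st_map s c) &
      forall c, cd C (i + 1) c = 0 -> (exists x, st_map t c = d x) ->
        exists c', c = cd C i c'].

(** The quotient of [N] by [S] is the pushout of [J / B] and [C (i + 1)] over [C i]; an embedding of
    it into an injective module gives both the differential and the comparison map. *)
Lemma exists_next_stage i (s : stage i) :
  injective_module s -> submodule (st_im s) -> exists t, next_stage s t.
Proof.
case: s => J B f /= Ji Bs; pose N : lmodType R := (J * C (i + 1)%R)%type.
pose S (u : N) := exists b c, B b /\ u = (b + f c, - cd C i c).
have Ss : submodule S.
  split; first by exists 0, 0; rewrite !linear0 addr0; split=> //; case: Bs.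
  move=> k _ _ [b [c [Bb ->]]] [b' [c' [Bb' ->]]].
  exists (k *: b + b'), (k *: c + c'); split; first exact: Bs.2.
  congr pair; first by rewrite /= scalerDr linearP addrACA.
  by rewrite /= linearP opprD scalerN.
have [I [phi [Ii phiS]]] := enough_injectives Ss.
have dL := fun_linC phi (@inl_linear R J (C (i + 1))).
have fL := fun_linC phi (@inr_linear R J (C (i + 1))).
pose d := mklin dL.
exists (@Stage (i + 1) I (fun y => exists x, y = d x) (mklin fL)).
split; [by []|split].
  split=> //; split; first by exists 0; rewrite linear0.
  by move=> k _ _ [x ->] [x' ->]; exists (k *: x + x'); rewrite linearP.
exists d; split=> //=.
- by move=> x Bx; apply/phiS; exists x, 0; rewrite !linear0 addr0.
- move=> c; apply: eqB; change (phi (f c, 0) - phi (0, cd C i c) = 0).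
  rewrite -linearB; apply/phiS; exists 0, c.
  by split; [case: Bs | congr pair; rewrite /= ?add0r ?subr0 ?sub0r].
- move=> x /phiS[b [c [Bb [xE /esym/eqP]]]]; rewrite oppr_eq0 => /eqP c0.
  by exists c => //; rewrite xE addrK.
- move=> c _ [x]; rewrite /linear_fun => /eqP; rewrite eq_sym -subr_eq0 -linearB => /eqP/phiS.
  by move=> [b [c' [_ [_ /= E]]]]; exists c'; apply: oppr_inj; rewrite -E sub0r.
Qed.

Lemma injective_resolution_exists : exists (J : complex R) (f : chain_map C J),
  [/\ forall i, injective_module (J i), forall i, i < a -> zero_module (J i) & qiso f].
Proof.
pose O : lmodType R := 'rV[R]_0.
have O0 (x : O) : x = 0 by apply: thinmx0.
pose z i : stage i := @Stage i O (fun=> True) (\0 : {linear C i -> O}).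
have Oi : injective_module O.
  move=> M N g f _; exists (\0 : {linear N -> O}) => x; rewrite [LHS]O0 [RHS]O0 //.
(* Zero modules serve below degree [a]. Injectivity on cohomology in degree [i + 1] then asks for
   [i + 1 < a], whence the bound [a - 1]. *)
have [|i t0 t1 [_ [[ti ts] _]]|s [sR sz]] := @rec_up stage next_stage (a - 1) z.
- move=> i ia; split; [by []|split=> //]; exists (\0 : {linear O -> O}); split=> //=.
  + by move=> x _; exists 0; rewrite ?linear0.
  + by move=> c c0 _; apply: (proj1 (coboundary1 c)); apply: Ca => //; lia.
- exact: exists_next_stage.
have /dchoice[d dP] := fun i => (sR i).2.2.
have dd i x : d (i + 1) (d i x) = 0.
  have [_ /(_ (d i x)) im _ _ _] := dP i; have [+ _ _ _ _] := dP (i + 1).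
  by apply; apply/im; exists x.
pose J := @Complex R (fun i => s i) d dd.
have fd i x : st_map (s (i + 1)) (cd C i x) = cd J i (st_map (s i) x).
  by have [_ _ <-] := dP i.
exists J, (@ChainMap R C J (fun i => st_map (s i)) fd); split.
- by move=> i; case: (sR i) => -[].
- by move=> i ia x; move: (x); rewrite /J /= sz; [exact: O0 | lia].
apply: int_succ => n; split.
  by move=> x x0 /coboundary1[y yE]; apply/coboundary1; have [_ _ _ _] := dP n; apply=> //; exists y.
move=> y y0; have [_ _ _ /(_ y y0)[c c0 im] _] := dP (n + 1).
exists c => //; apply/coboundary1; have [_ imP _ _ _] := dP n; exact/imP.
Qed.
End InjectiveResolution.

(** * Retracts of projective modules *)

Section FreeModule.
Variables (R : pzRingType) (X : eqType).

Record free := Free {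
  coef :> X -> R;
  coef_fin : exists s : seq X, forall x, x \notin s -> coef x = 0 }.

HB.instance Definition _ := gen_eqMixin free.
HB.instance Definition _ := gen_choiceMixin free.

Lemma freeP (f g : free) : (forall x, f x = g x) -> f = g.
Proof.
case: f g => [f fl] [g gl] /= fg; have E : f = g by apply/funext.
by case: g / E gl {fg} => gl; congr Free; apply: Prop_irrelevance.
Qed.

Program Definition free0 : free := @Free (fun x => 0) _.
Next Obligation. by exists [::]. Qed.
Program Definition freeN (f : free) : free := @Free (fun x => - f x) _.
Next Obligation. by move=> f; have [s fs] := coef_fin f; exists s => x /fs ->; rewrite oppr0. Qed.
Program Definition freeD (f g : free) : free := @Free (fun x => f x + g x) _.
Next Obligation.
move=> f g; have [s fs] := coef_fin f; have [t gt] := coef_fin g; exists (s ++ t) => x.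
by rewrite mem_cat negb_or => /andP[/fs -> /gt ->]; rewrite addr0.
Qed.
Program Definition freeZ (a : R) (f : free) : free := @Free (fun x => a * f x) _.
Next Obligation. by move=> a f; have [s fs] := coef_fin f; exists s => x /fs ->; rewrite mulr0. Qed.

Lemma freeDA : associative freeD.
Proof. by move=> f g h; apply: freeP => x; apply: addrA. Qed.
Lemma freeDC : commutative freeD.
Proof. by move=> f g; apply: freeP => x; apply: addrC. Qed.
Lemma free0D : left_id free0 freeD.
Proof. by move=> f; apply: freeP => x; apply: add0r. Qed.
Lemma freeND : left_inverse free0 freeN freeD.
Proof. by move=> f; apply: freeP => x; apply: addNr. Qed.
HB.instance Definition _ := GRing.isZmodule.Build free freeDA freeDC free0D freeND.

Lemma freeZA b c f : freeZ b (freeZ c f) = freeZ (b * c) f.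
Proof. by apply: freeP => x /=; rewrite mulrA. Qed.
Lemma free1Z : left_id 1 freeZ.
Proof. by move=> f; apply: freeP => x /=; rewrite mul1r. Qed.
Lemma freeZDr : right_distributive freeZ +%R.
Proof. by move=> b f g; apply: freeP => x; apply: mulrDr. Qed.
Lemma freeZDl f : {morph freeZ^~ f : b c / b + c}.
Proof. by move=> b c; apply: freeP => x; apply: mulrDl. Qed.
HB.instance Definition _ := GRing.Zmodule_isLmodule.Build R free freeZA free1Z freeZDr freeZDl.

Definition fsupp (f : free) : seq X := undup (sval (cid (coef_fin f))).

Lemma fsuppP f x : x \notin fsupp f -> f x = 0.
Proof. by rewrite mem_undup; case: cid => s /= fs; apply: fs. Qed.

Program Definition delta (x : X) : free := @Free (fun y => (y == x)%:R) _.
Next Obligation. by move=> x; exists [:: x] => y; rewrite inE => /negPf ->. Qed.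

Variables (M : lmodType R) (b : X -> M) (S : pred X).

(** With [S] constantly true this is the canonical map from the free module to [M]; a smaller [S]
    kills the generators outside it. *)
Definition fsum (f : free) : M := \sum_(x <- fsupp f | S x) f x *: b x.

Lemma fsumE (f : free) (s : seq X) : uniq s -> (forall x, x \notin s -> f x = 0) ->
  fsum f = \sum_(x <- s | S x) f x *: b x.
Proof.
have H t u : uniq t -> uniq u -> {subset t <= u} ->
    (forall x, x \notin t -> f x = 0) ->
    \sum_(x <- t | S x) f x *: b x = \sum_(x <- u | S x) f x *: b x.
  move=> tU uU tu ft; rewrite [RHS](bigID (mem t)) /= [X in _ + X]big1 ?addr0; last first.
    by move=> x /andP[_ /ft ->]; rewrite scale0r.
  under [RHS]eq_bigl do rewrite andbC.
  rewrite -big_filter_cond; apply: perm_big; apply: uniq_perm => //.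
    exact: filter_uniq.
  by move=> x; rewrite mem_filter; case xt: (x \in t) => //=; rewrite tu.
move=> sU fs; rewrite /fsum (H _ (undup (fsupp f ++ s))) ?undup_uniq //; first last.
- by move=> x; apply: fsuppP.
- by move=> x; rewrite mem_undup mem_cat => ->.
by symmetry; apply: H; rewrite ?undup_uniq // => x; rewrite mem_undup mem_cat orbC => ->.
Qed.

Lemma fsum_linear : linear fsum.
Proof.
move=> a f g; pose s := undup (fsupp f ++ fsupp g).
have fs x : x \notin s -> f x = 0.
  by rewrite mem_undup mem_cat negb_or => /andP[/fsuppP].
have gs x : x \notin s -> g x = 0.
  by rewrite mem_undup mem_cat negb_or => /andP[_ /fsuppP].
have sU : uniq s by apply: undup_uniq.
rewrite (fsumE sU fs) (fsumE sU gs) (fsumE (s := s)) //; last first.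
  by move=> x xs; rewrite /= fs // gs // mulr0 addr0.
rewrite scaler_sumr -big_split /=; apply: eq_bigr => x _.
by rewrite scalerA -scalerDl.
Qed.

Lemma fsum_delta x : S x -> fsum (delta x) = b x.
Proof.
move=> Sx; rewrite (fsumE (s := [:: x])) //.
  by rewrite big_cons Sx big_nil addr0 /= eqxx scale1r.
by move=> y; rewrite inE /= => /negPf ->.
Qed.
End FreeModule.

Lemma submodule_sum (R : pzRingType) (M : lmodType R) (S : M -> Prop) (I : eqType)
    (s : seq I) (Q : pred I) (F : I -> M) :
  submodule S -> (forall i, Q i -> S (F i)) -> S (\sum_(i <- s | Q i) F i).
Proof.
move=> [S0 SD] SF; elim/big_ind: _ => // x y Sx Sy.
by rewrite -[x]scale1r; apply: SD.
Qed.

Lemma submoduleZ (R : pzRingType) (M : lmodType R) (S : M -> Prop) a x :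
  submodule S -> S x -> S (a *: x).
Proof. by move=> [S0 SD] Sx; rewrite -[_ *: _]addr0; apply: SD. Qed.

(** Split the canonical map from the free module on the elements of [P]; [supp y] lists the
    generators occurring in the image of [y]. If [S] is closed under [supp], dropping the generators
    outside [S] changes no element of [S], so truncation is a retraction. *)
Lemma projective_support (R : pzRingType) (P : lmodType R) : projective P ->
  exists supp : P -> seq P, forall S : P -> Prop, submodule S ->
    (forall y, S y -> forall x, x \in supp y -> S x) ->
    exists r : {linear P -> P}, (forall y, S (r y)) /\ forall y, S y -> r y = y.
Proof.
move=> Pp; pose F : lmodType R := free R P.
pose pi : {linear F -> P} := mklin (fsum_linear (id : P -> P) xpredT).
have [x|h hE] := projective_lift (T := pi) (v := idfun) Pp.
  by exists (delta R x); apply: fsum_delta.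
exists (fun y => fsupp (h y)) => S Ss Ssupp.
pose r := mklin (fsum_linear (R := R) (id : P -> P) (fun x => `[< S x >])) \o h.
exists r; split=> y; first by apply: submodule_sum => // x /asboolP; apply: submoduleZ.
move=> Sy; rewrite -[RHS]hE /r /= /linear_fun /fsum; rewrite big_seq_cond [RHS]big_seq_cond.
apply: eq_bigl => x; case xs: (x \in _) => //=.
by apply/asboolP; apply: Ssupp Sy _ xs.
Qed.

(** * Functoriality of the tensor product *)

Section TensorFunctoriality.
Variables (A B : pzRingType) (L : bicomplex A B).

Section Graded.
Variables (P P' : complex B) (f : forall i, {linear P i -> P' i}).

(** Functoriality is set up for graded maps, as the retractions and splittings to be tensored need
    not commute with the differentials. *)
Definition gtens_pure n p (x : L p) (y : P (n - p)) : tens_obj L P' n :=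
  tens x (f (n - p) y).

Lemma gtens_balanced n : balanced (@gtens_pure n).
Proof.
split=> *; rewrite /gtens_pure /tens.
- exact: tpureDl.
- by rewrite linearD; apply: tpureDr.
- by rewrite linearZ; apply: tpure_ract.
- exact: tpureZ.
Qed.

Definition gtens n : {linear tens_obj L P n -> tens_obj L P' n} := tlift (gtens_balanced n).

Lemma gtensE n p (x : L p) (y : P (n - p)) : gtens n (tens x y) = tens x (f _ y).
Proof. exact: tlift_pure. Qed.
End Graded.

Lemma tens_ext (P : complex B) n (V : lmodType A) (f g : {linear tens_obj L P n -> V}) :
  (forall p (x : L p) (y : P (n - p)), f (tens x y) = g (tens x y)) -> f =1 g.
Proof. exact: tensor_ext. Qed.

Lemma gtens_tr (P P' : complex B) (f : forall i, {linear P i -> P' i}) i j (e : i = j) x :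
  f j (tr e x) = tr e (f i x).
Proof. by case: j / e. Qed.

Program Definition tmap (P P' : complex B) (f : chain_map P P') :
    chain_map (Tensor_complex L P) (Tensor_complex L P') :=
  @ChainMap A (Tensor_complex L P) (Tensor_complex L P') (fun n => gtens f n) _.
Next Obligation.
move=> P P' f n u; move: u.
apply: (tens_ext (f := gtens f (n + 1) \o tens_d L P n) (g := tens_d L P' n \o gtens f n)).
move=> p x y /=; rewrite gtensE !tens_dE /tens_d_pure linearD sg_lin !gtensE.
by rewrite !gtens_tr cmap_d.
Qed.

Lemma gtens_comp (P P' P'' : complex B) (f : forall i, {linear P i -> P' i})
   (g : forall i, {linear P' i -> P'' i}) (h : forall i, {linear P i -> P'' i}) :
  (forall i x, h i x = g i (f i x)) -> forall n u, gtens h n u = gtens g n (gtens f n u).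
Proof.
move=> E n; apply: (tens_ext (f := gtens h n) (g := gtens g n \o gtens f n)) => p x y /=.
by rewrite !gtensE E.
Qed.

Lemma gtens_id (P : complex B) n u : gtens (fun i => idfun : {linear P i -> P i}) n u = u.
Proof.
move: u; apply: (tens_ext (f := gtens _ n) (g := idfun)) => p x y /=.
by rewrite gtensE.
Qed.

End TensorFunctoriality.

Notation el C i x := (existT (fun j : int => C j : Type) i x) (only parsing).

Section Subcomplex.
Variables (R : pzRingType) (P : complex R) (S : forall i, P i -> Prop).
Hypotheses (HS : forall i, submodule (@S i)).
Hypothesis Sd : forall i x, S x -> S (cd P i x).

Lemma subcomplex : exists (P' : complex R) (i : chain_map P' P),
  (forall n, injective (i n)) /\ forall n y, S y <-> exists y', i n y' = y.
Proof.
have fact n : exists d : {linear subm (HS n) -> subm (HS (n + 1))},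
    forall x, sub_incl (HS (n + 1)) (d x) = cd P n (sub_incl (HS n) x).
  apply: (lin_factor (f := cd P n \o sub_incl (HS n))) => [|x]; first exact: sub_incl_inj.
  by apply/sub_inclE; apply: Sd; apply: sub_inclP.
have [d dE] := dchoice fact.
have dd n x : d (n + 1) (d n x) = 0.
  by apply: sub_incl_inj; rewrite !dE cdd linear0.
pose P' := @Complex R (fun n => subm (HS n)) d dd.
exists P', (@ChainMap R P' P (fun n => sub_incl (HS n)) dE); split=> n.
  exact: sub_incl_inj.
move=> y; exact: sub_inclE.
Qed.
End Subcomplex.

Section TensorInduction.
Variables (A B : pzRingType) (L : bicomplex A B) (P : complex B).

Lemma tens_ind n (T : tens_obj L P n -> Prop) :
  T 0 -> (forall u v, T u -> T v -> T (u + v)) -> (forall u, T u -> T (- u)) ->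
  (forall p (x : L p) (y : P (n - p)), T (tens x y)) -> forall u, T u.
Proof.
move=> T0 TD TN Tt u; rewrite -[u]treprK.
elim: (trepr u) => [|[b [p [x y]]] w IHw]; first exact: T0.
rewrite tclass_cons; apply: TD => //; case: b; last exact: Tt.
exact/TN/Tt.
Qed.

(* [u] is a combination of tensors whose second factors occur in [s] *)
Definition tens_span n (u : tens_obj L P n) (s : seq {i & P i}) : Prop :=
  forall T : tens_obj L P n -> Prop, submodule T ->
  (forall p (x : L p) y, List.In (el P (n - p) y) s -> T (tens x y)) -> T u.

Lemma tens_spanP n (u : tens_obj L P n) : exists s, tens_span u s.
Proof.
elim/tens_ind: u => [|u v [s us] [t vt]|u [s us]|p x y].
- by exists [::] => T [].
- exists (s ++ t) => T HT Tst; rewrite -[u]scale1r; apply: HT.2.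
    by apply: us => // p x y ys; apply: Tst; apply: List.in_or_app; left.
  by apply: vt => // p x y ys; apply: Tst; apply: List.in_or_app; right.
- by exists s => T HT Ts; rewrite -scaleN1r; apply: submoduleZ => //; apply: us.
- by exists [:: el P (n - p) y] => T HT Ts; apply: Ts; left.
Qed.
End TensorInduction.

(** * Closed subsets of a projective complex and of its tensor product *)

Section Generators.
Variables (R : pzRingType) (Q : complex R).
Hypotheses (Qb : bounded_above Q) (Qg : forall i, finitely_generated (Q i)).

(** One finite list serves all degrees from [N] on, because [Q] is bounded above with finitely
    generated terms. A cochain is thus tested in these degrees by finitely many values. *)
Definition generates_from (N : int) (G : seq {i & Q i}) : Prop :=
  forall i, N <= i -> forall T : Q i -> Prop, submodule T ->
  (forall x, List.In (el Q i x) G -> T x) -> forall x, T x.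

Lemma generatorsP N : exists G, generates_from N G.
Proof.
have [b Qz] := Qb.
have H k : exists G : seq {i & Q i}, forall i, N <= i -> i < N + k%:Z ->
    forall T : Q i -> Prop, submodule T ->
    (forall x, List.In (el Q i x) G -> T x) -> forall x, T x.
  elim: k => [|k [G GP]]; first by exists [::] => i; lia.
  have [r [g gP]] := Qg (N + k%:Z).
  exists ([seq el Q (N + k%:Z) (g j) | j <- enum 'I_r] ++ G) => i Ni iN T HT TG.
  have [ik|ik] := eqVneq i (N + k%:Z); last first.
    by apply: GP => //; [lia | move=> x xG; apply: TG; apply: List.in_or_app; right].
  subst i => x; have [c ->] := gP x; apply: submodule_sum => // j _.
  apply: submoduleZ => //; apply: TG; apply: List.in_or_app; left.
  have : j \in enum 'I_r by rewrite mem_enum.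
  elim: (enum _) => //= j' s IHs; rewrite inE => /orP[/eqP<-|/IHs]; by [left | right].
have [G GP] := H `|b - N|.+1; exists G => i Ni T HT TG x.
have [bi|ib] := ltP b i; last by apply: (GP i) => //; lia.
by rewrite (Qz i bi x); case: HT.
Qed.
End Generators.

Section Core.
Variables (A B : pzRingType) (L : bicomplex A B) (Q : complex A).
Variable (p : chain_map Q (lcomplex L)).
Hypotheses (Qb : bounded_above Q) (Qg : forall i, finitely_generated (Q i)).
Hypotheses (Qp : forall i, projective (Q i)) (pq : qiso p).
Variables (P : complex B) (a : int).
Hypotheses (Pp : forall i, projective (P i)) (uq : qiso (unit_map p P)).
Local Notation M := (Tensor_complex L P).
Hypothesis (Ma : forall n, n < a -> cohomology_zero M n).

Definition core_sort : Type := ({i & P i} + {i & M i})%type.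
Definition inP i (y : P i) : core_sort := inl (el P i y).
Definition inM i (m : M i) : core_sort := inr (el M i m).

Lemma inP_inj i : injective (@inP i).
Proof.
move=> x y /(congr1 (fun w => if w is inl v then v else el P i x)).
exact: existT_inj.
Qed.
Lemma inM_inj i : injective (@inM i).
Proof.
move=> x y /(congr1 (fun w => if w is inr v then v else el M i x)).
exact: existT_inj.
Qed.

Variable supp : forall i, P i -> seq (P i).
Hypothesis suppP : forall i (S : P i -> Prop), submodule S ->
  (forall y, S y -> forall x, x \in supp y -> S x) ->
  exists r : {linear P i -> P i}, (forall y, S (r y)) /\ forall y, S y -> r y = y.

Variable gens : int -> seq {i & Q i}.
Hypothesis gensP : forall N, generates_from N (gens N).

Let val_at n (f : cochain (triv Q) M n) (e : {i & Q i}) : core_sort :=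
  inM (f (projT1 e) (projT2 e)).

Definition ev n (f : cochain (triv Q) M n) (N : int) : seq core_sort :=
  [seq val_at f e | e <- gens N].

(* [cc_unit] makes the unit map surjective in cohomology on the closed part.
   Cochains Q -> M are compared through their values at generators of Q in
   degrees >= a - (n + 1), where only finitely many generators are needed: in
   lower degrees the values can be replaced by 0, since M is acyclic below a. *)
Record core_closed (S : pred core_sort) : Prop := {
  cc_P : forall i, submodule (fun y : P i => S (inP y));
  cc_supp : forall (w : {i & P i}), S (inP (projT2 w)) ->
    all S (map (@inP _) (supp (projT2 w)));
  cc_d : forall w : {i & P i}, S (inP (projT2 w)) -> S (inP (cd P _ (projT2 w)));
  cc_exP : forall w : {i & P (i + 1)}, S (inP (projT2 w)) ->
    (exists y, projT2 w = cd P (projT1 w) y) ->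
    exists2 y, projT2 w = cd P (projT1 w) y & S (inP y);
  cc_M : forall i, submodule (fun m : M i => S (inM m));
  cc_tens : forall n (x : {i & L i}) (y : P (n - projT1 x)),
    S (inP y) -> S (inM (tens (projT2 x) y : M n));
  cc_span : forall w : {i & M i}, S (inM (projT2 w)) ->
    exists2 s, tens_span (projT2 w) s & all S [seq inl v | v <- s];
  cc_exM : forall w : {i & M (i + 1)}, S (inM (projT2 w)) ->
    (exists m, projT2 w = cd M (projT1 w) m) ->
    exists2 m, projT2 w = cd M (projT1 w) m & S (inM m);
  cc_unit : forall n (f : cochain (triv Q) M (n + 1)),
    cd (zc (Hom_complex (triv Q) M)) (n + 1) f = 0 ->
    all S (ev f (a - (n + 1))) ->
    exists (y : P (n + 1)) (h : cochain (triv Q) M n),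
    [/\ cd P (n + 1) y = 0, S (inP y), all S (ev h (a - (n + 1))) &
        ev f (a - (n + 1)) = ev (unit_map p P (n + 1) y + hom_d h) (a - (n + 1))] }.

(** What the two classes have in common. Vanishing of cohomology descends to the small complexes
    through [cr_cohP] and [cr_cohM], while [cr_J] supplies a new injective complex. *)
Record core_result (S : pred core_sort) (P' : complex B) (i : chain_map P' P) : Prop := {
  cr_inj : forall n, injective (i n);
  cr_P : forall n (y : P n), S (inP y) <-> exists y', i n y' = y;
  cr_M : forall n (m : M n), S (inM m) <-> exists m', tmap L i n m' = m;
  cr_tinj : forall n, injective (tmap L i n);
  cr_proj : forall n, projective (P' n);
  cr_cohP : forall n (y : P' n), coboundary (i n y) -> coboundary y;
  cr_cohM : forall n (m : Tensor_complex L P' n), coboundary (tmap L i n m) -> coboundary m;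
  cr_J : exists (J : complex A) (g : chain_map (Tensor_complex L P') J),
    [/\ forall n, injective_module (J n), forall n, n < a -> zero_module (J n),
        qiso g & qiso (right_adjoint g)] }.

Lemma unit_map_tmap (P' : complex B) (i : chain_map P' P) n y :
  unit_map p P n (i n y) = post (triv Q) (tmap L i) n (unit_map p P' n y).
Proof.
apply: cochainP => j x; symmetry; apply: etrans (sg_lin (tmap L i (j + n)) _ _) _.
by congr sg; apply: etrans (gtensE _ _ _) _; rewrite gtens_tr.
Qed.

(** By [qiso_unit] the last clause becomes a statement on the unit map of [P']. It is injective on
    cohomology since the cohomology of [P'] embeds into that of [P]; surjectivity comes from
    [cc_unit]. *)
Lemma core_closed_result S : core_closed S -> exists (P' : complex B) (i : chain_map P' P),
  core_result S i.
Proof.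
move=> cl; have HP i : submodule (fun y : P i => S (inP y)) := cc_P cl i.
have [||P' [i [iI iP]]] := @subcomplex B P (fun n y => S (inP y)).
- exact: HP.
- by move=> n x Sx; apply: (cc_d cl (w := el P n x)).
(* These retractions are only graded, but this already makes L (x) P' a direct summand of L (x) P in
   each degree, and [P'] projective. *)
have retr n : exists r : {linear P n -> P' n}, forall y, r (i n y) = y.
  have [|r [rS rK]] := suppP (HP n).
    move=> y Sy x; have /all_In H := cc_supp cl (w := el P n y) Sy.
    move=> xs; apply: H.
    elim: (supp y) xs => //= z s IHs; rewrite inE => /orP[/eqP->|/IHs]; by [left | right].
  have [|r' r'E] := lin_factor (f := r) (iI n).
    by move=> y; apply/iP.
  by exists r' => y; apply: iI; rewrite r'E rK //; apply/iP; exists y.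
have {retr}/dchoice[r rK] := retr.
have tK n (m : Tensor_complex L P' n) : gtens L r n (tmap L i n m) = m.
  rewrite -[RHS]gtens_id; symmetry; apply: gtens_comp => j x /=.
  by rewrite rK.
exists P', i.
have iM n (m : M n) : S (inM m) <-> exists m', tmap L i n m' = m.
  split=> [Sm|[m' <-]].
    have [s ms Ss] := cc_span cl (w := el M n m) Sm.
    apply: (ms (fun m => exists m', tmap L i n m' = m)).
      split; first by exists 0; rewrite linear0.
      by move=> k _ _ [u <-] [v <-]; exists (k *: u + v); rewrite linearP.
    move=> q x y ys.
    have /iP[y' <-] : S (inP y).
      by move/all_In: Ss; apply; apply: (List.in_map inl) ys.
    by exists (tens x y'); apply: gtensE.
  have HM := cc_M cl n; elim/tens_ind: m' => [|u v Su Sv|u Su|q x y].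
  - by rewrite linear0; case: HM.
  - by rewrite linearD -[tmap L i n u]scale1r; apply: HM.2.
  - by rewrite linearN -scaleN1r; apply: (submoduleZ (S := fun m : M n => S (inM m))).
  rewrite [tmap _ _ _ _]gtensE; apply: (cc_tens cl (x := el L q x)).
  by apply/iP; eexists.
have cP n (y : P' n) : coboundary (i n y) -> coboundary y.
  move: n y; apply: int_succ => n y /coboundary1 ex.
  have [|z zE Sz] := cc_exP cl (w := existT (fun j => P (j + 1) : Type) n (i _ y)) _ ex.
    by apply/iP; exists y.
  move/iP: Sz => [z' z'E]; apply/coboundary1; exists z'; apply: iI.
  by rewrite cmap_d z'E.
have tI n : injective (tmap L i n) by apply: can_inj (@tK n).
have cM n (m : Tensor_complex L P' n) : coboundary (tmap L i n m) -> coboundary m.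
  move: n m; apply: int_succ => n y /coboundary1 ex.
  have [|z zE Sz] := cc_exM cl (w := existT (fun j => M (j + 1) : Type) n (tmap L i _ y)) _ ex.
    by apply/iM; exists y.
  move/iM: Sz => [z' z'E]; apply/coboundary1; exists z'; apply: tI.
  by rewrite cmap_d z'E.
have projP' n : projective (P' n).
  move=> X Y g f gs; have [h hE] := @Pp n X Y g (f \o r n) gs.
  by exists (h \o i n) => x /=; rewrite hE /= rK.
have M'a n : n < a -> cohomology_zero (Tensor_complex L P') n.
  move=> na m m0; apply: cM; apply: Ma => //.
  by rewrite -cmap_d m0 linear0.
have [J' [g [J'i J'z gq]]] := injective_resolution_exists M'a.
split=> //; exists J', g; split=> //.
apply/(qiso_unit Qb Qp pq) => //; first by exists a.
apply: int_succ => n; split.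
  move=> y y0 uy; apply: cP; apply/coboundary_zc; apply: (uq (n + 1)).1.
    by rewrite -[LHS]/(cd P _ (i _ y)) -cmap_d [cd P' _ y]y0 linear0.
  rewrite unit_map_tmap; apply/coboundary_zc; apply: coboundary_map; exact/coboundary_zc.
move=> f f0; pose N := a - (n + 1).
pose fM : cochain (triv Q) M (n + 1) := post (triv Q) (tmap L i) (n + 1) f.
have fM0 : cd (zc (Hom_complex (triv Q) M)) (n + 1) fM = 0.
  rewrite -[LHS]/(cd (Hom_complex (triv Q) M) _ _) -cmap_d.
  by rewrite [cd _ _ f]f0 linear0.
have SfM : all S (ev fM N).
  rewrite all_map; apply/all_In => -[j x] _ /=; apply/iM; by eexists.
have [y [h [y0 Sy Sh E]]] := cc_unit cl fM0 SfM.
move/iP: Sy y0 E => [y' <-] y'0 E.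
have {}y'0 : cd P' (n + 1) y' = 0 by apply: iI; rewrite cmap_d y'0 linear0.
have hS j (x : Q j) : N <= j -> S (inM (h j x)).
  move=> Nj; apply: (gensP Nj (T := fun x => S (inM (h j x)))).
    split; first by rewrite [h j 0]linear0; case: (cc_M cl (j + n)).
    move=> k u v Su Sv; have -> : h j (k *: u + v) = k *: h j u + h j v by apply: linearP.
    exact: (cc_M cl (j + n)).2.
  move=> e eG; move/all_In: Sh; apply.
  exact: (List.in_map (val_at h) _ (el Q j e)).
have fE j (x : Q j) : N <= j -> fM j x = unit_map p P (n + 1) (i _ y') j x + hom_d h j x.
  move=> Nj; pose D : cochain (triv Q) M (n + 1) :=
    fM - (unit_map p P (n + 1) (i _ y') + hom_d h).
  apply: eqB; rewrite -[LHS]/(D j x).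
  apply: (gensP Nj (T := fun x => D j x = 0)).
    split; first exact: linear0.
    move=> k u v Du Dv; have -> : D j (k *: u + v) = k *: D j u + D j v by apply: linearP.
    by rewrite Du Dv scaler0 addr0.
  move=> e eG; apply/eqP; rewrite subr_eq0; apply/eqP.
  move: E eG; rewrite /ev -/N; elim: (gens N) => //= v G IHG [Ev /IHG H] [vE|/H //].
  by move: Ev; rewrite vE /=; apply: existT_inj.
(* On the closed part, which contains the values of [h] in degrees from [N] on, [gtens L r] inverts
   the inclusion. It need not be a chain map, so the differential of [h'] is compared inside [M]. *)
pose h' : cochain (triv Q) J' n :=
  mkcoch (L := triv Q) (fun j => g (j + n) \o gtens L r (j + n) \o (h j : {linear _ -> _})).
pose ff : cochain (triv Q) (Tensor_complex L P') (n + 1) := f - unit_map p P' (n + 1) y'.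
have ffE : post (triv Q) g (n + 1) ff = hom_d h'.
  (* For [j < N] the target degree is below [a], where [J'] vanishes; this is the origin of the
     bound [a - (n + 1)] in [cc_unit]. *)
  apply: cochainP => j x; have [Nj|jN] := leP N j; last first.
    have Jz : zero_module (J' (j + (n + 1))) by apply: J'z; rewrite /N in jN; lia.
    by rewrite [LHS]Jz [RHS]Jz.
  have e1 : j + n + 1 = j + (n + 1) by lia.
  have e2 : j + 1 + n = j + (n + 1) by lia.
  rewrite (hom_dE _ _ e1 e2).
  change (g _ (ff j x) = cde J' e1 (g (j + n) (gtens L r (j + n) (h j x)))
    - sg n (tr e2 (g (j + 1 + n) (gtens L r (j + 1 + n) (h (j + 1) (cd Q j x)))))).
  rewrite -cmap_cde -cmap_tr -sg_lin -linearB; congr (g _ _).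
  apply: tI; rewrite [RHS]linearB [X in _ = _ - X]sg_lin [X in _ = X - _]cmap_cde [X in _ = _ - sg _ X]cmap_tr.
  have rS k (u : M k) : S (inM u) -> tmap L i k (gtens L r k u) = u.
    by move=> /iM[u' <-]; rewrite tK.
  rewrite !rS; first last.
  - exact: hS.
  - by apply: hS; lia.
  rewrite -(hom_dE _ _ e1 e2); have H := fE j x Nj; rewrite unit_map_tmap in H.
  apply: etrans (linearB (tmap L i (j + (n + 1))) (f j x) (unit_map p P' (n + 1) y' j x)) _.
  exact: eq_subrD H.
exists y' => //; apply/coboundary_zc.
have q1 : qiso (post (triv Q) g) by apply: qiso_post.
apply: (q1 (n + 1)).1; last by apply/coboundary1; exists h'; exact: ffE.
have uy0 : cd (zc (Hom_complex (triv Q) (Tensor_complex L P'))) (n + 1)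
    (unit_map p P' (n + 1) y') = 0.
  by rewrite -cmap_d [cd (zc P') _ _]y'0 linear0.
by apply: etrans (linearB (cd (Hom_complex (triv Q) _) (n + 1)) f _) _; rewrite [X in X - _]f0 [X in _ - X]uy0 subrr.
Qed.
Variable U : Type.
Variables (eA : A -> code U) (eB : B -> code U) (eL : {i & L i} -> code U).
Hypotheses (eA_inj : injective eA) (eB_inj : injective eB) (eL_inj : injective eL).

Lemma finitary_submodule W (R : pzRingType) (N : lmodType R) (e : R -> code U) (f : N -> W) :
  injective e -> injective f -> finitary U (fun S => submodule (fun x => S (f x))).
Proof.
move=> e_inj f_inj; apply: finitary_and; first exact: finitary_const.
have := @finitary_horn U W (R * N * N)%type (fun=> unit) (fun x => e x.1.1)
  (fun x => [:: f x.1.2; f x.2]) (fun _ _ => True)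
  (fun x _ => [:: f (x.1.1 *: x.1.2 + x.2)]).
case=> [[[r x] y] [[r' x'] y'] /= /e_inj -> [/f_inj -> /f_inj ->] //|Phi h].
exists Phi => S /h H r x y Sx Sy; have [||_ _] := H (r, x, y); rewrite /= ?Sx ?Sy ?andbT //; exists tt.
Qed.

Lemma finitary_core_closed : finitary U core_closed.
Proof.
(* The clauses of [core_closed] in the shape of [finitary_horn]; those that involve no choice
   receive a dummy existential over [unit]. *)
pose C (S : pred core_sort) := ((forall i, submodule (fun y : P i => S (inP y))) /\
  (forall (w : {i & P i}), all S [:: inP (projT2 w)] -> (exists y : unit, True) ->
    exists2 y : unit, True & all S (map (@inP _) (supp (projT2 w))))) /\
  ((forall w : {i & P i}, all S [:: inP (projT2 w)] -> (exists y : unit, True) ->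
    exists2 y : unit, True & all S [:: inP (cd P _ (projT2 w))]) /\
  (forall w : {i & P (i + 1)}, all S [:: inP (projT2 w)] ->
    (exists y, projT2 w = cd P (projT1 w) y) ->
    exists2 y, projT2 w = cd P (projT1 w) y & all S [:: inP y])) /\
  ((forall i, submodule (fun m : M i => S (inM m))) /\
  (forall n (w : {x : {i & L i} & P (n - projT1 x)}), all S [:: inP (projT2 w)] ->
    (exists y : unit, True) ->
    exists2 y : unit, True & all S [:: inM (tens (projT2 (projT1 w)) (projT2 w) : M n)])) /\
  ((forall w : {i & M i}, all S [:: inM (projT2 w)] -> (exists s, tens_span (projT2 w) s) ->
    exists2 s, tens_span (projT2 w) s & all S [seq inl v | v <- s]) /\
  (forall w : {i & M (i + 1)}, all S [:: inM (projT2 w)] ->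
    (exists m, projT2 w = cd M (projT1 w) m) ->
    exists2 m, projT2 w = cd M (projT1 w) m & all S [:: inM m])) /\
  (* Cochains are not coded by [U]. The input is the finite list [s] of values alone, and any [y]
     and [h] that realise this list will do. *)
  (forall n (s : seq core_sort), all S s ->
    (exists yh : P (n + 1) * cochain (triv Q) M n,
      cd P (n + 1) yh.1 = 0 /\
      s = ev (unit_map p P (n + 1) yh.1 + hom_d yh.2) (a - (n + 1))) ->
    exists2 yh : P (n + 1) * cochain (triv Q) M n,
      cd P (n + 1) yh.1 = 0 /\
      s = ev (unit_map p P (n + 1) yh.1 + hom_d yh.2) (a - (n + 1)) &
    all S (inP yh.1 :: ev yh.2 (a - (n + 1)))).
apply: (@finitary_imp U core_sort C).
  move=> S [[C1 C2] [[C3 C4] [[C5 C6] [[C7 C8] C9]]]]; split=> //.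
  - by move=> w Sw; have [||_ _ //] := C2 w; rewrite /= ?Sw //; exists tt.
  - by move=> w Sw; have [||_ _ /andP[]//] := C3 w; rewrite /= ?Sw //; exists tt.
  - by move=> w Sw ex; have [||y yE /andP[Sy _]] := C4 w; rewrite /= ?Sw //; exists y.
  - move=> n x y Sy; have [||_ _ /andP[]//] := C6 n (existT _ x y); rewrite /= ?Sy //; exists tt.
  - move=> w Sw; have [||s ws Ss] := C7 w; rewrite /= ?Sw //; [exact: tens_spanP | by exists s].
  - by move=> w Sw ex; have [||y yE /andP[Sy _]] := C8 w; rewrite /= ?Sw //; exists y.
  move=> n f f0 Sf.
  have [y0 y00 /coboundary1[h0 h0E]] := (uq (n + 1)).2 f f0.
  have [|[y h] /= [y0' E] /andP[Sy Sh]] := C9 n _ Sf.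
    exists (y0, h0); split; first exact: y00.
    by congr ev; apply: subr_eqD h0E.
  by exists y, h.
do !apply: finitary_and.
- apply: (finitary_forall (e := fun i : int => CNat (pickle i))); first exact: code_int_inj.
  by move=> i; apply: finitary_submodule eB_inj (@inP_inj i).
- by apply: finitary_horn (fun=> CNat 0) _ _ _ _ => -[i x] [j y] _ [].
- by apply: finitary_horn (fun=> CNat 0) _ _ _ _ => -[i x] [j y] _ [].
- apply: finitary_horn (fun w => CNat (pickle (projT1 w))) _ _ _ _ => -[i x] [j y] /=.
  by move=> /code_int_inj E; subst j => /(congr1 (head (inP x)))/inP_inj ->.
- apply: (finitary_forall (e := fun i : int => CNat (pickle i))); first exact: code_int_inj.
  by move=> i; apply: finitary_submodule eA_inj (@inM_inj i).
- apply: (finitary_forall (e := fun i : int => CNat (pickle i))); first exact: code_int_inj.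
  move=> n; apply: finitary_horn (fun w => eL (projT1 w)) _ _ _ _ => -[i x] [j y] /=.
  by move=> /eL_inj E; subst j => /(congr1 (head (inP x)))/inP_inj ->.
- by apply: finitary_horn (fun=> CNat 0) _ _ _ _ => -[i x] [j y] _ [].
- apply: finitary_horn (fun w => CNat (pickle (projT1 w))) _ _ _ _ => -[i x] [j y] /=.
  by move=> /code_int_inj E; subst j => /(congr1 (head (inM x)))/inM_inj ->.
apply: (finitary_forall (e := fun i : int => CNat (pickle i))); first exact: code_int_inj.
move=> n; by apply: finitary_horn (fun=> CNat 0) _ _ _ _.
Qed.

End Core.

(** * Small submodules in the two classes *)

Definition good_sub (R : pzRingType) (G : lmodType R -> Prop) (M : lmodType R)
    (s : M -> Prop) : Prop :=
  exists (N : lmodType R) (f : {linear N -> M}),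
    [/\ injective f, forall x, s x <-> exists n, f n = x & G N].

(** The ambient type [W] also holds the elements of the resolutions that certify [M]; only the trace
    of the closed subset on [M] has to be a module of the class. *)
Definition certified (U : Type) (R : pzRingType) (G : lmodType R -> Prop) : Prop :=
  forall M, G M -> exists (W : Type) (f : M -> W),
    injective f /\ finitary U (fun S => good_sub G (fun x => S (f x))).

Section RoundTrip.
Variables (A B : pzRingType) (L : bicomplex A B) (P : complex B) (J : complex A).

(** Together with [right_left_adjoint] this converts the datum [q] of [Eclass] into a datum [g] of
    the kind used in [Fclass] and back, so that one core serves both classes. *)
Lemma left_right_adjoint (g : chain_map (Tensor_complex L P) J) n u :
  left_adjoint (right_adjoint g) n u = g n u.
Proof.
move: u; apply: tens_ext => p x y; rewrite [LHS]adjE /adj_pure /=.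
rewrite tr_sg sgK -(cmap_tr g); congr (g n _).
have e : p + (n - p) - p = n - p by lia.
by rewrite (tens_tr _ e) tr_tr tr_id.
Qed.

Lemma right_left_adjoint (q : chain_map P (Hom_complex L J)) n y :
  right_adjoint (left_adjoint q) n y = q n y.
Proof.
apply: cochainP => p x /=; rewrite adjE /adj_pure.
rewrite (cmap_tr q) coch_tr -sg_add tr_tr tr_id.
rewrite (sg_odd (n := 0)) //.
by rewrite !(odd_abszD, odd_abszM, odd_abszN) /=; do 2!case: (odd _).
Qed.

End RoundTrip.

Section Certificates.
Variables (A B : pzRingType) (L : bicomplex A B) (l1 : int).
Hypothesis Lperf : perfect_above (lcomplex L).
Variable U : Type.
Variables (eA : A -> code U) (eB : B -> code U) (eL : {i & L i} -> code U).
Hypotheses (eA_inj : injective eA) (eB_inj : injective eB) (eL_inj : injective eL).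

Section Core.
Variables (P : complex B) (J : complex A) (g : chain_map (Tensor_complex L P) J) (a : int).
Hypotheses (Pp : forall i, projective (P i)).
Hypotheses (Jb : bounded_below J) (Ji : forall i, injective_module (J i)).
Hypotheses (gq : qiso g) (rq : qiso (right_adjoint g)).
Hypothesis Ma : forall n, n < a -> cohomology_zero (Tensor_complex L P) n.

Lemma finitary_core : finitary U (fun S : pred (core_sort L P) =>
  exists (P' : complex B) (i : chain_map P' P), core_result a S i).
Proof.
have [Q [p [Qb Qfp pq]]] := perfect_resolution Lperf.
have Qg i : finitely_generated (Q i) := (Qfp i).1.
have Qp i : projective (Q i) := (Qfp i).2.
have uq : qiso (unit_map p P) by apply/(qiso_unit Qb Qp pq Jb Ji gq).
have [supp suppP] := dchoice (fun i => projective_support (@Pp i)).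
have [gens gensP] := dchoice (generatorsP Qb Qg).
have := finitary_core_closed a uq supp gens eA_inj eB_inj eL_inj.
apply: finitary_imp => S; apply: (core_closed_result Qb Qp pq Pp uq Ma) => //.
Qed.
End Core.

(** [K2] and [K3] match the closed part of [E] with the classes of degree 0 cocycles of the small
    tensor complex, so [E'] is its cohomology in degree 0 and the new complex [J'] resolves it. *)
Lemma certified_E : certified U (Eclass L l1).
Proof.
move=> E [J [eta [[Ji Jz etaI etaE Jn] JL [P [q [Pb Pp qq lq]]]]]].
pose g := left_adjoint q.
have rq : qiso (right_adjoint g).
  by apply: (qiso_ext qq) => n y; apply: right_left_adjoint.
have J0 (x : J 0) : coboundary x -> x = 0.
  by move=> [m [e [y ->]]]; rewrite (Jz m _ y) ?linear0 //; lia.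
(* The cutoff is 0, as L (x) P is quasi-isomorphic to a resolution that starts in degree 0. *)
have Ma n : n < 0 -> cohomology_zero (Tensor_complex L P) n.
  move=> n0 x x0; apply: (lq n).1 => //.
  by rewrite (Jz n n0 (left_adjoint q n x)); apply: coboundary0.
have Jb : bounded_below J by exists 0.
exists (E + core_sort L P)%type, inl; split; first by move=> x y [].
have fin1 := finitary_preim (f := inr : core_sort L P -> E + core_sort L P)
  (fun x y (h : inr x = inr y) => let: erefl := h in erefl)
  (finitary_core Pp Jb Ji lq rq Ma).
have fin2 : finitary U (fun S : pred (E + core_sort L P) => forall e : E, all S [:: inl e] ->
    (exists m : Tensor_complex L P 0, cd (Tensor_complex L P) 0 m = 0 /\ g 0 m = eta e) ->
    exists2 m : Tensor_complex L P 0, cd (Tensor_complex L P) 0 m = 0 /\ g 0 m = eta e &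
      all S [:: inr (inM m)]).
  by apply: finitary_horn (fun=> CNat 0) _ _ _ _ => e e' _ [].
have fin3 : finitary U (fun S : pred (E + core_sort L P) =>
    forall m : Tensor_complex L P 0, all S [:: inr (inM m)] ->
    (exists e : E, eta e = g 0 m) -> exists2 e : E, eta e = g 0 m & all S [:: inl e]).
  by apply: finitary_horn (fun=> CNat 0) _ _ _ _ => m m' _ [] h; exact: existT_inj h.
have inlI : injective (inl : E -> E + core_sort L P) by move=> x y [].
have fin4 := finitary_submodule eA_inj inlI.
have := finitary_and (finitary_and fin1 fin2) (finitary_and fin3 fin4).
apply: finitary_imp => S [[[P' [i cr]] K2] [K3 HS]].
pose E' := subm HS; pose inc := sub_incl HS.
have [J' [g' [J'i J'z g'q r'q]]] := cr_J cr.
have J'0 (x : J' 0) : coboundary x -> x = 0.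
  by move=> [m [e [y ->]]]; rewrite (J'z m _ y) ?linear0 //; lia.
have lift (e : E') : exists m : Tensor_complex L P' 0,
    cd (Tensor_complex L P') 0 m = 0 /\ g 0 (tmap L i 0 m) = eta (inc e).
  have eS : S (inl (inc e)) := sub_inclP e.
  have [||m [m0 mE] /andP[mS _]] := K2 (inc e); rewrite /= ?eS //.
    have [|m m0 mE] := (lq 0).2 (eta (inc e)).
      by apply/etaE; exists (inc e).
    by exists m; split=> //; apply: esym; apply: eqB; apply: J0.
  move: mS m0 mE => /(cr_M cr)[m' <-] m0 mE; exists m'; split=> //.
  by apply: (cr_tinj cr); rewrite cmap_d m0 linear0.
have uniq0 (m : Tensor_complex L P' 0) : cd (Tensor_complex L P') 0 m = 0 ->
    g 0 (tmap L i 0 m) = 0 -> coboundary m.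
  move=> m0 gm; apply: (cr_cohM cr); apply: (lq 0).1; first by rewrite -cmap_d m0 linear0.
  by rewrite -/g gm; apply: coboundary0.
(* An element [e] goes to the image of any small cocycle lying over it; two such cocycles differ by
   a coboundary, and [J'] has no nonzero coboundaries in degree 0. *)
have [|||eta' eta'E] := @linear_of_rel A E' (J' 0) (fun e j => exists m,
    [/\ cd (Tensor_complex L P') 0 m = 0, g 0 (tmap L i 0 m) = eta (inc e) & g' 0 m = j]).
- by move=> e; have [m [m0 mE]] := lift e; exists (g' 0 m), m.
- move=> e _ _ [m [m0 mE <-]] [n [n0 nE <-]]; apply: eqB; rewrite -linearB.
  apply/J'0/coboundary_map/uniq0; first by rewrite linearB m0 n0 subrr.
  by rewrite !linearB mE nE subrr.
- move=> k e f _ _ [m [m0 mE <-]] [n [n0 nE <-]]; exists (k *: m + n); split.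
  + by rewrite linearP m0 n0 scaler0 addr0.
  + by rewrite !linearP mE nE.
  + by rewrite linearP.
exists E', inc; split; [exact: sub_incl_inj | exact: sub_inclE |].
exists J', eta'; split.
- split=> //.
  + have ker e : eta' e = 0 -> e = 0.
      have [m [m0 mE <-]] := eta'E e; move=> gm.
      have /(coboundary_map (tmap L i)) /(coboundary_map g) : coboundary m.
        by apply: (g'q 0).1 => //; rewrite gm; apply: coboundary0.
      rewrite mE => /J0 e0; apply: (@sub_incl_inj _ _ _ HS); apply: etaI.
      by rewrite [LHS]e0 !linear0.
    by move=> e f ef; apply: eqB; apply: ker; rewrite linearB ef subrr.
  + move=> x; split=> [x0|[e ->]]; last first.
      by have [m [m0 _ <-]] := eta'E e; rewrite -cmap_d m0 linear0.
    have [m m0 /J'0 /eqB xE] := (g'q 0).2 x x0.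
    have mS : S (inr (inM (tmap L i 0 m))) by apply/(cr_M cr); exists m.
    have [||e eE /andP[eS _]] := K3 (tmap L i 0 m); rewrite /= ?mS //.
      have /etaE[e eE] : cd J 0 (g 0 (tmap L i 0 m)) = 0 by rewrite -!cmap_d m0 !linear0.
      by exists e.
    have [e' e'E] := proj1 (sub_inclE HS e) eS; exists e'.
    have [n [n0 nE <-]] := eta'E e'; rewrite xE; apply: eqB; rewrite -linearB.
    apply/J'0/coboundary_map/uniq0; first by rewrite linearB m0 n0 subrr.
    by rewrite !linearB nE /inc e'E eE subrr.
  + move=> n n0 y y0; have [m m0 my] := (g'q n).2 y y0.
    rewrite -[y](subrK (g' n m)); apply: coboundaryD => //; apply: coboundary_map.
    apply: (cr_cohM cr); apply: (lq n).1; first by rewrite -cmap_d m0 linear0.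
    by apply: Jn => //; rewrite -!cmap_d m0 !linear0.
(* Vanishing of Ext is transported along Hom(L, J'), [P'], [P] and Hom(L, J): the middle map is
   injective on cohomology, the outer ones are isomorphisms. *)
- move=> n ln y y0; have [m m0 my] := (r'q n).2 y y0.
  rewrite -[y](subrK (right_adjoint g' n m)); apply: coboundaryD => //; apply: coboundary_map.
  apply: (cr_cohP cr); apply: (qq n).1; first by rewrite -cmap_d m0 linear0.
  by apply: JL => //; rewrite -!cmap_d m0 !linear0.
exists P', (right_adjoint g'); split=> //.
- have [b bP] := Pb; exists b => j bj x; apply: (cr_inj cr); rewrite linear0.
  exact: bP.
- exact: cr_proj cr.
by apply: (qiso_ext g'q) => n u; apply: left_right_adjoint.
Qed.

Lemma certified_F : certified U (Fclass L l1).
Proof.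
move=> F [P [eps [[Pp Pz epsS epsE Pn] PL [J [g [Jb Ji gq rq]]]]]].
(* Here the cutoff comes from the bound on Tor. *)
have Ma n : n < - l1 -> cohomology_zero (Tensor_complex L P) n.
  by move=> n1; rewrite -[n]opprK; apply: PL; lia.
exists (F + core_sort L P)%type, inl; split; first by move=> x y [].
have fin1 := finitary_preim (f := inr : core_sort L P -> F + core_sort L P)
  (fun x y (h : inr x = inr y) => let: erefl := h in erefl)
  (finitary_core Pp Jb Ji gq rq Ma).
have fin2 : finitary U (fun S : pred (F + core_sort L P) => forall f : F, all S [:: inl f] ->
    (exists y : P 0, eps y = f) -> exists2 y : P 0, eps y = f & all S [:: inr (inP L y)]).
  by apply: finitary_horn (fun=> CNat 0) _ _ _ _ => e e' _ [].
have fin3 : finitary U (fun S : pred (F + core_sort L P) =>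
    forall y : P 0, all S [:: inr (inP L y)] -> (exists u : unit, True) ->
    exists2 u : unit, True & all S [:: inl (eps y)]).
  by apply: finitary_horn (fun=> CNat 0) _ _ _ _ => m m' _ [] h; exact: existT_inj h.
have inlI : injective (inl : F -> F + core_sort L P) by move=> x y [].
have fin4 := finitary_submodule eB_inj inlI.
have := finitary_and (finitary_and fin1 fin2) (finitary_and fin3 fin4).
apply: finitary_imp => S [[[P' [i cr]] K2] [K3 HS]].
pose F' := subm HS; pose inc := sub_incl HS.
have [J' [g' [J'i J'z g'q r'q]]] := cr_J cr.
have [|y|eps' eps'E] := lin_factor (N := F') (i := inc) (f := eps \o i 0).
- exact: sub_incl_inj.
- apply/sub_inclE; have yS : S (inr (inP L (i 0 y))) by apply/(cr_P cr); exists y.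
  by have [||_ _ /andP[]//] := K3 (i 0 y); rewrite /= ?yS //; exists tt.
have cobE n (y : P' n) : coboundary y <-> coboundary (i n y).
  by split; [apply: coboundary_map | apply: (cr_cohP cr)].
exists F', inc; split; [exact: sub_incl_inj | exact: sub_inclE |].
exists P', eps'; split.
- split.
  + exact: cr_proj cr.
  + by move=> n n0 x; apply: (cr_inj cr); rewrite linear0; apply: Pz.
  + move=> f; have fS : S (inl (inc f)) := sub_inclP f.
    have [||y yE /andP[/(cr_P cr)[y' y'E] _]] := K2 (inc f); rewrite /= ?fS //.
    by exists y'; apply: (@sub_incl_inj _ _ _ HS); rewrite [LHS]eps'E /= y'E.
  + move=> y; apply: iff_trans (iff_sym (cobE _ y)); apply: iff_trans (epsE _).
    rewrite -[eps _]/((eps \o i 0) y) -eps'E; split=> [->|e0]; first by rewrite linear0.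
    by apply: (@sub_incl_inj _ _ _ HS); rewrite [LHS]e0 linear0.
  + by move=> n n0 y y0; apply/cobE; apply: Pn => //; rewrite -cmap_d y0 linear0.
- move=> n ln m m0; apply: (cr_cohM cr); apply: PL => //.
  by rewrite -cmap_d m0 linear0.
exists J', g'; split=> //.
by exists (- l1).
Qed.

End Certificates.

(** * Extensions *)

Section Twisted.
Variables (R : pzRingType) (C1 C3 : complex R).
Variable t : forall i, {linear C3 i -> C1 (i + 1)}.
Hypothesis tE : forall i x, cd C1 (i + 1) (t i x) + t (i + 1) (cd C3 i x) = 0.

(** Up to isomorphism, every extension of [C3] by [C1] that splits in each degree arises so. It is a
    shifted cone, written without the shift to avoid transport. *)
Definition tw_obj (i : int) : lmodType R := (C1 i * C3 i)%type.

Definition tw_d i (u : tw_obj i) : tw_obj (i + 1) :=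
  (cd C1 i u.1 + t i u.2, cd C3 i u.2).

Lemma tw_d_linear i : linear (@tw_d i).
Proof.
move=> a u v; congr pair => /=; last by rewrite linearP.
by rewrite !linearP scalerDr addrACA.
Qed.

Lemma tw_dd i u : mklin (@tw_d_linear (i + 1)) (mklin (@tw_d_linear i) u) = 0.
Proof. by congr pair => /=; rewrite ?cdd // linearD cdd add0r tE. Qed.

Definition tw : complex R := @Complex R tw_obj (fun i => mklin (@tw_d_linear i)) tw_dd.

Lemma tr_tw i j (e : i = j) (x : C1 i) (y : C3 i) :
  tr (C := tw) e (x, y) = (tr e x, tr e y).
Proof. by case: j / e. Qed.

Program Definition tw_in : chain_map C1 tw :=
  @ChainMap R C1 tw (fun i => mklin (@inl_linear R (C1 i) (C3 i))) _.
Next Obligation. by move=> i x; congr pair; rewrite /= linear0 ?addr0. Qed.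

Program Definition tw_out : chain_map tw C3 :=
  @ChainMap R tw C3 (fun i => mklin (@snd_linear R (C1 i) (C3 i))) _.
Next Obligation. by []. Qed.

Definition tw_fst i : {linear tw i -> C1 i} := mklin (@fst_linear R (C1 i) (C3 i)).
Definition tw_inr i : {linear C3 i -> tw i} := mklin (@inr_linear R (C1 i) (C3 i)).

End Twisted.

Section GradedSplit.
Variables (R : pzRingType) (C1 C2 C3 : complex R).
Variables (i : chain_map C1 C2) (p : chain_map C2 C3).
Variables (r : forall n, {linear C2 n -> C1 n}) (s : forall n, {linear C3 n -> C2 n}).

(** The splitting is by graded maps, so it is preserved by tensor products and Hom complexes and
    keeps the sequences exact after these functors. *)
Record gsplit : Prop := {
  gs_ri : forall n x, r n (i n x) = x;
  gs_ps : forall n x, p n (s n x) = x;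
  gs_pi : forall n x, p n (i n x) = 0;
  gs_sum : forall n x, i n (r n x) + s n (p n x) = x }.

Lemma gsplit_exact : gsplit -> forall n, exact_seq (i n) (p n).
Proof.
move=> [ri ps pi_ sum] n; split.
- exact: can_inj (ri n).
- by move=> y; exists (s n y).
- move=> x; split=> [px|[y ->]] //; exists (r n x).
  by rewrite -{1}[x]sum px linear0 addr0.
Qed.
End GradedSplit.

Lemma gsplit_tw (R : pzRingType) (C1 C3 : complex R) (t : forall i, {linear C3 i -> C1 (i + 1)})
  (tE : forall i x, cd C1 (i + 1) (t i x) + t (i + 1) (cd C3 i x) = 0) :
  gsplit (tw_in tE) (tw_out tE) (tw_fst tE) (tw_inr tE).
Proof. by split=> // n [x y]; congr pair; rewrite /= ?addr0 ?add0r. Qed.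

Section GradedFunctors.
Variables (A B : pzRingType) (L : bicomplex A B).

Lemma gtensD (P P' : complex B) (f g h : forall i, {linear P i -> P' i}) :
  (forall i x, h i x = f i x + g i x) ->
  forall n u, gtens L h n u = gtens L f n u + gtens L g n u.
Proof.
move=> E n; have HL := fun_linD (linearP (gtens L f n)) (linearP (gtens L g n)).
apply: (tens_ext (f := gtens L h n) (g := mklin HL)) => p x y.
by rewrite /= /linear_fun !gtensE E /tens tpureDr.
Qed.

Lemma gtens0 (P P' : complex B) (f : forall i, {linear P i -> P' i}) :
  (forall i x, f i x = 0) -> forall n u, gtens L f n u = 0.
Proof.
move=> E n; apply: (tens_ext (f := gtens L f n) (g := \0)) => p x y.
by rewrite gtensE E /tens tpure0r.
Qed.

Lemma gtens_cancel (P P' : complex B) (f : forall i, {linear P i -> P' i})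
    (g : forall i, {linear P' i -> P i}) :
  (forall i x, g i (f i x) = x) -> forall n u, gtens L g n (gtens L f n u) = u.
Proof.
move=> E n u; rewrite -[RHS]gtens_id; symmetry.
by apply: gtens_comp => i x /=; rewrite E.
Qed.

Lemma gsplit_tens (P1 P2 P3 : complex B) (i : chain_map P1 P2) (p : chain_map P2 P3) r s :
  gsplit i p r s -> gsplit (tmap L i) (tmap L p) (gtens L r) (gtens L s).
Proof.
case=> ri ps pi_ sum; split.
- exact: gtens_cancel.
- exact: gtens_cancel.
- move=> n u; rewrite /= -(gtens_comp (h := fun j => p j \o i j)) //.
  by apply: gtens0 => j x; apply: pi_.
- move=> n u; rewrite /= -(gtens_comp (h := fun j => i j \o r j)) //.
  rewrite -(gtens_comp (h := fun j => s j \o p j)) //.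
  by rewrite -(gtensD (h := fun j => idfun)) ?gtens_id // => j x; rewrite /= sum.
Qed.

Definition gpost_fun (M N : complex A) (f : forall i, {linear M i -> N i}) n
  (c : cochain L M n) : cochain L N n :=
  @Cochain A B L N n (fun p x => f _ (c p x))
    (fun p => linearP (f _ \o (c p : {linear _ -> _}))).

Lemma gpost_linear (M N : complex A) (f : forall i, {linear M i -> N i}) n :
  linear (gpost_fun f (n := n)).
Proof. by move=> b c d; apply: cochainP => p x /=; rewrite linearD. Qed.

Definition gpost (M N : complex A) (f : forall i, {linear M i -> N i}) n :
  {linear cochain L M n -> cochain L N n} := mklin (gpost_linear f (n := n)).

Lemma gsplit_post (M1 M2 M3 : complex A) (i : chain_map M1 M2) (p : chain_map M2 M3) r s :
  gsplit i p r s -> gsplit (post L i) (post L p) (gpost r) (gpost s).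
Proof.
case=> ri ps pi_ sum; split=> n c; apply: cochainP => j x.
- exact: ri.
- exact: ps.
- exact: pi_.
- exact: sum.
Qed.
End GradedFunctors.

Lemma projective_prod (R : pzRingType) (M N : lmodType R) :
  projective M -> projective N -> projective (M * N : lmodType R)%type.
Proof.
move=> Mp Np X Y g f gs.
have [h hE] := Mp X Y g (mklin (fun_linC f (@inl_linear R M N))) gs.
have [k kE] := Np X Y g (mklin (fun_linC f (@inr_linear R M N))) gs.
exists (mklin (fun_linD (fun_linC h (@fst_linear R M N)) (fun_linC k (@snd_linear R M N)))).
move=> [x y]; rewrite /= /linear_fun linearD hE kE /= /linear_fun -linearD; congr (f _).
by congr pair; rewrite /= ?addr0 ?add0r.
Qed.

Lemma injective_prod (R : pzRingType) (M N : lmodType R) :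
  injective_module M -> injective_module N -> injective_module (M * N : lmodType R)%type.
Proof.
move=> Mi Ni X Y g f gI.
have [h hE] := Mi X Y g (mklin (fun_linC (mklin (@fst_linear R M N)) (linearP f))) gI.
have [k kE] := Ni X Y g (mklin (fun_linC (mklin (@snd_linear R M N)) (linearP f))) gI.
have pL : linear (fun x => (h x, k x)) by move=> a x y; congr pair; rewrite linearP.
exists (mklin pL) => x; rewrite /= /linear_fun hE kE /= /linear_fun.
by case: (f x).
Qed.

Definition iso_closed (R : pzRingType) (G : lmodType R -> Prop) : Prop :=
  forall (M N : lmodType R) (f : {linear N -> M}), injective f -> surj f -> G M -> G N.

Definition ext_closed (R : pzRingType) (G : lmodType R -> Prop) : Prop :=
  forall (M1 M2 M3 : lmodType R) (i : {linear M1 -> M2}) (p : {linear M2 -> M3}),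
  exact_seq i p -> G M1 -> G M3 -> G M2.

Section Closure.
Variables (A B : pzRingType) (L : bicomplex A B) (l1 : int).

Lemma iso_closed_E : iso_closed (Eclass L l1).
Proof.
move=> M N f fI fS [J [eta [[Ji Jz etaI etaE Jn] JL q]]].
exists J, (eta \o f); split=> //; split=> //; first by move=> x y /etaI/fI.
move=> x; apply: iff_trans (etaE x) _; split=> [[m ->]|[n ->]].
  by have [n nE] := fS m; exists n; rewrite /= nE.
by exists (f n).
Qed.

Lemma iso_closed_F : iso_closed (Fclass L l1).
Proof.
move=> M N f fI fS [P [eps [[Pp Pz epsS epsE Pn] PL q]]].
have [g [fK gK]] := lin_inverse fI fS.
exists P, (g \o eps); split=> //; split=> //.
  by move=> n; have [y yE] := epsS (f n); exists y; rewrite /= yE.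
move=> x; apply: iff_trans _ (epsE x); split=> /= [gx|->]; last by rewrite linear0.
by rewrite -[LHS]gK gx linear0.
Qed.

End Closure.

(** * The horseshoe construction for injectives and extensions in the class E *)

Section HorseshoeInjective.
Variables (R : pzRingType) (E1 E2 E3 : lmodType R).
Variables (i0 : {linear E1 -> E2}) (p0 : {linear E2 -> E3}).
Hypothesis ex : exact_seq i0 p0.
Variables (J1 J3 : complex R) (eta1 : {linear E1 -> J1 0}) (eta3 : {linear E3 -> J3 0}).
Hypotheses (res1 : injective_resolution eta1) (res3 : injective_resolution eta3).

Lemma horseshoe_injective_maps :
  exists (ep : {linear E2 -> J1 0}) (d : forall i, {linear J3 i -> J1 (i + 1)}),
  [/\ forall y, ep (i0 y) = eta1 y,
      forall x, cd J1 0 (ep x) + d 0 (eta3 (p0 x)) = 0 &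
      forall i x, cd J1 (i + 1) (d i x) + d (i + 1) (cd J3 i x) = 0].
Proof.
have [J1i J1z eta1I eta1E J1n] := res1; have [J3i J3z eta3I eta3E J3n] := res3.
have [iI pS exE] := ex.
have [|ep epE] := injective_extend (T := i0) (v := eta1) (J1i 0).
  by move=> x; rewrite -{1}(linear0 i0) => /iI ->; rewrite linear0.
have [|d0 d0E] := injective_extend (T := eta3 \o p0) (v := mklin (fun_linN (fun_linC (cd J1 0) (linearP ep)))) (J1i (0 + 1)).
  move=> x /=; rewrite -{1}(linear0 eta3) => /eta3I/exE[y ->]; rewrite /linear_fun.
  have -> : ep (i0 y) = eta1 y by [].
  have -> : cd J1 0 (eta1 y) = 0 by apply/eta1E; exists y.
  exact: oppr0.
pose T i : Type := {linear J3 i -> J1 (i + 1)}.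
(* The seed is [d0] in degree 0 and zero elsewhere; [J3] vanishes in negative degrees. *)
pose z i : T i := match 0 =P i with
  | ReflectT e => eq_rect 0 T d0 i e | _ => \0 : {linear J3 i -> J1 (i + 1)} end.
have z0 : z 0 = d0 by rewrite /z; case: eqP => // e; rewrite (eq_irrelevance e erefl).
(* Sending cocycles to cocycles is what allows the composite of [t] with the differential of [J1] to
   factor through that of [J3], and so the recursion to continue. *)
pose good i (t : T i) := forall x : J3 i, cd J3 i x = 0 -> cd J1 (i + 1) (t x) = 0.
have zgood i : i <= 0 -> good i (z i).
  move=> i0' x x0; have [E|ne] := eqVneq i 0.
    subst i; have [e ->] := proj1 (eta3E x) x0; have [y <-] := pS e.
    by rewrite z0 [d0 _]d0E [LHS]linearN /= cdd oppr0.
  by rewrite (J3z _ _ x) ?linear0 //; lia.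
pose Rel i (t : T i) (t' : T (i + 1)) :=
  (forall x, cd J1 (i + 1) (t x) + t' (cd J3 i x) = 0) /\ good _ t'.
have [i ilt|i t0 t1 [r g1]|d [dR dz]] := @rec_up T Rel 0 z.
- split; last by apply: zgood; lia.
  by move=> x; rewrite (J3z i ilt x) !linear0 addr0.
- have [i1|i1] := leP (i + 1 + 1) 0.
    exists (z (i + 1 + 1)); split; last exact: zgood.
    by move=> x; rewrite (J3z _ _ x) ?linear0 ?addr0 //; lia.
  have [|t2 t2E] := injective_extend (T := cd J3 (i + 1))
      (v := mklin (fun_linN (fun_linC (cd J1 (i + 1 + 1)) (linearP t1)))) (J1i (i + 1 + 1 + 1)).
    by move=> x x0; exact: (etrans (congr1 -%R (g1 x x0)) (oppr0 _)).
  have r2 x : cd J1 (i + 1 + 1) (t1 x) + t2 (cd J3 (i + 1) x) = 0.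
    by rewrite t2E; exact: subrr.
  exists t2; split=> // x x0.
  have [|y ->] := proj1 (coboundary1 x) (J3n _ _ x x0); first by lia.
  have := congr1 (cd J1 _) (r2 y); by rewrite linearD cdd add0r linear0.
exists ep, d; split=> //; last by move=> i x; have [+ _] := dR i; apply.
by move=> x; rewrite dz // z0 [d0 _]d0E; exact: subrr.
Qed.

Variables (ep : {linear E2 -> J1 0}) (d : forall i, {linear J3 i -> J1 (i + 1)}).
Hypothesis ep_i : forall y, ep (i0 y) = eta1 y.
Hypothesis ep_d : forall x, cd J1 0 (ep x) + d 0 (eta3 (p0 x)) = 0.
Hypothesis dE : forall i x, cd J1 (i + 1) (d i x) + d (i + 1) (cd J3 i x) = 0.

Lemma horseshoe_eta_linear : linear (fun x => (ep x, eta3 (p0 x)) : tw dE 0).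
Proof. by move=> a x y; congr pair; rewrite !linearP. Qed.

Lemma horseshoe_injective : injective_resolution (mklin horseshoe_eta_linear).
Proof.
have [J1i J1z eta1I eta1E J1n] := res1; have [J3i J3z eta3I eta3E J3n] := res3.
have [iI pS exE] := ex.
have eta0 (E : lmodType R) (J : complex R) (eta : {linear E -> J 0}) :
    injective_resolution eta -> forall m, cd J 0 (eta m) = 0.
  by case=> _ _ _ H _ m; apply/H; exists m.
split.
- by move=> i; apply: injective_prod.
- by move=> i i0' [x y]; congr pair; [apply: J1z | apply: J3z].
- suff ker x : ep x = 0 -> eta3 (p0 x) = 0 -> x = 0.
    move=> x y [E F]; apply: eqB; apply: ker; first by rewrite linearB E subrr.
    by rewrite !linearB F subrr.
  move=> ex0; rewrite -{1}(linear0 eta3) => /eta3I/exE[y yE]; move: ex0.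
  by rewrite yE ep_i -{1}(linear0 eta1) => /eta1I ->; rewrite linear0.
- move=> [u v]; split=> [[]|[x ->]]; last first.
    by congr pair; [exact: ep_d | exact: (eta0 _ _ _ res3)].
  rewrite /= => E1' E3'; have [e3 e3E] := proj1 (eta3E v) E3'.
  have [x xE] := pS e3; have [|y yE] := proj1 (eta1E (u - ep x)).
    by rewrite linearB (subr_addr_eq0 (ep_d x) _) // xE -e3E.
  exists (x + i0 y); congr pair => /=; first by rewrite linearD ep_i -yE addrC subrK.
  by rewrite linearD (proj2 (exE (i0 y)) (ex_intro _ y erefl)) addr0 xE.
- move=> n n0; apply: (cohomology_zero_ses (i := tw_in dE) (p := tw_out dE)).
  + exact: (gsplit_exact (gsplit_tw dE)).
  + exact: J1n.
  + exact: J3n.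
Qed.
End HorseshoeInjective.

Lemma sg_pair (V W : zmodType) n (x : V) (y : W) : sg n (x, y) = (sg n x, sg n y).
Proof. by rewrite /sg; case: odd. Qed.

Lemma tw_cancel (V : zmodType) n (x y z y' : V) :
  x + z = 0 -> y = y' -> x + sg n y + (z - sg n y') = 0.
Proof. by move=> xz <-; rewrite addrACA xz add0r subrr. Qed.

Lemma k_cancel (V : zmodType) (q k c x y : V) :
  k = - y -> c = - x -> q + k = c + (q + (x - y)).
Proof. by move=> -> ->; rewrite addrCA addKr. Qed.

Section TwistedHom.
Variables (A B : pzRingType) (L : bicomplex A B) (J1 J3 : complex A).
Variable d : forall i, {linear J3 i -> J1 (i + 1)}.
Hypothesis dE : forall i x, cd J1 (i + 1) (d i x) + d (i + 1) (cd J3 i x) = 0.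

Lemma d_tr i j (e : i = j) (e' : i + 1 = j + 1) (x : J3 i) :
  d j (tr e x) = tr e' (d i x).
Proof. by case: j / e e' => e'; rewrite !tr_id. Qed.

Definition connecting_fun n (f : cochain L J3 n) : cochain L J1 (n + 1) :=
  @Cochain A B L J1 (n + 1)
    (fun p x => tr (esym (addrA p n 1)) (d (p + n) (f p x)))
    (fun p => linearP (tr (esym (addrA p n 1)) \o d (p + n) \o (f p : {linear _ -> _}))).

Lemma connecting_linear n : linear (@connecting_fun n).
Proof. by move=> b f g; apply: cochainP => p x /=; rewrite !linearD. Qed.

Definition connecting n : {linear cochain L J3 n -> cochain L J1 (n + 1)} :=
  mklin (@connecting_linear n).

Lemma connecting_anti n (f : cochain L J3 n) : hom_d (connecting n f) + connecting (n + 1) (hom_d f) = 0.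
Proof.
apply: cochainP => p x.
have e1 : p + (n + 1) + 1 = p + (n + 1 + 1) by lia.
have e2 : p + 1 + (n + 1) = p + (n + 1 + 1) by lia.
have e3 : p + n + 1 = p + (n + 1) by lia.
have e4 : p + 1 + n = p + (n + 1) by lia.
change (hom_d (connecting n f) p x + connecting (n + 1) (hom_d f) p x = 0).
rewrite (hom_dE _ _ e1 e2).
change (cde J1 e1 (tr (esym (addrA p n 1)) (d (p + n) (f p x)))
  - sg (n + 1) (tr e2 (tr (esym (addrA (p + 1) n 1)) (d (p + 1 + n) (f (p + 1) (bd L p x)))))
  + tr (esym (addrA p (n + 1) 1)) (d (p + (n + 1)) (hom_d f p x)) = 0).
rewrite (hom_dE _ _ e3 e4) [d _ (_ - _)]linearB [d _ (sg _ _)]sg_lin cdeE.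
rewrite (d_tr _ (congr1 (+%R^~ 1) e3)) (d_tr _ (congr1 (+%R^~ 1) e4)).
rewrite trB tr_sg !tr_tr.
rewrite (cd_tr _ (congr1 (+%R^~ 1) (esym (addrA p n 1)))) !tr_tr sgS opprK.
apply: tw_cancel; last exact: tr_irr.
have := congr1 (tr (C := J1) (etrans (congr1 (+%R^~ 1) (esym (addrA p n 1))) e1)) (dE (f p x)).
rewrite tr0 trD => E; apply: etrans E.
by congr (_ + _); exact: tr_irr.
Qed.

Definition pairc n (f1 : cochain L J1 n) (f3 : cochain L J3 n) : cochain L (tw dE) n :=
  @Cochain A B L (tw dE) n (fun p x => (f1 p x, f3 p x))
    (fun p a x y => f_equal2 pair (@coch_linear _ _ _ _ _ f1 p a x y)
                                  (@coch_linear _ _ _ _ _ f3 p a x y)).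

Lemma hom_d_pairc n (f1 : cochain L J1 n) (f3 : cochain L J3 n) :
  hom_d (pairc f1 f3) = pairc (hom_d f1 + connecting n f3) (hom_d f3).
Proof.
apply: cochainP => p x; rewrite /= /hom_d_fun /= /linear_fun /tw_d /=.
rewrite !(tr_tw dE) sg_pair; congr pair; rewrite /= trD [RHS]addrAC.
by [].
Qed.

Lemma pairc_linear n b (f1 g1 : cochain L J1 n) (f3 g3 : cochain L J3 n) :
  pairc (b *: f1 + g1) (b *: f3 + g3) = b *: pairc f1 f3 + pairc g1 g3.
Proof. exact: cochainP. Qed.

End TwistedHom.

Section ExtensionE.
Variables (A B : pzRingType) (L : bicomplex A B) (l1 : int).

(** The horseshoe gives [J2]. The complex [P2] needs a twist that [q1] and [q3] relate to the twist
    of [J2]; since [q1] is a quasi-isomorphism and [P3] is projective, it can be found up to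
    homotopy, and the five lemma does the rest. *)
Lemma ext_closed_E : ext_closed (Eclass L l1).
Proof.
move=> E1 E2 E3 i0 p0 ex.
move=> [J1 [eta1 [res1 JL1 [P1 [q1 [Pb1 Pp1 qq1 lq1]]]]]].
move=> [J3 [eta3 [res3 JL3 [P3 [q3 [Pb3 Pp3 qq3 lq3]]]]]].
have [ep [d [ep_i ep_d dE]]] := horseshoe_injective_maps ex res1 res3.
pose J2 := tw dE; exists J2, (mklin (horseshoe_eta_linear p0 eta3 ep dE)).
have exJ := gsplit_exact (gsplit_post L (gsplit_tw dE)).
split.
- exact: (horseshoe_injective ex res1 res3 ep_i ep_d).
- by move=> n ln; apply: (cohomology_zero_ses exJ); [apply: JL1 | apply: JL3].
(* The connecting map after [q3], as a cocycle of degree 1, written [0 + 1]. Its lift along [q1]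
   becomes the twist [t], and the homotopy [b] becomes [k]. *)
pose F : cochain (triv P3) (Hom_complex L J1) (0 + 1) :=
  mkcoch (L := triv P3) (fun i => connecting L d i \o q3 i : {linear P3 i -> Hom_complex L J1 (i + (0 + 1))}).
have [||a [b [a0 FE]]] := hom_lift (L := triv P3) (n := 0) (f := F) (e := 0) Pb3 Pp3 qq1.
- exact: (linear0 (@hom_d _ _ (triv P3) P1 _ : {linear _ -> _})).
- move=> i y.
  have e1 : i + (0 + 1) + 1 = i + (0 + 1 + 1) :> int by lia.
  have e2 : i + 1 + (0 + 1) = i + (0 + 1 + 1) :> int by lia.
  rewrite (hom_dE _ _ e1 e2).
  have := congr1 (tr (C := Hom_complex L J1) e1) (connecting_anti dE (q3 i y)).
  rewrite tr0 trD => E; rewrite [RHS]linear0; apply: etrans E; congr (_ + _).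
  apply: etrans (opprK _) _; change (F (i + 1) (bd (triv P3) i y)) with
    (connecting L d (i + 1) (q3 (i + 1) (cd P3 i y))); rewrite cmap_d; exact: tr_irr.
have Lt i := @coch_linear _ _ _ _ _ a i.
pose t i : {linear P3 i -> P1 (i + 1)} := mklin (@Lt i).
have tE i x : cd P1 (i + 1) (t i x) + t (i + 1) (cd P3 i x) = 0.
  have e1 : i + (0 + 1) + 1 = i + (0 + 1 + 1) :> int by lia.
  have e2 : i + 1 + (0 + 1) = i + (0 + 1 + 1) :> int by lia.
  have := congr1 (fun c : cochain (triv P3) P1 _ => tr (C := P1) (esym e1) (c i x)) a0.
  rewrite (hom_dE _ _ e1 e2) tr0 trB tr_cde tr_sg tr_tr => E.
  apply: etrans E; congr (_ + _); first by symmetry; exact: cde_cd.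
  by symmetry; apply: etrans (opprK _) _; exact: tr_id.
have e5 i : i + 0 = i :> int by lia.
have kL i := fun_linN (fun_linC (tr (C := Hom_complex L J1) (e5 i)) (@coch_linear _ _ _ _ _ b i)).
pose k i : {linear P3 i -> Hom_complex L J1 i} := mklin (@kL i).
have kE i y : q1 (i + 1) (t i y) + k (i + 1) (cd P3 i y) =
    cd (Hom_complex L J1) i (k i y) + connecting L d i (q3 i y).
  have f1 : i + 0 + 1 = i + (0 + 1) :> int by lia.
  have f2 : i + 1 + 0 = i + (0 + 1) :> int by lia.
  have := FE i y; rewrite (hom_dE _ _ f1 f2) => FE'.
  have -> : connecting L d i (q3 i y) = F i y by [].
  rewrite FE'; apply: k_cancel.
    by congr (- _); exact: tr_irr.
  apply: etrans (linearN (cd (Hom_complex L J1) i) _) _; congr (- _).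
  apply: etrans (esym (cde_cd erefl _)) _; apply: etrans (cde_tr _ _ _) _.
  exact: cde_irr.
pose P2 := tw tE.
(* The correction by [k] compensates the difference between [q1] after [t] and the connecting map
   after [q3], which makes [q2] a chain map. *)
pose q2f n (y : P2 n) : cochain L J2 n := pairc dE (q1 n y.1 + k n y.2) (q3 n y.2).
have q2L n : linear (@q2f n).
  move=> c x y; rewrite /q2f -pairc_linear; congr pairc; rewrite !linearP //.
  by rewrite scalerDr addrACA.
have q2d n (y : P2 n) : q2f (n + 1) (cd P2 n y) = hom_d (q2f n y).
  rewrite hom_d_pairc; congr pairc; last exact: (cmap_d q3 y.2).
  have Eq : q1 (n + 1) (cd P1 n y.1 + t n y.2) =
      cd (Hom_complex L J1) n (q1 n y.1) + q1 (n + 1) (t n y.2) by rewrite linearD cmap_d.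
  have Ek := linearD (cd (Hom_complex L J1) n) (q1 n y.1) (k n y.2).
  apply: etrans (congr1 (+%R^~ _) Eq) (etrans _ (esym (congr1 (+%R^~ _) Ek))).
  by rewrite -[LHS]addrA -[RHS]addrA kE.
pose q2 := @ChainMap B P2 (Hom_complex L J2) (fun n => mklin (@q2L n)) q2d.
have q12 n x : q2 n (tw_in tE n x) = post L (tw_in dE) n (q1 n x).
  by apply: cochainP => p z; congr pair => /=; rewrite ?linear0 ?addr0.
have q23 n x : q3 n (tw_out tE n x) = post L (tw_out dE) n (q2 n x).
  by apply: cochainP.
exists P2, q2; split.
- have [c1 c1P] := Pb1; have [c3 c3P] := Pb3; exists (Order.max c1 c3) => i.
  by rewrite gt_max => /andP[i1 i3] [x y]; congr pair; [apply: c1P | apply: c3P].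
- by move=> i; apply: projective_prod.
- exact: (qiso_ses (gsplit_exact (gsplit_tw tE)) exJ q12 q23).
have exP := gsplit_exact (gsplit_tens L (gsplit_tw tE)).
apply: (qiso_ses exP (gsplit_exact (gsplit_tw dE)) (f1 := left_adjoint q1) (f3 := left_adjoint q3)) => //.
- move=> n; apply: (tens_ext (f := left_adjoint q2 n \o tmap L (tw_in tE) n)
    (g := tw_in dE n \o left_adjoint q1 n)) => p x y.
  change (left_adjoint q2 n (gtens L (tw_in tE) n (tens x y)) =
    tw_in dE n (left_adjoint q1 n (tens x y))).
  rewrite gtensE; apply: etrans (adjE _ _ _) (etrans _ (esym (congr1 _ (adjE _ _ _)))).
  rewrite /adj_pure q12 [tw_in dE n _]sg_lin; congr sg.
  by apply: etrans (tr_tw dE _ _ _) _; rewrite tr0.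
- move=> n; apply: (tens_ext (f := left_adjoint q3 n \o tmap L (tw_out tE) n)
    (g := tw_out dE n \o left_adjoint q2 n)) => p x y.
  change (left_adjoint q3 n (gtens L (tw_out tE) n (tens x y)) =
    tw_out dE n (left_adjoint q2 n (tens x y))).
  rewrite gtensE; apply: etrans (adjE _ _ _) (etrans _ (esym (congr1 _ (adjE _ _ _)))).
  rewrite /adj_pure q23 [tw_out dE n _]sg_lin; congr sg.
  by symmetry; exact: (congr1 snd (tr_tw dE _ _ _)).
Qed.
End ExtensionE.

(** * The horseshoe construction for projectives and extensions in the class F *)

Section HorseshoeProjective.
Variables (R : pzRingType) (F1 F2 F3 : lmodType R).
Variables (i0 : {linear F1 -> F2}) (p0 : {linear F2 -> F3}).
Hypothesis ex : exact_seq i0 p0.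
Variables (P1 P3 : complex R) (eps1 : {linear P1 0 -> F1}) (eps3 : {linear P3 0 -> F3}).
Hypotheses (res1 : projective_resolution eps1) (res3 : projective_resolution eps3).

Lemma horseshoe_projective_maps :
  exists (ep : {linear P3 0 -> F2}) (d : forall i, {linear P3 i -> P1 (i + 1)}),
  [/\ forall y, p0 (ep y) = eps3 y,
      forall x, i0 (eps1 (d (-1) x)) + ep (cd P3 (-1) x) = 0 &
      forall i x, cd P1 (i + 1) (d i x) + d (i + 1) (cd P3 i x) = 0].
Proof.
have [P1p P1z eps1S eps1E P1n] := res1; have [P3p P3z eps3S eps3E P3n] := res3.
have [iI pS exE] := ex.
have [y|ep epE] := projective_lift (T := p0) (v := eps3) (P3p 0); first exact: pS.
have d30 (x : P3 (-1)) : eps3 (cd P3 (-1) x) = 0 by apply/eps3E; exact: (coboundary_cd x).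
have [y|d0 d0E] := projective_lift (T := i0 \o eps1)
    (v := mklin (fun_linN (fun_linC ep (linearP (cd P3 (-1)))))) (P3p (-1)).
  have /exE[z zE] : p0 (- ep (cd P3 (-1) y)) = 0 by rewrite linearN epE d30 oppr0.
  by have [w wz] := eps1S z; exists w; exact: (etrans (congr1 i0 wz) (esym zE)).
pose T i : Type := {linear P3 i -> P1 (i + 1)}.
pose z i : T i := match -1 =P i with
  | ReflectT e => eq_rect (-1) T d0 i e | _ => \0 : {linear P3 i -> P1 (i + 1)} end.
have z0 : z (-1) = d0 by rewrite /z; case: eqP => // e; rewrite (eq_irrelevance e erefl).
(* The dual invariant: [t] sends coboundaries to coboundaries, so its composite with the
   differential of [P3] lifts through that of [P1]. *)
pose good i (t : T i) := forall j (e : j + 1 = i) (x : P3 j), coboundary (t (cde P3 e x)).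
have P1pos i (x : P1 (i + 1)) : 0 <= i -> x = 0 by move=> ?; apply: P1z; lia.
have zgood i : -1 <= i -> good i (z i).
  move=> i0'; have [E|ne] := eqVneq i (-1); last first.
    by move=> j e x; rewrite (P1pos i (z i _)) //; [exact: coboundary0 | lia].
  subst i => j e x; rewrite z0; apply/(eps1E (d0 _)); apply: iI.
  have := d0E (cde P3 e x); rewrite /= /linear_fun linear0 => ->.
  have -> : cd P3 (-1) (cde P3 e x) = 0 by rewrite -(cde_cd erefl) cde_cde.
  by rewrite linear0 oppr0.
pose Rel i (t : T i) (t' : T (i + 1)) :=
  (forall x, cd P1 (i + 1) (t x) + t' (cd P3 i x) = 0) /\ good i t.
have [i ilt|i t1 t2 [r g1]|d [dR dz]] := @rec_down T Rel (-1) z.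
- split; last exact: zgood.
  by move=> x; apply: P1pos; lia.
- have [i1|i1] := leP (-1) i.
    exists (z i); split; last exact: zgood.
    by move=> x; apply: P1pos; lia.
  have [x|t0 t0E] := projective_lift (T := cd P1 (i + 1))
      (v := mklin (fun_linN (fun_linC t1 (linearP (cd P3 i))))) (P3p i).
    have /coboundary1[y yE] := g1 i erefl x; exists (- y).
    by rewrite linearN -yE cde_cd.
  have r0 x : cd P1 (i + 1) (t0 x) + t1 (cd P3 i x) = 0 by rewrite t0E; exact: addNr.
  exists t0; split=> // j e x; apply: P1n; first by lia.
  have := r0 (cde P3 e x); rewrite -[cd P3 i _](cde_cd erefl) cde_cde linear0 addr0 //.
exists ep, d; split=> //; last by move=> i x; have [+ _] := dR i; apply.
move=> x; rewrite dz // z0.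
by have := d0E x; rewrite /= /linear_fun => ->; rewrite addNr.
Qed.

Variables (ep : {linear P3 0 -> F2}) (d : forall i, {linear P3 i -> P1 (i + 1)}).
Hypothesis p_ep : forall y, p0 (ep y) = eps3 y.
Hypothesis ep_d : forall x, i0 (eps1 (d (-1) x)) + ep (cd P3 (-1) x) = 0.
Hypothesis dE : forall i x, cd P1 (i + 1) (d i x) + d (i + 1) (cd P3 i x) = 0.

Lemma horseshoe_eps_linear : linear (fun u : tw dE 0 => i0 (eps1 u.1) + ep u.2).
Proof.
apply: fun_linD; first exact: (fun_linC i0 (fun_linC eps1 (@fst_linear _ _ _))).
exact: (fun_linC ep (@snd_linear _ _ _)).
Qed.

Lemma horseshoe_projective : projective_resolution (mklin horseshoe_eps_linear).
Proof.
have [P1p P1z eps1S eps1E P1n] := res1; have [P3p P3z eps3S eps3E P3n] := res3.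
have [iI pS exE] := ex.
have pi y : p0 (i0 y) = 0 by apply/exE; exists y.
split.
- by move=> i; apply: projective_prod.
- by move=> i i0' [x y]; congr pair; [apply: P1z | apply: P3z].
- move=> f; have [y yE] := eps3S (p0 f).
  have /exE[f1 f1E] : p0 (f - ep y) = 0 by rewrite linearB p_ep yE subrr.
  have [x xE] := eps1S f1; exists (x, y).
  by rewrite /= /linear_fun /= xE -f1E subrK.
- move=> [u v]; split; last first.
    move/(coboundary1 (C := tw dE) (n := -1)) => [[x y] E].
    have -> : u = cd P1 (-1) x + d (-1) y := congr1 fst E.
    have -> : v = cd P3 (-1) y := congr1 snd E.
    rewrite /= /linear_fun /= linearD.
    have -> : eps1 (cd P1 (-1) x) = 0 by apply/eps1E; exact: (coboundary_cd x).
    by rewrite add0r ep_d.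
  rewrite /= /linear_fun /= => E.
  have /eps3E/(coboundary1 (n := -1))[y yE] : eps3 v = 0.
    by have := congr1 p0 E; rewrite linearD pi add0r p_ep linear0.
  have /eps1E/(coboundary1 (n := -1))[x xE] : eps1 (u - d (-1) y) = 0.
    apply: iI; rewrite !linearB linear0; apply: subr_addr_eq0 (ep_d y) _.
    by rewrite -yE.
  apply/(coboundary1 (C := tw dE) (n := -1)); exists (x, y).
  by congr pair => /=; [rewrite -xE; exact: (esym (subrK _ _)) | exact: yE].
- move=> n n0; apply: (cohomology_zero_ses (i := tw_in dE) (p := tw_out dE)).
  + exact: (gsplit_exact (gsplit_tw dE)).
  + exact: P1n.
  + exact: P3n.
Qed.
End HorseshoeProjective.

Section ExtensionF.
Variables (A B : pzRingType) (L : bicomplex A B) (l1 : int).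
Hypothesis Lperf : perfect_above (lcomplex L).

Lemma exact_zmap (R : pzRingType) (C1 C2 C3 : complex R) (i : chain_map C1 C2)
    (p : chain_map C2 C3) :
  (forall n, exact_seq (i n) (p n)) -> forall n, exact_seq (zmap i n) (zmap p n).
Proof. by move=> ex n; case: (ex n). Qed.

(** No injective complex is glued from [J1] and [J3]. The criterion of [qiso_unit] passes to the
    middle term by the five lemma, and a fresh injective resolution of the middle tensor complex
    realises it. *)
Lemma ext_closed_F : ext_closed (Fclass L l1).
Proof.
move=> F1 F2 F3 i0 p0 ex.
move=> [P1 [eps1 [res1 PL1 [J1 [g1 [Jb1 Ji1 gq1 rq1]]]]]].
move=> [P3 [eps3 [res3 PL3 [J3 [g3 [Jb3 Ji3 gq3 rq3]]]]]].
have [ep [d [p_ep ep_d dE]]] := horseshoe_projective_maps ex res1 res3.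
exists (tw dE), (mklin (@horseshoe_eps_linear _ _ _ i0 _ _ eps1 ep d dE)).
have exP := gsplit_exact (gsplit_tens L (gsplit_tw dE)).
have M2 n : l1 < n -> cohomology_zero (Tensor_complex L (tw dE)) (- n).
  by move=> ln; apply: (cohomology_zero_ses exP); [apply: PL1 | apply: PL3].
split=> //; first exact: (horseshoe_projective ex res1 res3 p_ep ep_d).
have [Q [p [Qb Qfp pq]]] := perfect_resolution Lperf.
have Qp i : projective (Q i) := (Qfp i).2.
have u1 : qiso (unit_map p P1) by apply/(qiso_unit Qb Qp pq Jb1 Ji1 gq1).
have u3 : qiso (unit_map p P3) by apply/(qiso_unit Qb Qp pq Jb3 Ji3 gq3).
have u2 : qiso (unit_map p (tw dE)).
  apply: (qiso_ses (exact_zmap (gsplit_exact (gsplit_tw dE)))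
    (exact_zmap (gsplit_exact (gsplit_post (triv Q) (gsplit_tens L (gsplit_tw dE)))))) u1 u3.
  - by move=> n x; apply: unit_map_tmap.
  - by move=> n x; apply: unit_map_tmap.
have [n n1|J [g [Ji Jz gq]]] := @injective_resolution_exists _ (Tensor_complex L (tw dE)) (- l1).
  by rewrite -[n]opprK; apply: M2; lia.
exists J, g; split=> //; first by exists (- l1).
by apply/(qiso_unit Qb Qp pq) => //; exists (- l1).
Qed.
End ExtensionF.

(** * Acyclic complexes in an exact category *)

Section Acyclic.
Variables (R : pzRingType) (G : lmodType R -> Prop).
Hypotheses (Giso : iso_closed G) (Gext : ext_closed G).
Implicit Types C D : complex R.

Lemma G_prod (M N : lmodType R) : G M -> G N -> G (M * N : lmodType R)%type.
Proof.
move=> GM GN; apply: (Gext (i := mklin (@inl_linear R M N)) (p := mklin (@snd_linear R M N))) => //.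
split; first by move=> x y [].
  by move=> y; exists (0, y).
move=> [x y]; split=> [E|[z E]]; last exact: (congr1 snd E).
by exists x; congr pair; exact: E.
Qed.

(** Direct summands of objects of [G]. They are needed because cocycles are not preserved by
    homotopy equivalences, only up to summands. *)
Definition Gs (M : lmodType R) : Prop := exists N : lmodType R, G (M * N : lmodType R)%type.

(** The complement is the kernel of [g]. *)
Lemma Gs_summand (M K : lmodType R) (f : {linear M -> K}) (g : {linear K -> M}) :
  (forall x, g (f x) = x) -> G K -> Gs M.
Proof.
move=> gf GK; have HS : submodule (fun y => g y = 0).
  by split=> [|a x y x0 y0]; rewrite ?linear0 // linearP x0 y0 scaler0 addr0.
exists (subm HS); pose i := sub_incl HS.
have gi y : g (i y) = 0 := sub_inclP y.
have hL := fun_linD (fun_linC f (@fst_linear R M (subm HS)))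
  (fun_linC i (@snd_linear R M (subm HS))).
apply: (Giso (f := mklin hL)) GK.
  move=> [x y] [x' y']; rewrite /= /linear_fun /= => E.
  have xx : x = x' by have := congr1 g E; rewrite !linearD !gi !gf !addr0.
  rewrite xx in E *; move/addrI: E => E.
  by have <- : y = y' by exact: (sub_incl_inj E).
move=> z; have [y yE] : exists y, i y = z - f (g z).
  by apply/(sub_inclE HS); rewrite linearB gf subrr.
by exists (g z, y); apply: etrans (congr1 (+%R (f (g z))) yE) _; rewrite addrC subrK.
Qed.

Lemma Gs_retract (M K : lmodType R) (f : {linear M -> K}) (g : {linear K -> M}) :
  (forall x, g (f x) = x) -> Gs K -> Gs M.
Proof.
move=> gf [N GK].
apply: (Gs_summand (f := mklin (fun_linC (mklin (@inl_linear R K N)) (linearP f)))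
  (g := mklin (fun_linC g (@fst_linear R K N)))) GK.
by move=> x; exact: gf.
Qed.


Lemma Gs_ext : ext_closed Gs.
Proof.
move=> M1 M2 M3 i p [iI pS ex] [N1 G1] [N3 G3].
exists (N1 * N3 : lmodType R)%type.
pose X1 : lmodType R := (M1 * N1)%type; pose X2 : lmodType R := (M2 * (N1 * N3))%type.
pose X3 : lmodType R := (M3 * N3)%type.
have jL : linear (fun u : X1 => (i u.1, (u.2, 0)) : X2).
  by move=> a u v; congr (_, (_, _)) => /=; rewrite ?linearP ?scaler0 ?addr0.
have qL : linear (fun u : X2 => (p u.1, u.2.2) : X3).
  by move=> a u v; congr pair => /=; rewrite ?linearP.
apply: (Gext (i := mklin jL) (p := mklin qL)) G1 G3; split.
- by move=> [x n] [y m] [/iI -> ->].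
- by move=> [z n]; have [x <-] := pS z; exists (x, (0, n)).
- move=> [x [n m]]; split=> [[/ex[y ->] ->]|[[y k] [-> _ ->]]]; first by exists (y, n).
  by congr pair; apply/ex; exists y.
Qed.

Lemma cocycles_submodule C i : submodule (fun x : C i => cd C i x = 0).
Proof.
by split=> [|a x y x0 y0]; rewrite ?linear0 // linearP x0 y0 scaler0 addr0.
Qed.

Definition Zc C i : lmodType R := subm (cocycles_submodule C i).
Definition Zi C i : {linear Zc C i -> C i} := sub_incl _.

Lemma Zi0 C i (z : Zc C i) : cd C i (Zi C i z) = 0.
Proof. exact: sub_inclP z. Qed.

Lemma Zi_inj C i : injective (Zi C i).
Proof. exact: sub_incl_inj. Qed.

Lemma ZiE C i x : cd C i x = 0 -> exists z, Zi C i z = x.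
Proof. by move=> x0; apply/(sub_inclE (cocycles_submodule C i)). Qed.

Lemma Zmap C D i j (f : {linear C i -> D j}) :
  (forall x, cd C i x = 0 -> cd D j (f x) = 0) ->
  exists g : {linear Zc C i -> Zc D j}, forall z, Zi D j (g z) = f (Zi C i z).
Proof.
move=> f0; apply: (lin_factor (f := f \o Zi C i)) => [|z]; first exact: Zi_inj.
by apply: ZiE; apply: f0; apply: Zi0.
Qed.

(** An intrinsic form of [Ac], free of homotopy equivalences; closure properties of [Ac] and its
    restriction to subcomplexes are proved through it. *)
Definition acycs C : Prop := [/\ terms_in G C, acyclic C & forall i, Gs (Zc C i)].

Lemma spliced_acyc C : spliced G C -> acyclic C /\ forall i, G (Zc C i).
Proof.
move=> [Z [j [p S]]]; split.
  apply/acyclic1 => n x x0.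
  have [_ jI _ ex dE] := S (n + 1); have [_ _ pS _ dE'] := S n.
  have /ex[z zE] : p (n + 1) x = 0.
    have [_ jI' _ _ _] := S (n + 1 + 1); apply: jI'.
    by rewrite -dE x0 linear0.
  by have [y yE] := pS z; exists y; rewrite dE' yE.
move=> i; have [[GZ _] jI pS ex dE] := S i.
have ker x : cd C i x = 0 <-> exists z, j i z = x.
  rewrite dE; split=> [E|[z <-]].
    have [_ jI' _ _ _] := S (i + 1).
    have /ex[z ->] : p i x = 0 by apply: jI'; rewrite E linear0.
    by exists z.
  by rewrite (proj2 (ex (j i z)) (ex_intro _ z erefl)) linear0.
have [|g gE] := lin_factor (f := Zi C i) jI.
  by move=> z; apply/ker; apply: Zi0.
apply: (Giso (f := g)) GZ; first by move=> x y E; apply: Zi_inj; rewrite -!gE E.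
move=> z; have [|x xE] := @ZiE C i (j i z); first by apply/ker; exists z.
by exists x; apply: jI; rewrite gE.
Qed.

Lemma Ac_acycs C : Ac G C -> acycs C.
Proof.
move=> [GC [D [sD [f [g [[h hE] _]]]]]]; have [aD ZD] := spliced_acyc sD.
have GD i : G (D i) by have [Z [j [p S]]] := sD; have [[]] := S i.
split=> //.
  apply/acyclic1 => n x x0.
  have [|y yE] := proj1 (acyclic1 D) aD n (f (n + 1) x); first by rewrite -cmap_d x0 linear0.
  exists (g n y - h n x); rewrite linearB -cmap_d -yE.
  by have := hE n x; rewrite /= x0 linear0 addr0 => <-; rewrite subKr.
apply: int_succ => i.
have [|F FE] := @Zmap C D (i + 1) (i + 1) (f (i + 1)).
  by move=> x x0; rewrite -cmap_d x0 linear0.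
(* On cocycles the homotopy reads [z = g (f z) - d (h z)], which makes the cocycles of [C] a retract
   of [K]. *)
pose K : lmodType R := (Zc D (i + 1)%R * C i)%type.
have aL : linear (fun z => (F z, h i (Zi C _ z)) : K).
  by move=> a x y; congr pair; rewrite !linearP.
have bL : linear (fun u : K => g (i + 1) (Zi D _ u.1) - cd C i u.2).
  apply: fun_linD; first exact: (fun_linC _ (fun_linC _ (@fst_linear _ _ _))).
  by apply: fun_linN; exact: (fun_linC _ (@snd_linear _ _ _)).
have [|b bE] := lin_factor (f := mklin bL) (@Zi_inj C (i + 1)).
  move=> u; apply: ZiE; rewrite /= /linear_fun linearB cdd subr0 -cmap_d Zi0 linear0 //.
apply: (Gs_summand (f := mklin aL) (g := b)); last exact: G_prod.
move=> z; apply: Zi_inj; rewrite bE.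
change (g (i + 1) (Zi D _ (F z)) - cd C i (h i (Zi C _ z)) = Zi C _ z); rewrite FE.
by have := hE i (Zi C _ z); rewrite Zi0 linear0 addr0 /= => <-; rewrite subKr.
Qed.

(** Adding the contractible complex with terms [N i * N (i + 1)] does not change the homotopy type
    and completes the cocycles to [Zc C i * N i], which lies in [G]; the sum is therefore
    spliced. *)
Lemma acycs_Ac C : acycs C -> Ac G C.
Proof.
move=> [GC aC /dchoice[N GN]]; split=> //.
pose D i : lmodType R := (C i * (N i * N (i + 1)%R))%type.
have dL i : linear (fun u : D i => (cd C i u.1, (u.2.2, 0)) : D (i + 1)).
  by move=> a u v; congr (_, (_, _)) => /=; rewrite ?linearP ?scaler0 ?addr0.
have dd i u : mklin (@dL (i + 1)) (mklin (@dL i) u) = 0.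
  by congr (_, _); rewrite /= cdd.
pose CD := @Complex R D (fun i => mklin (@dL i)) dd.
exists CD; split.
  pose Z i : lmodType R := (Zc C i * N i)%type.
  have jL i : linear (fun u : Z i => (Zi C i u.1, (u.2, 0)) : D i).
    by move=> a u v; congr (_, (_, _)) => /=; rewrite ?linearP ?scaler0 ?addr0.
  have [b bE] : exists b : forall i, {linear C i -> Zc C (i + 1)},
      forall i x, Zi C (i + 1) (b i x) = cd C i x.
    apply: (@dchoice int (fun i => {linear C i -> Zc C (i + 1)})
       (fun i b => forall x, Zi C (i + 1) (b x) = cd C i x)) => i.
    apply: lin_factor => [|x]; first exact: Zi_inj.
    by apply: ZiE; rewrite cdd.
  have pL i : linear (fun u : D i => (b i u.1, u.2.2) : Z (i + 1)).
    by move=> a u v; congr pair => /=; rewrite ?linearP.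
  have ex i : exact_seq (mklin (@jL i)) (mklin (@pL i)).
    split.
    - by move=> [x n] [y m] [/Zi_inj -> ->].
    - move=> [z n]; have [y yE] := proj1 (acyclic1 C) aC i (Zi C _ z) (Zi0 z).
      by exists (y, (0, n)); congr pair; apply: Zi_inj; rewrite bE -yE.
    - move=> [x [n m]]; split=> [[b0 m0]|[[y k] [-> _ ->]]].
        have [|z zE] := @ZiE C i x; first by rewrite -bE b0 linear0.
        by exists (z, n); rewrite -zE [m]m0.
      by congr pair; apply: Zi_inj; rewrite bE Zi0 linear0.
  exists Z, (fun i => mklin (@jL i)), (fun i => mklin (@pL i)) => i.
  have [jI pS exE] := ex i; split=> //; first split.
  - exact: GN.
  - by apply: (Gext (ex i)); apply: GN.
  - move=> [x [n m]]; change ((cd C i x, (m, 0)) = (Zi C (i + 1) (b i x), (m, 0)) :> D (i + 1)).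
    by rewrite bE.
have fL i : linear (fun x : C i => (x, (0, 0)) : D i).
  by move=> a x y; congr (_, (_, _)); rewrite /= scaler0 addr0.
have fd i x : mklin (@fL (i + 1)) (cd C i x) = cd CD i (mklin (@fL i) x) by [].
have gL i : linear (fun u : D i => u.1) by [].
have gd i u : mklin (@gL (i + 1)) (cd CD i u) = cd C i (mklin (@gL i) u) by [].
exists (@ChainMap R C CD (fun i => mklin (@fL i)) fd).
exists (@ChainMap R CD C (fun i => mklin (@gL i)) gd); split.
  exists (fun i => \0 : {linear C (i + 1) -> C i}) => i x.
  by rewrite /= subrr linear0 addr0.
have hL i : linear (fun u : D (i + 1) => (0, (0, - u.2.1)) : D i).
  by move=> a u v; congr (_, (_, _)); rewrite /= ?scaler0 ?addr0 // opprD scalerN.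
exists (fun i => mklin (@hL i)) => i [x [n m]] /=.
congr (_, (_, _)); rewrite /= ?subrr ?linear0 ?addr0 ?sub0r ?add0r //.
Qed.

(** Acyclicity of [C] makes the cocycle modules a short exact sequence, to which [Gs_ext]
    applies. *)
Lemma Ac_ses C D E (i : chain_map C D) (p : chain_map D E) :
  (forall n, exact_seq (i n) (p n)) -> Ac G C -> Ac G E -> Ac G D.
Proof.
move=> ex /Ac_acycs[GC aC ZC] /Ac_acycs[GE aE ZE]; apply: acycs_Ac; split.
- by move=> n; apply: (Gext (ex n)).
- by move=> n; apply: (cohomology_zero_ses ex).
move=> n; have [|f fE] := @Zmap C D n n (i n).
  by move=> x x0; rewrite -cmap_d x0 linear0.
have [|g gE] := @Zmap D E n n (p n).
  by move=> x x0; rewrite -cmap_d x0 linear0.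
apply: (Gs_ext (i := f) (p := g)) (ZC n) (ZE n).
have [iI pS exn] := ex n; split.
- by move=> x y E'; apply: Zi_inj; apply: iI; rewrite -!fE E'.
- move=> z; have [x xE] := pS (Zi E n z); have [iI' _ exn'] := ex (n + 1).
  have /exn'[y yE] : p (n + 1) (cd D n x) = 0 by rewrite cmap_d xE Zi0.
  have [|y' y'E] := proj1 (acyclic1 C) aC n y.
    by have [iI2 _ _] := ex (n + 1 + 1); apply: iI2; rewrite cmap_d -yE cdd linear0.
  have [|w wE] := @ZiE D n (x - i n y').
    by rewrite linearB -cmap_d -y'E -yE subrr.
  exists w; apply: Zi_inj; rewrite gE wE linearB xE.
  by rewrite (proj2 (exn (i n y')) (ex_intro _ y' erefl)) subr0.
- move=> z; split=> [E'|[y ->]]; last first.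
    apply: Zi_inj; rewrite gE fE linear0.
    by apply/exn; exists (Zi C n y).
  have /exn[y yE] : p n (Zi D n z) = 0 by rewrite -gE E' linear0.
  have [|w wE] := @ZiE C n y.
    by have [iI' _ _] := ex (n + 1); apply: iI'; rewrite cmap_d -yE Zi0 linear0.
  by exists w; apply: Zi_inj; rewrite fE wE.
Qed.

Lemma Ac_retract C D (i : chain_map C D) (r : chain_map D C) :
  (forall n x, r n (i n x) = x) -> terms_in G C -> Ac G D -> Ac G C.
Proof.
move=> ri GC /Ac_acycs[GD aD ZD]; apply: acycs_Ac; split=> //.
  move=> n x x0; rewrite -(ri n x); apply: coboundary_map; apply: aD.
  by rewrite -cmap_d x0 linear0.
move=> n; have [|f fE] := @Zmap C D n n (i n).
  by move=> x x0; rewrite -cmap_d x0 linear0.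
have [|g gE] := @Zmap D C n n (r n).
  by move=> x x0; rewrite -cmap_d x0 linear0.
by apply: (Gs_retract (f := f) (g := g)) (ZD n) => z; apply: Zi_inj; rewrite gE fE ri.
Qed.

(** The shift by one, with its sign, indexed so that no transport occurs. *)
Definition sh1 C : complex R :=
  @Complex R (fun i => C (i + 1)) (fun i => mklin (fun_linN (linearP (cd C (i + 1)))))
   (fun i x => etrans (congr1 -%R (etrans (linearN (cd C _) _) (etrans (congr1 -%R (cdd _)) (oppr0 _)))) (oppr0 _)).

Lemma sh1_Zc C i : exists (f : {linear Zc (sh1 C) i -> Zc C (i + 1)})
  (g : {linear Zc C (i + 1) -> Zc (sh1 C) i}), cancel f g /\ cancel g f.
Proof.
have [|f fE] := lin_factor (f := Zi (sh1 C) i) (@Zi_inj C (i + 1)).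
  by move=> z; apply: ZiE; apply: oppr_inj; rewrite oppr0; apply: Zi0 z.
have [|g gE] := lin_factor (f := Zi C (i + 1)) (@Zi_inj (sh1 C) i).
  move=> z; apply: (@ZiE (sh1 C) i (Zi C (i + 1) z)).
  by apply: etrans (congr1 -%R (Zi0 z)) (oppr0 _).
exists f, g; split=> z; first by apply: (@Zi_inj (sh1 C)); rewrite gE fE.
by apply: Zi_inj; rewrite fE gE.
Qed.

Lemma acyclic_sh1 C : acyclic (sh1 C) <-> acyclic C.
Proof.
split=> [/acyclic1 aS|/acyclic1 aC]; apply/acyclic1.
  apply: int_succ => n x x0; have [|y yE] := aS n x.
    by apply: etrans (congr1 -%R x0) (oppr0 _).
  by exists (- y); rewrite linearN; exact: yE.
move=> n x x0; have [|y yE] := aC (n + 1) x.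
  by apply: oppr_inj; rewrite oppr0; exact: x0.
by exists (- y); rewrite yE /= /linear_fun linearN opprK.
Qed.

Lemma Ac_sh1 C : Ac G (sh1 C) <-> Ac G C.
Proof.
split=> /Ac_acycs[GC aC ZC]; apply: acycs_Ac; split.
- by apply: int_succ => n; exact: GC n.
- exact/acyclic_sh1.
- apply: int_succ => n; have [f [g [fK gK]]] := sh1_Zc C n.
  exact: (Gs_retract gK (ZC n)).
- by move=> n; exact: GC (n + 1).
- exact/acyclic_sh1.
- move=> n; have [f [g [fK gK]]] := sh1_Zc C n.
  exact: (Gs_retract fK (ZC (n + 1))).
Qed.

End Acyclic.

(** * Fractions *)

Lemma zmod_regroup (V : zmodType) (a b c e : V) : a + b + e = a + (c + e) + (b - c).
Proof. by rewrite (addrC c) (addrC b) [RHS]addrA [a + (e + c)]addrA addrK addrAC. Qed.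

Lemma zmod_shuffle (V : zmodType) (a b c e : V) :
  e - (a + (b + e) + c) = - (a + (b + c)).
Proof.
have -> : a + (b + e) + c = e + (a + (b + c)) by rewrite (addrC b) !addrA (addrC a e).
by rewrite opprD addrA subrr sub0r.
Qed.

Section Homotopy.
Variable R : pzRingType.
Implicit Types C D E : complex R.

Lemma homotopic_refl C D (f g : chain_map C D) : (forall i x, f i x = g i x) -> homotopic f g.
Proof.
move=> fg; exists (fun i => \0 : {linear C (i + 1) -> D i}) => i x.
by rewrite fg subrr linear0 addr0.
Qed.

Lemma homotopic_sym C D (f g : chain_map C D) : homotopic f g -> homotopic g f.
Proof.
move=> [h hE]; exists (fun i => mklin (fun_linN (linearP (h i)))) => i x.
by rewrite -opprB hE opprD /= /linear_fun linearN.
Qed.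

Lemma homotopic_trans C D (f g k : chain_map C D) :
  homotopic f g -> homotopic g k -> homotopic f k.
Proof.
move=> [h hE] [h' h'E]; exists (fun i => mklin (fun_linD (linearP (h i)) (linearP (h' i)))).
move=> i x; rewrite /= /linear_fun linearD addrACA -hE -h'E [RHS]addrA.
by congr (_ - _); rewrite subrK.
Qed.

Lemma homotopic_compl C D E (f g : chain_map C D) (k : chain_map D E) :
  homotopic f g -> homotopic (comp_map k f) (comp_map k g).
Proof.
move=> [h hE]; exists (fun i => k i \o h i) => i x /=.
by rewrite -linearB hE linearD cmap_d.
Qed.

Lemma homotopic_compr C D E (f g : chain_map D E) (k : chain_map C D) :
  homotopic f g -> homotopic (comp_map f k) (comp_map g k).
Proof.
move=> [h hE]; exists (fun i => h i \o k (i + 1)) => i x /=.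
by rewrite hE !cmap_d.
Qed.

(* [S] is [C[-1]], up to sign; it is only accessed through [ka], in degrees of
   the form [i + 1], to avoid transport along [i - 1 + 1 = i]. *)
Lemma unshift C : exists (S : complex R) (ka : forall i, {linear S (i + 1) -> C i}),
  [/\ forall i, injective (ka i), forall i, surj (ka i),
      forall i x, ka (i + 1) (cd S (i + 1) x) = - cd C i (ka i x) &
      forall D (phi : forall i, {linear C i -> D (i + 1)}),
        (forall i x, phi (i + 1) (cd C i x) = - cd D (i + 1) (phi i x)) ->
        exists f : chain_map S D, forall i x, f (i + 1) x = phi i (ka i x)].
Proof.
have e i : i + 1 - 1 = i :> int by lia.
pose ka i : {linear C (i + 1 - 1) -> C i} := (tr (C := C) (e i) : {linear _ -> _}).
exists (shift C (-1)), ka; split.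
- by move=> i; apply: (can_inj (g := tr (C := C) (esym (e i)))) => x; rewrite trK.
- by move=> i y; exists (tr (C := C) (esym (e i)) y); apply: trK.
- move=> i x; rewrite /ka /= /shift_d -[sg _ _]/(- _) trN tr_tr; congr (- _).
  have key j k (e1 : j = k) (e2 : j + 1 = k + 1) (y : C j) : tr e2 (cd C j y) = cd C k (tr e1 y).
    by case: k / e1 e2 => e2; rewrite !tr_id.
  exact: key.
move=> D phi phid.
have e' i : i - 1 + 1 = i :> int by lia.
have phi_tr i j (e1 : j = i) (e2 : j + 1 = i + 1) x :
    tr e2 (phi j x) = phi i (tr e1 x) by case: i / e1 e2 => e2; rewrite !tr_id.
pose f i : {linear shift C (-1) i -> D i} :=
  (tr (C := D) (e' i) : {linear _ -> _}) \o (phi (i - 1) : {linear _ -> _}).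
have fd i x : f (i + 1) (cd (shift C (-1)) i x) = cd D i (f i x).
  have H := phi_tr _ _ (addrAC i (-1) 1) (congr1 (+%R^~ 1) (addrAC i (-1) 1)) (cd C (i - 1) x).
  change (tr (e' (i + 1)) (phi (i + 1 - 1) (- tr (addrAC i (-1) 1) (cd C (i - 1) x))) =
    cd D i (tr (e' i) (phi (i - 1) x))).
  rewrite linearN -H phid.
  have trNN j (e1 : i - 1 + 1 + 1 = j) (y : D (i - 1 + 1 + 1)) : - tr e1 (- y) = tr e1 y.
    by case: j / e1; rewrite /= opprK.
  rewrite trNN tr_tr (cd_tr _ (congr1 (+%R^~ 1) (e' i))); exact: tr_irr.
exists (@ChainMap R (shift C (-1)) D f fd) => i x.
by rewrite /= -(phi_tr _ _ (e i) (congr1 (+%R^~ 1) (e i))); apply: tr_irr.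
Qed.

Variable G : lmodType R -> Prop.
Hypotheses (Giso : iso_closed G) (Gext : ext_closed G).

(* [cone s -> cone Psi -> (cone w)[1]] is a short exact sequence for the map
   [Psi : cone w -> cone s] induced by [u] and [h], and [(cone u)[1]] is a retract
   of [cone Psi]. *)
Lemma cone_two_of_three C D E (u : chain_map C D) (s : chain_map D E) (w : chain_map C E) :
  terms_in G C -> terms_in G D -> homotopic (comp_map s u) w ->
  Ac G (cone s) -> Ac G (cone w) -> Ac G (cone u).
Proof.
move=> GC GD [h hE] As Aw.
have hE' i x : s (i + 1) (u (i + 1) x) = w (i + 1) x + (cd E i (h i x) + h (i + 1) (cd C (i + 1) x)).
  by apply: subr_eqD; exact: hE.
have PL n : linear (fun c : cone w n => (u (n + 1) c.1, c.2 - h n c.1) : cone s n).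
  move=> a x y; congr pair => /=; first by rewrite linearP.
  by rewrite linearP scalerBr opprD addrACA.
have Pd n c : mklin (@PL (n + 1)) (cd (cone w) n c) = cd (cone s) n (mklin (@PL n) c).
  case: c => b x; congr pair; rewrite /= ?linearN ?cmap_d //.
  by rewrite opprK linearB hE'; apply: zmod_regroup.
pose Psi := @ChainMap R (cone w) (cone s) (fun n => mklin (@PL n)) Pd.
have AP : Ac G (cone Psi).
  have iL n : linear (fun c : cone s n => (0, c) : cone Psi n).
    by move=> a x y; congr (_, _); rewrite /= scaler0 addr0.
  have id n c : mklin (@iL (n + 1)) (cd (cone s) n c) = cd (cone Psi) n (mklin (@iL n) c).
    by congr (_, _); rewrite /= ?linear0 ?oppr0 ?add0r.
  have oL n : linear (fun c : cone Psi n => c.1 : sh1 (cone w) n) by [].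
  have od n c : mklin (@oL (n + 1)) (cd (cone Psi) n c) = cd (sh1 (cone w)) n (mklin (@oL n) c).
    by [].
  apply: (Ac_ses Giso Gext (i := @ChainMap R (cone s) (cone Psi) (fun n => mklin (@iL n)) id)
     (p := @ChainMap R (cone Psi) (sh1 (cone w)) (fun n => mklin (@oL n)) od)) => //.
    move=> n; split; first by move=> x y [].
      by move=> y; exists (y, 0).
    move=> [x y]; split=> [E0|[z E0]]; last exact: (congr1 fst E0).
    by exists y; congr (_, _); exact: E0.
  exact/(Ac_sh1 Giso Gext).
have Gu : terms_in G (cone u) by move=> i; apply: (G_prod Gext); [exact: GC | exact: GD].
apply/(Ac_sh1 Giso Gext).
have fL n : linear (fun c : sh1 (cone u) n =>
    ((c.1, h (n + 1) c.1 + s (n + 1) c.2), (- c.2, 0)) : cone Psi n).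
  move=> a x y; congr ((_, _), (_, _)) => /=.
  - by rewrite !linearP scalerDr addrACA.
  - by rewrite opprD scalerN.
  - by rewrite scaler0 addr0.
have fd n c : mklin (@fL (n + 1)) (cd (sh1 (cone u)) n c) = cd (cone Psi) n (mklin (@fL n) c).
  case: c => b z; rewrite /= /linear_fun /cone_d /=.
  congr ((_, _), (_, _)).
  - change (h (n + 1 + 1) (- - cd C (n + 1 + 1) b) + s (n + 1 + 1) (- (u (n + 1 + 1) b + cd D (n + 1) z)) =
      - (w (n + 1 + 1) b + cd E (n + 1) (h (n + 1) b + s (n + 1) z))).
    rewrite opprK linearN [s _ (_ + _)]linearD hE' cmap_d [cd E _ (_ + _)]linearD; exact: zmod_shuffle.
  - change (- - (u (n + 1 + 1) b + cd D (n + 1) z) = u (n + 1 + 1) b - cd D (n + 1) (- z)).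
    by rewrite [cd D _ (- _)]linearN !opprK.
  - change (0 = (h (n + 1) b + s (n + 1) z - h (n + 1) b) + (s (n + 1) (- z) + cd E n 0)).
    by rewrite [s _ (- _)]linearN [cd E _ 0]linear0 addr0 addDK subrr.
have rL n : linear (fun c : cone Psi n => (c.1.1, - c.2.1) : sh1 (cone u) n).
  by move=> a x y; congr (_, _); rewrite /= opprD scalerN.
have rd n c : mklin (@rL (n + 1)) (cd (cone Psi) n c) = cd (sh1 (cone u)) n (mklin (@rL n) c).
  case: c => [[b x] [z x0]]; congr (_, _).
  change (- (u (n + 1 + 1) b - cd D (n + 1) z) = - (u (n + 1 + 1) b + cd D (n + 1) (- z))).
  by rewrite [cd D _ (- _)]linearN.
apply: (Ac_retract Giso Gext (i := @ChainMap R (sh1 (cone u)) (cone Psi) (fun n => mklin (@fL n)) fd)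
  (r := @ChainMap R (cone Psi) (sh1 (cone u)) (fun n => mklin (@rL n)) rd)) AP => //.
  by move=> n [b z]; congr (_, _); exact: opprK.
by move=> n; exact: Gu.
Qed.
End Homotopy.

Section Fractions.
Variables (R : pzRingType) (G : lmodType R -> Prop).
Hypotheses (Giso : iso_closed G) (Gext : ext_closed G).

(* [W] is the cocone of [(v1, - u2) : W1 (+) W2 -> Z], so that
   [cone u2 -> cone (w1 f) -> cone w1] is a short exact sequence. *)
Lemma weak_pullback (W1 W2 Z X : complex R) (v1 : chain_map W1 Z) (u2 : chain_map W2 Z)
    (w1 : chain_map W1 X) :
  terms_in G W1 -> terms_in G W2 -> terms_in G Z -> terms_in G X ->
  Ac G (cone u2) -> Ac G (cone w1) ->
  exists (W : complex R) (f : chain_map W W1) (g : chain_map W W2),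
    [/\ terms_in G W, homotopic (comp_map v1 f) (comp_map u2 g) & Ac G (cone (comp_map w1 f))].
Proof.
move=> G1 G2 GZ GX A2 A1.
have tE i (x : W2 i) : cd W1 (i + 1) ((\0 : {linear W2 i -> W1 (i + 1)}) x) +
    (\0 : {linear W2 (i + 1) -> W1 (i + 1 + 1)}) (cd W2 i x) = 0.
  by rewrite /= linear0 addr0.
pose P := tw tE.
have FL i : linear (fun x : P i => v1 i x.1 - u2 i x.2).
  by apply: fun_linD; [|apply: fun_linN]; apply: fun_linC.
have Fd i x : mklin (@FL (i + 1)) (cd P i x) = cd Z i (mklin (@FL i) x).
  case: x => a b.
  change (v1 (i + 1) (cd W1 i a + 0) - u2 (i + 1) (cd W2 i b) = cd Z i (v1 i a - u2 i b)).
  by rewrite [X in v1 _ X]addr0 !cmap_d linearB.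
pose F := @ChainMap R P Z (fun i => mklin (@FL i)) Fd.
have [W [ka [kI kS kd kU]]] := unshift (cone F).
have aL i : linear (fun c : cone F i => c.1.1 : W1 (i + 1)) by [].
have bL i : linear (fun c : cone F i => c.1.2 : W2 (i + 1)) by [].
have [|f fE] := kU W1 (fun i => mklin (@aL i)).
  move=> i [[a b] z]; change (- (cd W1 (i + 1) a + 0) = - cd W1 (i + 1) a).
  by congr (- _); exact: addr0.
have [|g gE] := kU W2 (fun i => mklin (@bL i)); first by move=> i [[a b] z].
exists W, f, g; split.
- apply: int_succ => i; have [k [k1 k2]] := lin_inverse (@kI i) (@kS i).
  apply: (Giso (f := ka i)) => //.
  by do 2?[apply: (G_prod Gext)]; [exact: G1 | exact: G2 | exact: GZ].
- have hL i : linear (fun x : W (i + 1) => - (ka i x).2).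
    by apply: fun_linN; apply: fun_linC (linearP (ka i)) => a x y.
  exists (fun i => mklin (@hL i)) => i x.
  change (v1 (i + 1) (f (i + 1) x) - u2 (i + 1) (g (i + 1) x) =
    cd Z i (- (ka i x).2) - (ka (i + 1) (cd W (i + 1) x)).2).
  rewrite fE gE kd; case: (ka i x) => [[a b] z].
  change (v1 (i + 1) a - u2 (i + 1) b = cd Z i (- z) - - (v1 (i + 1) a - u2 (i + 1) b + cd Z i z)).
  by rewrite opprK [cd Z _ (- z)]linearN [RHS]addrC addrK.
have kL n : linear (fun c : cone u2 n => ((0, - c.1), c.2) : cone F n).
  by move=> a x y; congr ((_, _), _); rewrite /= ?scaler0 ?addr0 // opprD scalerN.
have [k kE] : exists k : forall n, {linear cone u2 n -> W (n + 1)},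
    forall n c, ka n (k n c) = ((0, - c.1), c.2).
  apply: (@dchoice int (fun n => {linear cone u2 n -> W (n + 1)})
     (fun n k => forall c, ka n (k c) = ((0, - c.1), c.2))) => n.
  have [h hE] := lin_factor (f := mklin (@kL n)) (@kI n) (fun c => @kS n _); by exists h.
have jL n : linear (fun c => (k n c, 0) : cone (comp_map w1 f) n).
  by move=> a x y; congr (_, _); rewrite ?linearP //= scaler0 addr0.
have f0 n c : f (n + 1) (k n c) = 0 by rewrite fE kE.
have jd n c : mklin (@jL (n + 1)) (cd (cone u2) n c) = cd (cone (comp_map w1 f)) n (mklin (@jL n) c).
  congr (_, _); last first.
    by rewrite /= f0 !linear0 addr0.
  apply: kI; rewrite kE [ka _ (- _)]linearN kd kE opprK.
  congr ((_, _), _) => /=.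
  - by rewrite opprK linear0 addr0 oppr0.
  - by rewrite [cd W2 _ (- _)]linearN !opprK.
  - rewrite opprK; congr (_ + _).
    change (u2 (n + 1) c.1 = v1 (n + 1) 0 - u2 (n + 1) (- c.1)).
    by rewrite linear0 sub0r [u2 _ (- _)]linearN opprK.
have pL n : linear (fun c : cone (comp_map w1 f) n => (f (n + 1) c.1, c.2) : cone w1 n).
  by move=> a x y; congr (_, _); rewrite /= ?linearP.
have pd n c : mklin (@pL (n + 1)) (cd (cone (comp_map w1 f)) n c) = cd (cone w1) n (mklin (@pL n) c).
  by congr (_, _); rewrite /= linearN cmap_d.
apply: (Ac_ses Giso Gext (i := @ChainMap R (cone u2) (cone (comp_map w1 f)) (fun n => mklin (@jL n)) jd)
     (p := @ChainMap R (cone (comp_map w1 f)) (cone w1) (fun n => mklin (@pL n)) pd)) => // n.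
split.
- move=> [b z] [b' z'] E.
  have := congr1 (ka n) (congr1 fst E); rewrite !kE => -[E1 E2].
  by congr (_, _) => //; apply: oppr_inj.
- move=> [a y]; have [x xE] := kS n ((a, 0), 0).
  by exists (x, y); congr (_, _); rewrite fE xE.
- move=> [x y]; split=> [E|[c [-> ->]]]; last by congr (_, _); exact: f0.
  have := congr1 snd E; have := congr1 fst E; rewrite /= fE => xE yE.
  exists (- (ka n x).1.2, (ka n x).2); congr (_, _) => //.
  apply: kI; rewrite kE /= opprK; case: (ka n x) xE => [[a b] z] /= xE.
  by congr ((_, _), _).
Qed.

Implicit Types X Y : complex R.
Local Notation groof := (roof (terms_in G) (Ac G)).


Lemma roof_equiv_sym X Y (r r' : groof X Y) : roof_equiv r r' -> roof_equiv r' r.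
Proof.
move=> [W [w [u [v [GW Aw h1 h2 h3]]]]].
by exists W, w, v, u; split=> //; apply: homotopic_sym.
Qed.


(** Both refinements map to the middle of [r'], so their weak pullback over it is a common
    refinement. This requires [u2] to have its cone in [Ac], which is two-out-of-three for
    [roof_den r'] and [w2]. *)
Lemma roof_equiv_trans X Y (r r' r'' : groof X Y) : terms_in G X ->
  roof_equiv r r' -> roof_equiv r' r'' -> roof_equiv r r''.
Proof.
move=> GX [W1 [w1 [u1 [v1 [G1 A1 a1 b1 c1]]]]] [W2 [w2 [u2 [v2 [G2 A2 a2 b2 c2]]]]].
have GZ := roof_midK r'.
have Au2 := cone_two_of_three Giso Gext G2 GZ a2 (roof_denP r') A2.
have [W [f [g [GW h Af]]]] := weak_pullback v1 G1 G2 GZ GX Au2 A1.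
have hc (K : complex R) (s : chain_map (roof_mid r') K) :
    homotopic (comp_map (comp_map s v1) f) (comp_map (comp_map s u2) g).
  exact: (homotopic_compl s h).
exists W, (comp_map w1 f), (comp_map u1 f), (comp_map v2 g); split=> //.
- exact: homotopic_compr a1.
- apply: (homotopic_trans (homotopic_compr g b2)).
  apply: (homotopic_trans (homotopic_sym (homotopic_compr g a2))).
  apply: (homotopic_trans (homotopic_sym (hc _ _))).
  exact: homotopic_compr b1.
- apply: (homotopic_trans (homotopic_compr f c1)).
  apply: (homotopic_trans (hc _ _)).
  exact: homotopic_compr c2.
Qed.

End Fractions.

Lemma pair_eq (V W : Type) (u v : V * W) : u.1 = v.1 -> u.2 = v.2 -> u = v.
Proof. by case: u v => [? ?] [? ?] /= -> ->. Qed.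

(** * Small fractions and their diagrams *)

Section SmallRoofs.
Variables (R : pzRingType) (G : lmodType R -> Prop) (U : Type).
Hypotheses (Giso : iso_closed G) (Gext : ext_closed G) (Gcert : certified U G).
Variables (X Y : complex R).
Hypothesis GX : terms_in G X.
Variable eX : {i & X i} -> code U.
Hypothesis eX_inj : injective eX.
Local Notation groof := (roof (terms_in G) (Ac G) X Y).
Local Notation T := (term (code U)).

(** In each degree a partial surjection from the terms, given as a functional relation, since not
    every term denotes an element. *)
Definition enumerates (C : complex R) (E : forall i, T -> C i -> Prop) : Prop :=
  (forall i x, exists t, E i t x) /\
  (forall i t x x', E i t x -> E i t x' -> x = x').

Section Hull.
Variable r : groof.
Let Z := roof_mid r.
Let K := cone (roof_den r).
Variables (N : int -> lmodType R) (WZ WP : int -> Type).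
Let P i : lmodType R := (Zc K i * N i)%type.
Variables (fZ : forall i, Z i -> WZ i) (fP : forall i, P i -> WP i).
Hypotheses (fZ_inj : forall i, injective (@fZ i)) (fP_inj : forall i, injective (@fP i)).
Let W : Type := ({i & WZ i} + {i & WP i})%type.
Let inZ i (x : Z i) : W := inl (existT WZ i (fZ x)).
Let inP i (x : P i) : W := inr (existT WP i (fP x)).

Let inZ_inj i : injective (@inZ i).
Proof. by move=> x y E; apply: (@fZ_inj i); exact: existT_inj (inl_inj E). Qed.
Let inP_inj i : injective (@inP i).
Proof. by move=> x y E; apply: (@fP_inj i); exact: existT_inj (inr_inj E). Qed.

(* The last three conditions make [K] restrict to an acyclic complex whose
   cocycles, together with the elements of [N] in the closed subset, form the
   closed part of [P].  A cocycle [(z, x)] is recovered from its component [z],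
   which lies in the subset, and from [x], which is part of the code of the
   rule. *)
Definition roof_closed (S : pred W) : Prop :=
  (forall i, good_sub G (fun x : Z i => S (inZ x))) /\
  (forall i, good_sub G (fun x : P i => S (inP x))) /\
  (forall w : {i & Z i}, all S [:: inZ (projT2 w)] -> (exists y : unit, True) ->
     exists2 y : unit, True & all S [:: inZ (cd Z _ (projT2 w))]) /\
  (forall w : {i & P i}, all S [:: inP (projT2 w)] -> (exists y : unit, True) ->
     exists2 y : unit, True &
     all S [:: inZ (Zi K _ (projT2 w).1).1; @inP (projT1 w) (0, (projT2 w).2)]) /\
  (forall w : {i & Zc K i}, all S [:: inZ (Zi K _ (projT2 w)).1] -> (exists y : unit, True) ->
     exists2 y : unit, True & all S [:: @inP (projT1 w) (projT2 w, 0)]) /\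
  (forall w : {i : int & Zc K (i + 1)%R}, all S [:: inZ (Zi K _ (projT2 w)).1] ->
     (exists c : K (projT1 w), cd K _ c = Zi K _ (projT2 w)) ->
     exists2 c : K (projT1 w), cd K _ c = Zi K _ (projT2 w) & all S [:: inZ c.1]).

Lemma finitary_roof_closed :
  (forall i, finitary U (fun S => good_sub G (fun x => S (fZ (i := i) x)))) ->
  (forall i, finitary U (fun S => good_sub G (fun x => S (fP (i := i) x)))) ->
  finitary U roof_closed.
Proof.
move=> gZ gP; do 5?apply: finitary_and.
- apply: (finitary_forall (e := fun i : int => CNat (pickle i))); first exact: code_int_inj.
  move=> i; apply: (finitary_preim (f := fun w => inl (existT WZ i w) : W)) (gZ i).
  by move=> w w' E; exact: existT_inj (inl_inj E).
- apply: (finitary_forall (e := fun i : int => CNat (pickle i))); first exact: code_int_inj.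
  move=> i; apply: (finitary_preim (f := fun w => inr (existT WP i w) : W)) (gP i).
  by move=> w w' E; exact: existT_inj (inr_inj E).
- apply: finitary_horn (fun w => CNat (pickle (projT1 w))) _ _ _ _ => -[i x] [j y] /=.
  by move=> /code_int_inj E; subst j => /(congr1 (head (inZ x)))/inZ_inj ->.
- apply: finitary_horn (fun w => CNat (pickle (projT1 w))) _ _ _ _ => -[i x] [j y] /=.
  by move=> /code_int_inj E; subst j => /(congr1 (head (inP x)))/inP_inj ->.
- apply: finitary_horn (fun w => CPair (CNat (pickle (projT1 w)))
    (eX (existT (fun i => X i) _ (Zi K _ (projT2 w)).2))) _ _ _ _ => -[i x] [j y] /= [].
  move=> /(pcan_inj pickleK) E; subst j => /eX_inj E2.
  have {}E2 := @existT_inj (fun i => X i) _ _ _ E2; move=> /(congr1 (head (inZ (Zi K i x).1))).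
  move=> /inZ_inj E1; congr existT; apply: (@Zi_inj _ K).
  exact: pair_eq E1 E2.
apply: finitary_horn (fun w => CPair (CNat (pickle (projT1 w)))
    (eX (existT (fun i => X i) _ (Zi K _ (projT2 w)).2))) _ _ _ _ => -[i x] [j y] /= [].
move=> /(pcan_inj pickleK) E; subst j => /eX_inj E2.
have {}E2 := @existT_inj (fun i => X i) _ _ _ E2; move=> /(congr1 (head (inZ (Zi K _ x).1))).
move=> /inZ_inj E1; congr existT; apply: (@Zi_inj _ K).
exact: pair_eq E1 E2.
Qed.

Lemma roof_closed_sub (S : pred W) : roof_closed S ->
  exists (r' : groof) (f : forall i, roof_mid r' i -> Z i),
    [/\ roof_equiv r r', forall i, injective (f i) & forall i z, S (inZ (f i z))].
Proof.
move=> [HZ [HP [Hd [HPZ [HZP Hb]]]]].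
have {Hd} Sd i (x : Z i) : S (inZ x) -> S (inZ (cd Z i x)).
  by move=> Sx; have [|_ _ /andP[]] := Hd (existT (fun i => Z i) i x) _ (ex_intro _ tt I); rewrite /= ?Sx.
have {HPZ} SPZ i (p : P i) : S (inP p) -> S (inZ (Zi K i p.1).1) /\ S (@inP i (0, p.2)).
  move=> Sp; have [|_ _ /and3P[]] := HPZ (existT (fun i => P i) i p) _ (ex_intro _ tt I) => //.
  by rewrite /= Sp.
have {HZP} SZP i (c : Zc K i) : S (inZ (Zi K i c).1) -> S (@inP i (c, 0)).
  move=> Sc; have [|_ _ /andP[]] := HZP (existT (fun i => Zc K i) i c) _ (ex_intro _ tt I) => //.
  by rewrite /= Sc.
have [GK aK _] := Ac_acycs Giso Gext (roof_denP r).
have {Hb} Sb i (c : Zc K (i + 1)) : S (inZ (Zi K (i + 1) c).1) ->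
    exists2 b : K i, cd K i b = Zi K (i + 1) c & S (inZ b.1).
  move=> Sc; have [||b bE /andP[]] := Hb (existT (fun i => Zc K (i + 1)) i c).
  - by rewrite /= Sc.
  - have [b bE] := proj1 (acyclic1 K) aK i (Zi K (i + 1) c) (Zi0 c).
    by exists b.
  by exists b.
have [Z' /dchoice[g gP]] := @dchoice int _ _ HZ.
have gI i : injective (g i) by case: (gP i).
have gS i x : S (inZ x) <-> exists z, g i z = x by case: (gP i).
have Sg i z : S (inZ (g i z)) by apply/gS; exists z.
have GZ' i : G (Z' i) by case: (gP i).
have [d dE] : exists d : forall i, {linear Z' i -> Z' (i + 1)},
    forall i z, g (i + 1) (d i z) = cd Z i (g i z).
  apply: (@dchoice int (fun i => {linear Z' i -> Z' (i + 1)})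
     (fun i d => forall z, g (i + 1) (d z) = cd Z i (g i z))) => i.
  apply: (lin_factor (f := cd Z i \o g i)) => [|z]; first exact: gI.
  by apply/gS/Sd.
have dd i z : d (i + 1) (d i z) = 0 by apply: gI; rewrite !dE cdd linear0.
pose C := @Complex R Z' d dd.
pose inc := @ChainMap R C Z g dE.
pose K' := cone (comp_map (roof_den r) inc).
have jL n : linear (fun c : K' n => (g (n + 1) c.1, c.2) : K n).
  by move=> a x y; congr (_, _); rewrite /= ?linearP.
pose j n : {linear K' n -> K n} := mklin (@jL n).
have jI n : injective (j n).
  by move=> [z x] [z' x'] [/gI -> ->].
have jd n c : j (n + 1) (cd K' n c) = cd K n (j n c).
  by congr (_, _); rewrite /= linearN dE.
have AK' : Ac G K'.
  apply: (acycs_Ac Gext); split.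
  - by move=> i; apply: (G_prod Gext); [exact: GZ' | exact: GX].
  - apply/acyclic1 => n c c0.
    have [|c' c'E] := @ZiE _ K (n + 1) (j (n + 1) c); first by rewrite -jd c0 linear0.
    have [|[b x] bE Sb'] := Sb n c'; first by rewrite c'E; apply: Sg.
    have [b' b'E] := proj1 (gS _ _) Sb'.
    exists (b', x); apply: jI; rewrite jd -c'E -bE; congr (cd K n _).
    by congr (_, _).
  (* The complement of the cocycles of [K'] is the closed part of [N i]: the two closure clauses
     linking cocycles with [P] identify their product with [Q], which lies in [G]. *)
  move=> i; have [Q [q [qI qS GQ]]] := HP i.
  have SQ z : S (inP (q z)) by apply/qS; exists z.
  have HN : submodule (fun n => S (@inP i (0, n))).
    split; first by apply/qS; exists 0; apply: linear0.
    move=> a x y /qS[x' x'E] /qS[y' y'E]; apply/qS; exists (a *: x' + y').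
    by rewrite linearP x'E y'E; congr (_, _); rewrite /= scaler0 addr0.
  exists (subm HN).
  have [|k kE] := lin_factor (i := Zi K i) (f := j i \o Zi K' i) (@Zi_inj _ K i).
    by move=> c; apply: ZiE; rewrite /= -jd Zi0 linear0.
  pose D : lmodType R := (Zc K' i * subm HN)%type.
  have mL : linear (fun c : D => (k c.1, sub_incl HN c.2) : P i).
    by move=> a x y; congr (_, _); rewrite linearP.
  have Sm (c : D) : S (@inP i (mklin mL c)).
    have /qS[x xE] : S (@inP i (k c.1, 0)) by apply: SZP; rewrite kE; apply: Sg.
    have /qS[y yE] : S (@inP i (0, sub_incl HN c.2)) by exact: (sub_inclP c.2).
    apply/qS; exists (x + y); rewrite linearD xE yE.
    by congr (_, _); rewrite /= ?addr0 ?add0r.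
  have [h hE] := lin_factor qI (fun c => proj1 (qS _) (Sm c)).
  apply: (Giso (f := h)) GQ.
    move=> [c n] [c' n'] E; have := congr1 q E; rewrite !hE => -[E1 /sub_incl_inj ->].
    congr (_, _); apply: (@Zi_inj _ K'); apply: jI.
    by rewrite -[LHS]kE -[RHS]kE E1.
  move=> x; have [S1 S2] := SPZ i (q x) (SQ x).
  have [n nE] := proj1 (sub_inclE HN _) S2.
  have [z zE] := proj1 (gS _ _) S1.
  have [|c cE] := @ZiE _ K' i (z, (Zi K i (q x).1).2).
    apply: jI; rewrite jd linear0 -[RHS](Zi0 (q x).1); congr (cd K i _).
    apply: pair_eq; [exact: zE | by []].
  exists (c, n); apply: qI; rewrite hE; apply: pair_eq => /=; last exact: nE.
  apply: (@Zi_inj _ K); apply: etrans (kE c) _; apply: etrans (congr1 (j i) cE) _.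
  by apply: pair_eq; [exact: zE | by []].
exists (@Roof R _ _ X Y C GZ' (comp_map (roof_den r) inc) AK' (comp_map (roof_num r) inc)), g.
split=> //; exists C, (comp_map (roof_den r) inc), inc, (id_map C); split=> //; exact: homotopic_refl.
Qed.

End Hull.

Lemma small_roof (r : groof) : exists (r' : groof) (E : forall i, T -> roof_mid r' i -> Prop),
  roof_equiv r r' /\ enumerates E.
Proof.
have [_ _ /dchoice[N GP]] := Ac_acycs Giso Gext (roof_denP r).
have /(@dchoice int)[WZ /dchoice[fZ HZ]] := fun i => Gcert (roof_midK r i).
have /(@dchoice int)[WP /dchoice[fP HP]] := fun i => Gcert (GP i).
have fZ_inj i : injective (fZ i) by case: (HZ i).
have fP_inj i : injective (fP i) by case: (HP i).
have [Phi PhiP] := finitary_roof_closed fZ_inj fP_inj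
  (fun i => proj2 (HZ i)) (fun i => proj2 (HP i)).
have [S [/PhiP cS [v vS]]] := small_hull Phi.
have [r' [f [rr' fI fS]]] := roof_closed_sub cS.
exists r', (fun i t z => v t = Some (inl (existT WZ i (fZ i (f i z))))); split=> //; split.
  by move=> i z; apply: vS.
move=> i t z z' -> E; apply/(fI i)/fZ_inj; exact: existT_inj (inl_inj (Some_inj E)).
Qed.

(** Only terms, scalars and elements of [X] and [Y] occur, so one type serves all fractions from [X]
    to [Y], however large their middle complexes. *)
Definition diagram_type : Type :=
  ((int -> R -> T -> T -> T -> Prop) * (int -> T -> T -> Prop) *
   (forall i, T -> X i -> Prop) * (forall i, T -> Y i -> Prop))%type.

Definition diagram (r : groof) (E : forall i, T -> roof_mid r i -> Prop) : diagram_type :=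
  (fun i a s t u => exists x y, [/\ E i s x, E i t y & E i u (a *: x + y)],
   fun i s t => exists2 x, E i s x & E _ t (cd (roof_mid r) i x),
   fun i t x => exists2 z, E i t z & roof_den r i z = x,
   fun i t y => exists2 z, E i t z & roof_num r i z = y).

Lemma diagram_eq (r r' : groof) (E : forall i, T -> roof_mid r i -> Prop)
    (E' : forall i, T -> roof_mid r' i -> Prop) :
  enumerates E -> enumerates E' -> diagram E = diagram E' -> roof_equiv r r'.
Proof.
move=> [Es Eu] [Es' Eu'] D.
have lin i a s t u x y : E i s x -> E i t y -> E i u (a *: x + y) ->
    exists x' y', [/\ E' i s x', E' i t y' & E' i u (a *: x' + y')].
  move=> sx ty uxy; have : (diagram E).1.1.1 i a s t u by exists x, y.
  by rewrite D.
have dif i s t x : E i s x -> E _ t (cd (roof_mid r) i x) ->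
    exists2 x', E' i s x' & E' _ t (cd (roof_mid r') i x').
  move=> sx tx; have : (diagram E).1.1.2 i s t by exists x.
  by rewrite D.
have den i t x : E i t x -> exists2 x', E' i t x' & roof_den r' i x' = roof_den r i x.
  move=> tx; have : (diagram E).1.2 i t (roof_den r i x) by exists x.
  by rewrite D.
have num i t x : E i t x -> exists2 x', E' i t x' & roof_num r' i x' = roof_num r i x.
  move=> tx; have : (diagram E).2 i t (roof_num r i x) by exists x.
  by rewrite D.
pose rel i x x' := exists2 t, E i t x & E' i t x'.
(* Coincidence of values is not a component of a diagram. It is recovered from the relation
   [1 *: x + 0 = x], which holds with either name of [x] as the result. *)
have rel_fun i x x' x'' : rel i x x' -> rel i x x'' -> x' = x''.
  move=> [s sx sx'] [t tx tx'']; have [z z0] := Es i 0.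
  have [|y' [w' [sy' zw' ty']]] := lin i 1 s z t x 0 sx z0; first by rewrite scale1r addr0.
  have [|y2 [w2 [sy2 zw2 sy2']]] := lin i 1 s z s x 0 sx z0; first by rewrite scale1r addr0.
  rewrite -(Eu' _ _ _ _ sx' sy') scale1r in ty'.
  rewrite -(Eu' _ _ _ _ sx' sy2) -(Eu' _ _ _ _ zw' zw2) scale1r in sy2'.
  rewrite (Eu' _ _ _ _ tx'' ty').
  exact: Eu' sx' sy2'.
have [f fE] : exists f : forall i, {linear roof_mid r i -> roof_mid r' i},
    forall i x, rel i x (f i x).
  apply: (@dchoice int (fun i => {linear roof_mid r i -> roof_mid r' i})
    (fun i f => forall x, rel i x (f x))) => i.
  apply: linear_of_rel => [x||a x y x' y' [s sx sx'] [t ty ty']].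
  - by have [t tx] := Es i x; have [x' tx' _] := den i t x tx; exists x', t.
  - exact: rel_fun.
  have [u uE] := Es i (a *: x + y); have [v [w [sv tw uvw]]] := lin _ _ _ _ _ _ _ sx ty uE.
  by exists u => //; rewrite (Eu' _ _ _ _ sx' sv) (Eu' _ _ _ _ ty' tw).
have fd i x : f (i + 1) (cd (roof_mid r) i x) = cd (roof_mid r') i (f i x).
  have [s sx sx'] := fE i x; have [t tx] := Es (i + 1) (cd (roof_mid r) i x).
  have [x' sx'' tx'] := dif i s t x sx tx; rewrite (Eu' _ _ _ _ sx' sx'').
  by apply: rel_fun (fE _ _) _; exists t.
pose F := @ChainMap R (roof_mid r) (roof_mid r') f fd.
exists (roof_mid r), (roof_den r), (id_map _), F; split.
- exact: roof_midK.
- exact: roof_denP.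
- exact: homotopic_refl.
- apply: homotopic_refl => i x; have [t tx tx'] := fE i x; have [x' tx'' <-] := den i t x tx.
  by rewrite /= (Eu' _ _ _ _ tx' tx'').
- apply: homotopic_refl => i x; have [t tx tx'] := fE i x; have [x' tx'' xE] := num i t x tx.
  by rewrite /= (Eu' _ _ _ _ tx' tx'').
Qed.

(** A class has many small representatives and enumerations, so the invariant collects the diagrams
    of all of them. *)
Definition diagrams (r : groof) (D : diagram_type) : Prop :=
  exists (r' : groof) (E : forall i, T -> roof_mid r' i -> Prop),
    [/\ roof_equiv r r', enumerates E & diagram E = D].

Lemma diagramsP (r r' : groof) : diagrams r = diagrams r' <-> roof_equiv r r'.
Proof.
have sym := @roof_equiv_sym R G X Y.
have trans (a b c : groof) := @roof_equiv_trans R G Giso Gext X Y a b c GX.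
split=> [E|rr'].
  have [r0 [E0 [rr0 en0]]] := small_roof r.
  have : diagrams r (diagram E0) by exists r0, E0.
  rewrite E => -[r1 [E1 [rr1 en1 D]]].
  apply: (trans _ _ _ rr0 _); apply: (trans _ _ _ _ (sym _ _ rr1)).
  by apply: diagram_eq en0 en1 _.
apply: funext => D; apply: propext; split=> -[r0 [E0 [rr0 en0 D0]]]; exists r0, E0; split=> //.
  exact: (trans _ _ _ (sym _ _ rr') rr0).
exact: (trans _ _ _ rr' rr0).
Qed.

End SmallRoofs.

Theorem certified_Hom_sets (R : pzRingType) (G : lmodType R -> Prop) :
  iso_closed G -> ext_closed G ->
  (forall X : complex R, exists U : Type,
     certified U G /\ exists e : {i & X i} -> code U, injective e) ->
  derived_category_has_Hom_sets G.
Proof.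
move=> Giso Gext HU X Y GX GY.
have [U [Gcert [eX eX_inj]]] := HU X.
(* The image of [diagrams] among the predicates on [diagram_type], hence a type in the universe of
   carriers. *)
exists {s : diagram_type U X Y -> Prop | exists r, s = @diagrams R G U X Y r}.
exists (fun r => exist _ (diagrams r) (ex_intro _ r erefl)); split.
  by move=> [s sr]; case: (sr) => r rE; exists r; apply: eq_exist; rewrite -rE.
move=> r r'; rewrite -(diagramsP Giso Gext Gcert GX eX_inj); split=> [/(congr1 sval)//|E].
exact: eq_exist.
Qed.

Theorem corollary11p3 (A B : pzRingType) (L : bicomplex A B) (d1 d2 l1 : int)
    (L_pseudo_dualizing : pseudo_dualizing L)
    (L_degrees : concentrated (lcomplex L) (- d1) d2)
    (le_d1_l1 : d1 <= l1) :
  derived_category_has_Hom_sets (Eclass L l1) /\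
  derived_category_has_Hom_sets (Fclass L l1).
Proof.
have Lp := pd_lperfect L_pseudo_dualizing; split; apply: certified_Hom_sets.
- exact: iso_closed_E.
- exact: ext_closed_E.
(* The codes depend on the source [X] but on no fraction; scalars serve the submodule rules,
   elements of [L] the tensor rule, and elements of [X] the cocycle rules. *)
- move=> X; exists (A + B + {i & L i} + {i & X i})%type; split; last first.
    by exists (fun x => CLeaf (inr x)) => x y [].
  apply: (certified_E Lp (eA := fun a => CLeaf (inl (inl (inl a))))
    (eB := fun b => CLeaf (inl (inl (inr b)))) (eL := fun x => CLeaf (inl (inr x)))).
  + by move=> x y [].
  + by move=> x y [].
  + by move=> x y [].
- exact: iso_closed_F.
- exact: ext_closed_F.
move=> X; exists (A + B + {i & L i} + {i & X i})%type; split; last first.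
  by exists (fun x => CLeaf (inr x)) => x y [].
apply: (certified_F Lp (eA := fun a => CLeaf (inl (inl (inl a))))
  (eB := fun b => CLeaf (inl (inl (inr b)))) (eL := fun x => CLeaf (inl (inr x)))).
- by move=> x y [].
- by move=> x y [].
- by move=> x y [].
Qed.
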